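(* Let $d\ge 3$ and $\alpha\in(-1,1)$ be such that $2/(1-\alpha)$ is not an integer, and let $\kappa$ be the smallest integer greater than $2/(1-\alpha)$. Suppose $$\frac{v_x}{v_y}\le\left(\frac{2}{1-\alpha}\right)^2\frac{d+2}{d}\,\frac{1-\{\kappa-2/(1-\alpha)\}}{2\kappa(\kappa-1)}.$$ Then the Bayesian predictive density with respect to the harmonic prior, $$\hat p_H(y\mid x;\alpha)=\frac{m_H^{1/\beta}(\gamma x+(1-\gamma)y,\,v_x\gamma)}{E_{Z_1}\!\left[m_H^{1/\beta}(x+\xi Z_1,\,v_x\gamma)\right]}\,\phi(y-x,v_y/\gamma),$$ satisfies $R_\alpha(\mu;\hat p_H)\le R_\alpha(\mu;\hat p_U)$ for every $\mu\in\mathbb{R}^d$, where $\hat p_U(y\mid x;\alpha)=\phi(y-x,v_y/\gamma)$.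
   Context: $v_x,v_y>0$ known; $X\sim N_d(\mu,v_xI)$, $Y\sim N_d(\mu,v_yI)$ independent; $\phi(\cdot,\sigma^2)$ is the $N_d(0,\sigma^2I)$ density. $\beta=(1-\alpha)/2$, $\gamma=1/(1+\beta v_x/v_y)$, $\xi=(1-\gamma)(v_y/\gamma)^{1/2}$, $Z_1\sim N_d(0,I)$. $m_H(w,v)=\int\phi(w-\mu,v)\|\mu\|^{-(d-2)}d\mu$. The $\alpha$-divergence loss is $D_\alpha=\int f_\alpha\!\left(\hat p(y\mid x)/\phi(y-\mu,v_y)\right)\phi(y-\mu,v_y)\,dy$ with $f_\alpha(z)=\frac{4}{1-\alpha^2}(1-z^{(1+\alpha)/2})$, and the risk is $R_\alpha(\mu;\hat p)=\int D_\alpha\,\phi(x-\mu,v_x)\,dx$. *)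

(* Defs.v *)
From HB Require Import structures.
From mathcomp Require Import all_boot all_order all_algebra.
From mathcomp Require Import all_classical all_reals all_analysis.
Set Implicit Arguments. Unset Strict Implicit. Unset Printing Implicit Defensive.
Import Order.TTheory GRing.Theory Num.Theory.
Import numFieldNormedType.Exports.
Local Open Scope ring_scope.
Local Open Scope ereal_scope.

Section Defs.
Variable R : realType.

(* Lebesgue integral over R^d, as the iterated one-dimensional Lebesgue
   integral over the coordinates.  [iint n F] integrates F over the
   coordinates 0..n-1 of a point (nat -> R) whose other coordinates are 0. *)
Fixpoint iint (n : nat) (F : (nat -> R) -> \bar R) : \bar R :=
  match n with
  | 0 => F (fun _ => 0%R)
  | n'.+1 => \int[@lebesgue_measure R]_(t in [set: R])
               iint n' (fun v => F (fun i => if i == n' then t else v i))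
  end.

Definition integral_Rd (d : nat) (f : 'rV[R]_d -> \bar R) : \bar R :=
  iint d (fun v => f (\row_(i < d) v (nat_of_ord i))).

Definition sqnorm (d : nat) (v : 'rV[R]_d) : R := (\sum_(i < d) (v 0 i) ^+ 2)%R.
Definition enorm (d : nat) (v : 'rV[R]_d) : R := Num.sqrt (sqnorm v).

Definition phi (d : nat) (v : 'rV[R]_d) (s2 : R) : R :=
  ((Num.sqrt (2 * pi * s2)) ^- d * expR (- sqnorm v / (2 * s2)))%R.

Definition m_H (d : nat) (w : 'rV[R]_d) (v : R) : R :=
  fine (integral_Rd (fun mu : 'rV[R]_d =>
          ((phi (w - mu) v) * (enorm mu) ^- (d - 2))%:E)).

Definition beta (alpha : R) : R := ((1 - alpha) / 2)%R.
Definition gamma (alpha vx vy : R) : R := (1 / (1 + beta alpha * vx / vy))%R.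
Definition xi (alpha vx vy : R) : R :=
  ((1 - gamma alpha vx vy) * Num.sqrt (vy / gamma alpha vx vy))%R.

Definition f_alpha (alpha z : R) : R :=
  (4 / (1 - alpha ^+ 2) * (1 - z `^ ((1 + alpha) / 2)))%R.

(* a predictive density is a function p y x = \hat p(y | x) *)
Definition D_alpha (d : nat) (alpha vy : R) (mu : 'rV[R]_d)
  (p : 'rV[R]_d -> 'rV[R]_d -> R) (x : 'rV[R]_d) : \bar R :=
  integral_Rd (fun y =>
    (f_alpha alpha (p y x / phi (y - mu) vy) * phi (y - mu) vy)%:E).

Definition risk_alpha (d : nat) (alpha vx vy : R) (mu : 'rV[R]_d)
  (p : 'rV[R]_d -> 'rV[R]_d -> R) : \bar R :=
  integral_Rd (fun x => D_alpha alpha vy mu p x * (phi (x - mu) vx)%:E).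

Definition p_U (d : nat) (alpha vx vy : R) (y x : 'rV[R]_d) : R :=
  phi (y - x) (vy / gamma alpha vx vy).

Definition EZ_mH (d : nat) (alpha vx vy : R) (x : 'rV[R]_d) : R :=
  fine (integral_Rd (fun z : 'rV[R]_d =>
    ((m_H (x + xi alpha vx vy *: z) (vx * gamma alpha vx vy)) `^ (1 / beta alpha)
      * phi z 1)%:E)).

Definition p_H (d : nat) (alpha vx vy : R) (y x : 'rV[R]_d) : R :=
  ((m_H (gamma alpha vx vy *: x + (1 - gamma alpha vx vy) *: y)
        (vx * gamma alpha vx vy)) `^ (1 / beta alpha)
   / EZ_mH alpha vx vy x * phi (y - x) (vy / gamma alpha vx vy))%R.

Definition fracpart (t : R) : R := (t - (Num.floor t)%:~R)%R.

End Defs.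

(* Main.v *)
Require Import Defs.
From HB Require Import structures.
From mathcomp Require Import all_boot all_order all_algebra.
From mathcomp Require Import all_classical all_reals all_analysis measurable_realfun.
From mathcomp Require Import ring lra.
Set Implicit Arguments. Unset Strict Implicit. Unset Printing Implicit Defensive.
Import Order.TTheory GRing.Theory Num.Theory.
Import numFieldNormedType.Exports.
Local Open Scope classical_set_scope.
Local Open Scope ring_scope.

(** Put [p = 1/beta], [v = vx * gamma], [r = |x|^2 / (2 v)].  Up to a constant the
    risk is minus an affinity, and completing the square (the density of
    [w = gamma x + (1 - gamma) y] factors out) reduces the claim to
    [1 <= m(w)^(p-1) * E_x[N(x)^(-(1-beta))]], where [m = m_H(., v)],
    [x ~ N(w, xi^2 I)] and [N(x) = E[m^p(x + xi Z)]].

    The harmonic marginal is a Gaussian mixture,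
    [m(w) = K * E exp(- r U)] with [U = V^(1/a)], [V] uniform and [a = (d-2)/2], so
    [m^kappa = K^kappa * E exp(- r S)] with [S] a sum of [kappa] independent copies
    of [U], and convolving it with a Gaussian of variance [v tau] gives the explicit
    mixture [A_tau(x)] of [gmix d tau r S].  Jensen's inequality bounds [N] by
    [K^p * A_tmax^(p/kappa)] with [xi^2 = v tmax], so it remains to see that
    [A_0^(-b)(w) <= E_x A_tmax^(-b)(x)] for [b = (p-1)/kappa].  This holds because
    [A_tau^(-b)] is a subsolution of the backward heat equation, that is,
    [A_tau^((1-b)/2)] is superharmonic for [tau <= tmax], which follows from Euler-type identities
    for the law of [S], two Chebyshev association inequalities, and the hypothesis on
    [vx / vy]. The flow is followed in discrete time, with an error quadratic in the
    step. *)


(** * Iterated integrals *)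

(** Integer powers matter because a product of mixtures of [exp (- r s)] is again such a mixture,
    with the convolved law. Taking [kappa > p] makes [t^(p/kappa)] concave, so Jensen bounds [N]
    from above, the right direction since [N] enters with a negative power. With
    [th = p - (kappa - 1)] one has [(1 + b) kappa = 2 (kappa - 1) + th]: at [tau = 0]
    superharmonicity holds with a surplus proportional to [th], and this surplus must absorb a
    moment that grows with [tau]. Hence [tmax] is bounded by a multiple of [th]; the factor
    [d/(d+2)] is [E U^2 / E U].

    Discrete time avoids differentiating [A_tau^(-b)] under the integrals. The convex map [y^(-b)]
    is bounded below by its tangent at a log-linear approximation of [A_tau] around [x], after which
    only explicit Gaussian integrals remain. The price is an error that grows exponentially in
    [|x|^2]; it is integrable along the whole flow because [b kappa tmax < 1], which also follows
    from the hypothesis on [vx / vy]. *)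

Section iterated_integral.
Variable R : realType.
Local Notation mu := (@lebesgue_measure R).
Local Open Scope ereal_scope.

Implicit Types F G : (nat -> R) -> \bar R.

Definition upd (v : nat -> R) n (t : R) : nat -> R :=
  fun i => if i == n then t else v i.

Lemma iintS n F : iint n.+1 F = \int[mu]_t iint n (fun v => F (upd v n t)).
Proof. by []. Qed.

(* Measurability in the first n coordinates is expressed on n.-tuple R. *)
Definition meas_coord n (F : (nat -> R) -> \bar R) :=
  measurable_fun setT (fun t : n.-tuple R => F (nth 0%R t)).

(** The arbitrary parameter space makes induction on the dimension possible: peeling off the last
    coordinate moves it into the parameter. *)
Definition meas_param n d (X : measurableType d) (F : X -> (nat -> R) -> \bar R) :=
  measurable_fun setT (fun p : X * n.-tuple R => F p.1 (nth 0%R p.2)).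

Lemma nth_rcons_upd n (t : n.-tuple R) (x : R) :
  nth 0%R (rcons t x) = upd (nth 0%R t) n x.
Proof.
apply/funext => i; rewrite nth_rcons /upd size_tuple.
case: ltngtP => // ni; by rewrite nth_default// size_tuple ltnW.
Qed.

Lemma measurable_rcons n d (X : measurableType d) (f : X -> n.-tuple R) (g : X -> R) :
  measurable_fun setT f -> measurable_fun setT g ->
  measurable_fun setT (fun x => [tuple of rcons (f x) (g x)]).
Proof.
move=> mf mg; apply/measurable_fun_tnthP => i /=.
rewrite (_ : _ \o _ = fun x => if (i < n)%N then nth 0%R (f x) i else g x); last first.
  apply/funext => x /=; rewrite (tnth_nth 0%R)/= nth_rcons size_tuple.
  case: ltngtP => // ni; have := ltn_ord i; by rewrite ltnS leqNgt ni.
case: ltnP => // ni.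
rewrite (_ : (fun _ => _) = (fun t => tnth t (Ordinal ni)) \o f); last first.
  by apply/funext => x /=; rewrite (tnth_nth 0%R).
apply: measurableT_comp => //; exact: measurable_tnth.
Qed.

Lemma meas_coord_upd n F : meas_coord n.+1 F ->
  @meas_param n _ R (fun t v => F (upd v n t)).
Proof.
move=> mF; rewrite /meas_param.
under eq_fun do rewrite -nth_rcons_upd.
apply: (measurableT_comp (f := fun t : n.+1.-tuple R => F (nth 0%R t))) => //.
exact: measurable_rcons.
Qed.

Lemma meas_param_upd n d (X : measurableType d) (F : X -> (nat -> R) -> \bar R) : meas_param n.+1 F ->
  @meas_param n _ (X * R)%type (fun p v => F p.1 (upd v n p.2)).
Proof.
move=> mF; rewrite /meas_param.
under eq_fun do rewrite -nth_rcons_upd.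
apply: (measurableT_comp (f := fun p : X * n.+1.-tuple R => F p.1 (nth 0%R p.2))
  (g := fun q : X * R * n.-tuple R => (q.1.1, [tuple of rcons q.2 q.1.2]))) => //.
apply: measurable_fun_pair.
  exact: measurableT_comp.
by apply: measurable_rcons => //; exact: measurableT_comp.
Qed.

Lemma meas_param_coord n d (X : measurableType d) (F : X -> (nat -> R) -> \bar R) x :
  meas_param n F -> meas_coord n (F x).
Proof.
move=> mF; apply: (measurableT_comp (g := fun t : n.-tuple R => (x, t)) mF).
exact: measurable_fun_pair.
Qed.

Lemma iint_ge0 n F : (forall v, 0 <= F v) -> 0 <= iint n F.
Proof.
elim: n F => [|n IH] F F0; first exact: F0.
rewrite iintS.
by apply: integral_ge0 => t _; exact: IH.
Qed.

Lemma measurable_iint n d (X : measurableType d) (F : X -> (nat -> R) -> \bar R) :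
  meas_param n F -> (forall x v, 0 <= F x v) ->
  measurable_fun setT (fun x => iint n (F x)).
Proof.
elim: n d X F => [|n IH] d X F mF F0.
  rewrite /=; rewrite (_ : (fun x => _) = (fun x => F x (nth 0%R [tuple])));
    last by apply/funext => x; congr (F x _); apply/funext => i; rewrite nth_nil.
  apply: (measurableT_comp (g := fun x : X => (x, [tuple])) mF).
  exact: measurable_fun_pair.
apply: (measurable_fun_fubini_tonelli_F (m2 := mu)
  (fun p : X * R => iint n (fun v => F p.1 (upd v n p.2)))) => //=.
- by apply: IH => //; exact: meas_param_upd.
- by move=> p; exact: iint_ge0.
Qed.

Lemma measurable_iint_coord n F : meas_coord n.+1 F -> (forall v, 0 <= F v) ->
  measurable_fun setT (fun t => iint n (fun v => F (upd v n t))).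
Proof. by move=> mF F0; apply: measurable_iint => //; exact: meas_coord_upd. Qed.

Lemma le_iint n F G : meas_coord n F -> meas_coord n G ->
  (forall v, 0 <= F v) -> (forall v, F v <= G v) -> iint n F <= iint n G.
Proof.
elim: n F G => [|n IH] F G mF mG F0 FG; first exact: FG.
rewrite !iintS; apply: ge0_le_integral => //.
- by move=> t _; exact: iint_ge0.
- exact: measurable_iint_coord.
- by apply: measurable_iint_coord => // v; exact: le_trans (F0 v) (FG v).
- move=> t _; apply: IH => //.
  + exact: (meas_param_coord t (meas_coord_upd mF)).
  + exact: (meas_param_coord t (meas_coord_upd mG)).
Qed.

Lemma iintZl n F (k : R) : meas_coord n F -> (forall v, 0 <= F v) -> (0 <= k)%R ->
  iint n (fun v => k%:E * F v) = k%:E * iint n F.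
Proof.
elim: n F => [|n IH] F mF F0 k0 //.
rewrite !iintS -ge0_integralZl_EFin//; last 2 first.
- by move=> t _; exact: iint_ge0.
- exact: measurable_iint_coord.
apply: eq_integral => t _; rewrite IH//.
exact: (meas_param_coord t (meas_coord_upd mF)).
Qed.

Lemma iintD n F G : meas_coord n F -> meas_coord n G ->
  (forall v, 0 <= F v) -> (forall v, 0 <= G v) ->
  iint n (fun v => F v + G v) = iint n F + iint n G.
Proof.
elim: n F G => [|n IH] F G mF mG F0 G0 //.
rewrite !iintS -ge0_integralD//; last 4 first.
- by move=> t _; exact: iint_ge0.
- exact: measurable_iint_coord.
- by move=> t _; exact: iint_ge0.
- exact: measurable_iint_coord.
apply: eq_integral => t _; rewrite IH//.
- exact: (meas_param_coord t (meas_coord_upd mF)).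
- exact: (meas_param_coord t (meas_coord_upd mG)).
Qed.

Lemma iint_fubini n d (X : measurableType d) (F : X -> (nat -> R) -> \bar R)
    (m : {sigma_finite_measure set X -> \bar R}) :
  meas_param n F -> (forall x v, 0 <= F x v) ->
  \int[m]_x iint n (F x) = iint n (fun v => \int[m]_x F x v).
Proof.
elim: n F => [//|n IH] F mF F0.
rewrite iintS; under eq_integral do rewrite iintS.
rewrite (fubini_tonelli (m1 := m) (m2 := mu)
  (fun p : X * R => iint n (fun v => F p.1 (upd v n p.2))))//=; last 2 first.
- by apply: measurable_iint => //; exact: meas_param_upd.
- by move=> p; exact: iint_ge0.
apply: eq_integral => t _; rewrite IH//.
have := meas_param_upd mF; rewrite /meas_param => h.
apply: (measurableT_comp (g := fun p : X * n.-tuple R => (p.1, t, p.2)) h).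
by do 2 (apply: measurable_fun_pair => //).
Qed.

Definition meas_coord2 n m (F : (nat -> R) -> (nat -> R) -> \bar R) :=
  measurable_fun setT
    (fun p : n.-tuple R * m.-tuple R => F (nth 0%R p.1) (nth 0%R p.2)).

Lemma iint_swap n m (F : (nat -> R) -> (nat -> R) -> \bar R) : meas_coord2 n m F -> (forall v u, 0 <= F v u) ->
  iint n (fun v => iint m (F v)) = iint m (fun u => iint n (F^~ u)).
Proof.
elim: n F => [//|n IH] F mF F0.
have mFu : measurable_fun setT (fun q : R * n.-tuple R * m.-tuple R =>
    F (upd (nth 0%R q.1.2) n q.1.1) (nth 0%R q.2)).
  under eq_fun do rewrite -nth_rcons_upd.
  apply: (measurableT_comp (g := fun q : R * n.-tuple R * m.-tuple R =>
    ([tuple of rcons q.1.2 q.1.1], q.2)) mF).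
  apply: measurable_fun_pair => //.
  by apply: measurable_rcons; exact: measurableT_comp.
rewrite iintS (_ : (fun u => iint n.+1 _) =
  (fun u => \int[mu]_t iint n (fun v => F (upd v n t) u)))//.
rewrite -iint_fubini//; last 2 first.
- apply: (@measurable_iint n _ (R * m.-tuple R)%type
     (fun q v => F (upd v n q.1) (nth 0%R q.2))) => //.
  rewrite /meas_param.
  apply: (measurableT_comp (g := fun q : (R * m.-tuple R) * n.-tuple R =>
    ((q.1.1, q.2), q.1.2)) mFu).
  apply: measurable_fun_pair; last exact: measurableT_comp.
  by apply: measurable_fun_pair => //; exact: measurableT_comp.
- by move=> t u; exact: iint_ge0.
apply: eq_integral => t _; rewrite IH//.
apply: (measurableT_comp (g := fun q : n.-tuple R * m.-tuple R =>
    ((t, q.1), q.2)) mFu).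
by apply: measurable_fun_pair => //; apply: measurable_fun_pair.
Qed.

(** The image of [c] times Lebesgue measure under [t |-> a + c t] agrees with Lebesgue measure on
    half-open intervals, hence everywhere. *)
Lemma ge0_integral_affine (f : R -> \bar R) (a c : R) : (0 < c)%R ->
  measurable_fun setT f -> (forall t, 0 <= f t) ->
  \int[mu]_t f t = c%:E * \int[mu]_t f (a + c * t)%R.
Proof.
move=> c0 mf f0.
have maff : measurable_fun setT (fun t : measurableTypeR R => (a + c * t)%R : measurableTypeR R).
  by apply: measurable_funD => //; exact: measurable_funM.
pose k : {nonneg R} := NngNum (ltW c0).
have -> : c%:E * \int[mu]_t f (a + c * t)%R = \int[mscale k mu]_t f (a + c * t)%R.
  by rewrite ge0_integral_mscale//; exact: (measurableT_comp mf maff).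
transitivity (\int[pushforward (mscale k mu)
    (fun t : measurableTypeR R => (a + c * t)%R : measurableTypeR R)]_t f t); last first.
  by rewrite (ge0_integral_pushforward maff)//; exact: preimage_setT.
apply: eq_measure_integral => A mA _.
apply: (@lebesgue_measure_unique R (pushforward (mscale k mu) _)) => //= _ [[x y]] _ <-.
rewrite /pushforward /mscale/= (_ : _ @^-1` _ = `]((x - a) / c)%R, ((y - a) / c)%R]%classic); last first.
  apply/seteqP; split => z /=; rewrite !in_itv/=.
    by rewrite ltr_pdivrMr// ler_pdivlMr// ltrBlDl lerBrDl mulrC.
  by rewrite ltr_pdivrMr// ler_pdivlMr// ltrBlDl lerBrDl mulrC.
rewrite !lebesgue_measure_itv/= !lte_fin ltr_pM2r ?invr_gt0// ltrD2r.
case: ifPn => _; last by rewrite mule0.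
rewrite -!EFinB -EFinM; congr EFin.
by rewrite mulrBr !(mulrCA c) divff ?gt_eqF// !mulr1 opprB addrA subrK.
Qed.

(** Coordinates of index at least [n] are 0 on the left and [a i] on the right, so [F] has to depend
    on the first [n] coordinates only. *)
Lemma iint_affine n F (a : nat -> R) (c : R) : (0 < c)%R ->
  (forall v w, (forall i, (i < n)%N -> v i = w i) -> F v = F w) ->
  meas_coord n F -> (forall v, 0 <= F v) ->
  iint n F = (c ^+ n)%:E * iint n (fun v => F (fun i => a i + c * v i)%R).
Proof.
move=> c0; elim: n F => [|n IH] F dF mF F0.
  by rewrite expr0 mul1e; exact: dF.
rewrite !iintS (ge0_integral_affine (a n) c0)//; last 2 first.
- exact: measurable_iint_coord.
- by move=> t; exact: iint_ge0.
have mF1 t := meas_param_coord t (meas_coord_upd mF).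
have dF1 t v w : (forall i, (i < n)%N -> v i = w i) ->
    F (upd v n t) = F (upd w n t).
  move=> vw; apply: dF => i; rewrite /upd ltnS leq_eqVlt.
  by case: eqVneq => //= _; exact: vw.
rewrite exprS EFinM -muleA; congr (_ * _).
have -> : \int[mu]_t iint n (fun v => F (fun i => (a i + c * upd v n t i)%R)) =
    \int[mu]_t iint n (fun v => F (upd (fun i => a i + c * v i)%R n (a n + c * t)%R)).
  apply: eq_integral => t _; congr (iint n _); apply/funext => v; congr F.
  by apply/funext => i; rewrite /upd; case: eqVneq => [->|].
rewrite -ge0_integralZl_EFin//; last 3 first.
- by move=> t _; exact: iint_ge0.
- apply: (@measurable_iint n _ R (fun t v => F (upd (fun i => a i + c * v i)%R n (a n + c * t)%R))) => //.
  rewrite /meas_param (_ : (fun p => _) = (fun p : R * n.-tuple R => F (nth 0%R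
      [tuple of rcons [tuple (a i + c * tnth p.2 i)%R | i < n] (a n + c * p.1)%R]))); last first.
    apply/funext => p; apply: dF => i.
    rewrite nth_rcons_upd /upd ltnS leq_eqVlt; case: eqVneq => //= _ ni.
    have := tnth_mktuple (fun i : 'I_n => (a i + c * tnth p.2 i)%R) (Ordinal ni).
    by rewrite !(tnth_nth 0%R)/= => ->.
  apply: (measurableT_comp (f := fun t : n.+1.-tuple R => F (nth 0%R t)) mF).
  apply: measurable_rcons.
    apply/measurable_fun_tnthP => i /=.
    rewrite (_ : _ \o _ = fun p : R * n.-tuple R => (a i + c * tnth p.2 i)%R); last first.
      by apply/funext => p /=; rewrite tnth_mktuple.
    apply: measurable_funD => //; apply: measurable_funM => //.
    apply: (measurableT_comp (f := fun t : n.-tuple R => tnth t i)) => //.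
    exact: measurable_tnth.
  by apply: measurable_funD => //; exact: measurable_funM.
- by rewrite exprn_ge0// ltW.
apply: eq_integral => t _; rewrite (IH (fun v => F (upd v n (a n + c * t)%R)))//; exact: dF1.
Qed.

(* Finiteness of every partial integral, which lets iterated integrals be
   subtracted. *)
Fixpoint iint_finite n (F : (nat -> R) -> \bar R) : Prop :=
  match n with
  | 0 => F (fun _ => 0%R) \is a fin_num
  | n'.+1 => (forall t, iint_finite n' (fun v => F (upd v n' t))) /\
             iint n F \is a fin_num
  end.

Lemma iint_finite_fin_num n F : iint_finite n F -> iint n F \is a fin_num.
Proof. by case: n => [|n] //= []. Qed.

Lemma le_iint_finite n F G : meas_coord n F -> meas_coord n G ->
  (forall v, 0 <= F v) -> (forall v, F v <= G v) ->
  iint_finite n G -> iint_finite n F.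
Proof.
elim: n F G => [|n IH] F G mF mG F0 FG /=.
  move=> G0; rewrite ge0_fin_numE// (le_lt_trans (FG _))//.
  by rewrite -ge0_fin_numE// (le_trans (F0 _) (FG _)).
move=> [Gt Gf]; split.
  move=> t; apply: (IH _ _ _ _ _ _ (Gt t)) => //.
  - exact: (meas_param_coord t (meas_coord_upd mF)).
  - exact: (meas_param_coord t (meas_coord_upd mG)).
have G0 v : 0 <= G v by exact: le_trans (F0 v) (FG v).
have iF0 : 0 <= iint n.+1 F by exact: iint_ge0.
have iG0 : 0 <= iint n.+1 G by exact: iint_ge0.
rewrite ge0_fin_numE// (le_lt_trans (le_iint mF mG F0 FG))//.
by rewrite -ge0_fin_numE.
Qed.

Lemma iintB n F G : meas_coord n F -> meas_coord n G ->
  (forall v, 0 <= F v) -> (forall v, 0 <= G v) ->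
  iint_finite n F -> iint_finite n G ->
  iint n (fun v => F v - G v) = iint n F - iint n G.
Proof.
elim: n F G => [|n IH] F G mF mG F0 G0 //= [Ft Ff] [Gt Gf].
rewrite -integralB//; last 2 first.
- apply/integrableP; split; first exact: measurable_iint_coord.
  under eq_integral do rewrite gee0_abs ?iint_ge0//.
  by move: Ff; rewrite ge0_fin_numE//; apply: integral_ge0 => t _; exact: iint_ge0.
- apply/integrableP; split; first exact: measurable_iint_coord.
  under eq_integral do rewrite gee0_abs ?iint_ge0//.
  by move: Gf; rewrite ge0_fin_numE//; apply: integral_ge0 => t _; exact: iint_ge0.
apply: eq_integral => t _; apply: (IH (fun v => F (upd v n t)) (fun v => G (upd v n t))) => //.
- exact: (meas_param_coord t (meas_coord_upd mF)).
- exact: (meas_param_coord t (meas_coord_upd mG)).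
Qed.

End iterated_integral.

(** * Integrals over row vectors *)

Section vector_integral.
Variables (R : realType) (d : nat).
Local Notation mu := (@lebesgue_measure R).
Local Open Scope ereal_scope.
Implicit Types f g : 'rV[R]_d -> \bar R.

Definition tvec (t : d.-tuple R) : 'rV[R]_d := \row_i tnth t i.

Lemma row_nth (t : d.-tuple R) : \row_(i < d) nth 0%R t i = tvec t.
Proof. by apply/rowP => i; rewrite !mxE (tnth_nth 0%R). Qed.

Definition meas_vec f := measurable_fun setT (f \o tvec).
Definition meas_pvec d0 (X : measurableType d0) (f : X -> 'rV[R]_d -> \bar R) :=
  measurable_fun setT (fun p : X * d.-tuple R => f p.1 (tvec p.2)).
Definition meas_vec2 (f : 'rV[R]_d -> 'rV[R]_d -> \bar R) :=
  measurable_fun setT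
    (fun p : d.-tuple R * d.-tuple R => f (tvec p.1) (tvec p.2)).

Lemma meas_vec_EFin (g : 'rV[R]_d -> R) :
  measurable_fun setT (fun t => g (tvec t)) -> meas_vec (fun x => (g x)%:E).
Proof. by move/measurable_EFinP. Qed.

Lemma meas_pvec_EFin d0 (X : measurableType d0) (g : X -> 'rV[R]_d -> R) :
  measurable_fun setT (fun p : X * d.-tuple R => g p.1 (tvec p.2)) ->
  meas_pvec (fun x y => (g x y)%:E).
Proof. by move/measurable_EFinP. Qed.

Lemma meas_vec2_EFin (g : 'rV[R]_d -> 'rV[R]_d -> R) :
  measurable_fun setT
    (fun p : d.-tuple R * d.-tuple R => g (tvec p.1) (tvec p.2)) ->
  meas_vec2 (fun x y => (g x y)%:E).
Proof. by move/measurable_EFinP. Qed.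

Lemma meas_vec_coord f : meas_vec f -> meas_coord d (fun v => f (\row_(i < d) v i)).
Proof. by rewrite /meas_vec /meas_coord; under [in X in _ -> X]eq_fun do rewrite row_nth. Qed.

Lemma meas_pvec_param d0 (X : measurableType d0) (f : X -> 'rV[R]_d -> \bar R) :
  meas_pvec f -> meas_param d (fun x v => f x (\row_(i < d) v i)).
Proof. by rewrite /meas_pvec /meas_param; under [in X in _ -> X]eq_fun do rewrite row_nth. Qed.

Lemma integral_Rd_ge0 f : (forall x, 0 <= f x) -> 0 <= integral_Rd f.
Proof. by move=> f0; exact: iint_ge0. Qed.

Lemma le_integral_Rd f g : meas_vec f -> meas_vec g ->
  (forall x, 0 <= f x) -> (forall x, f x <= g x) -> integral_Rd f <= integral_Rd g.
Proof. by move=> mf mg f0 fg; apply: le_iint => //; exact: meas_vec_coord. Qed.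

Lemma integral_RdZl f (k : R) : meas_vec f -> (forall x, 0 <= f x) -> (0 <= k)%R ->
  integral_Rd (fun x => k%:E * f x) = k%:E * integral_Rd f.
Proof. by move=> mf f0 k0; apply: iintZl => //; exact: meas_vec_coord. Qed.

Lemma integral_RdD f g : meas_vec f -> meas_vec g ->
  (forall x, 0 <= f x) -> (forall x, 0 <= g x) ->
  integral_Rd (fun x => f x + g x) = integral_Rd f + integral_Rd g.
Proof. by move=> mf mg f0 g0; apply: iintD => //; exact: meas_vec_coord. Qed.

Lemma measurable_integral_Rd d0 (X : measurableType d0) (f : X -> 'rV[R]_d -> \bar R) :
  meas_pvec f -> (forall x v, 0 <= f x v) ->
  measurable_fun setT (fun x => integral_Rd (f x)).
Proof. by move=> mf f0; apply: measurable_iint => //; exact: meas_pvec_param. Qed.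

Lemma meas_vec2_integral (f2 : 'rV[R]_d -> 'rV[R]_d -> \bar R) : meas_vec2 f2 -> (forall x y, 0 <= f2 x y) ->
  meas_vec (fun x => integral_Rd (f2 x)).
Proof.
by move=> mf f0; apply: (@measurable_integral_Rd _ (d.-tuple R) (fun t => f2 (tvec t))).
Qed.

Lemma integral_Rd_fubini d0 (X : measurableType d0) (f : X -> 'rV[R]_d -> \bar R)
    (m : {sigma_finite_measure set X -> \bar R}) :
  meas_pvec f -> (forall x v, 0 <= f x v) ->
  \int[m]_x integral_Rd (f x) = integral_Rd (fun v => \int[m]_x f x v).
Proof. by move=> mf f0; apply: iint_fubini => //; exact: meas_pvec_param. Qed.

Lemma integral_Rd_swap (f2 : 'rV[R]_d -> 'rV[R]_d -> \bar R) : meas_vec2 f2 -> (forall x y, 0 <= f2 x y) ->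
  integral_Rd (fun x => integral_Rd (f2 x)) = integral_Rd (fun y => integral_Rd (f2^~ y)).
Proof.
move=> mf f0; apply: (iint_swap (F := fun v u => f2 (\row_(i < d) v i) (\row_(i < d) u i))) => //.
by rewrite /meas_coord2; under eq_fun do rewrite !row_nth.
Qed.

Lemma integral_Rd_affine f (a : 'rV[R]_d) (c : R) : (0 < c)%R -> meas_vec f ->
  (forall x, 0 <= f x) ->
  integral_Rd f = (c ^+ d)%:E * integral_Rd (fun x => f (a + c *: x)%R).
Proof.
move=> c0 mf f0.
rewrite /integral_Rd (iint_affine (fun i => nth 0%R [seq a ord0 j | j <- enum 'I_d] i) c0)//.
- congr (_ * iint d _); apply/funext => v; congr f; apply/rowP => i.
  by rewrite !mxE (nth_map i) ?size_enum_ord// nth_ord_enum.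
- move=> v w vw; congr f; apply/rowP => i; rewrite !mxE; exact: vw.
- exact: meas_vec_coord.
Qed.

Definition Rd_finite f := iint_finite d (fun v => f (\row_(i < d) v i)).

Lemma le_Rd_finite f g : meas_vec f -> meas_vec g ->
  (forall x, 0 <= f x) -> (forall x, f x <= g x) -> Rd_finite g -> Rd_finite f.
Proof.
by move=> mf mg f0 fg; apply: le_iint_finite => //; exact: meas_vec_coord.
Qed.

Lemma integral_RdB f g : meas_vec f -> meas_vec g ->
  (forall x, 0 <= f x) -> (forall x, 0 <= g x) -> Rd_finite f -> Rd_finite g ->
  integral_Rd (fun x => f x - g x) = integral_Rd f - integral_Rd g.
Proof. by move=> mf mg f0 g0 ff fg; apply: iintB => //; exact: meas_vec_coord. Qed.

Lemma Rd_finite_fin_num f : Rd_finite f -> integral_Rd f \is a fin_num.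
Proof. exact: iint_finite_fin_num. Qed.

Definition coord_meas d0 (X : measurableType d0) (g : X -> 'rV[R]_d) :=
  forall i, measurable_fun setT (fun x => g x ord0 i).

Section coord_meas.
Context d0 (X : measurableType d0).
Implicit Types u w : X -> 'rV[R]_d.

Lemma coord_measD u w : coord_meas u -> coord_meas w -> coord_meas (fun x => u x + w x)%R.
Proof.
move=> mu mw i; under eq_fun do rewrite mxE; exact: measurable_funD.
Qed.

Lemma coord_measN u : coord_meas u -> coord_meas (fun x => - u x)%R.
Proof.
move=> mu i; under eq_fun do rewrite mxE; exact: measurableT_comp.
Qed.

Lemma coord_measZ (c : R) u : coord_meas u -> coord_meas (fun x => c *: u x)%R.
Proof.
move=> mu i; under eq_fun do rewrite mxE; exact: measurable_funM.
Qed.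

Lemma coord_meas_cst (x : 'rV[R]_d) : coord_meas (fun _ : X => x).
Proof. by move=> i. Qed.

Lemma coord_meas_tvec (g : X -> d.-tuple R) : measurable_fun setT g ->
  coord_meas (fun x => tvec (g x)).
Proof.
move=> mg i; under eq_fun do rewrite mxE.
apply: (measurableT_comp (f := fun t : d.-tuple R => tnth t i)) => //.
exact: measurable_tnth.
Qed.

Lemma measurable_sqnorm u : coord_meas u -> measurable_fun setT (fun x => sqnorm (u x)).
Proof.
move=> mu; apply: measurable_sum => i; apply: measurable_funX; exact: mu.
Qed.

Lemma measurable_phi u (s2 : R) : coord_meas u ->
  measurable_fun setT (fun x => phi (u x) s2).
Proof.
move=> mu; apply: measurable_funM => //; apply: measurableT_comp => //.
apply: measurable_funM => //; apply: measurableT_comp => //.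
exact: measurable_sqnorm.
Qed.

Definition dot (q x : 'rV[R]_d) : R := (\sum_(i < d) q ord0 i * x ord0 i)%R.

Lemma measurable_dot q u : coord_meas u -> measurable_fun setT (fun x => dot q (u x)).
Proof.
move=> mu; apply: measurable_sum => i; apply: measurable_funM => //; exact: mu.
Qed.

End coord_meas.

Local Open Scope ring_scope.
Implicit Types p q x y : 'rV[R]_d.

Lemma sqnorm_ge0 x : 0 <= sqnorm x.
Proof. by apply: sumr_ge0 => i _; rewrite sqr_ge0. Qed.

Lemma sqnorm_DZ x q (c : R) :
  sqnorm (x + c *: q) = sqnorm x + 2 * c * dot q x + c ^+ 2 * sqnorm q.
Proof.
rewrite /sqnorm /dot !mulr_sumr -!big_split/=; apply: eq_bigr => i _.
rewrite !mxE; ring.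
Qed.

Lemma sqnormN x : sqnorm (- x) = sqnorm x.
Proof. by apply: eq_bigr => i _; rewrite mxE sqrrN. Qed.

Lemma sqnormB_sym x y : sqnorm (x - y) = sqnorm (y - x).
Proof. by rewrite -sqnormN opprB. Qed.

Lemma sqnormB y x : sqnorm (y - x) = sqnorm y - 2 * dot x y + sqnorm x.
Proof.
by rewrite -scaleN1r sqnorm_DZ sqrrN expr1n mul1r mulrN1 mulNr.
Qed.

Lemma sqnormZ (c : R) x : sqnorm (c *: x) = c ^+ 2 * sqnorm x.
Proof. by rewrite /sqnorm mulr_sumr; apply: eq_bigr => i _; rewrite mxE exprMn. Qed.

Lemma dotDr q x y : dot q (x + y) = dot q x + dot q y.
Proof. by rewrite /dot -big_split; apply: eq_bigr => i _; rewrite mxE mulrDr. Qed.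

Lemma dotNr q x : dot q (- x) = - dot q x.
Proof. by rewrite /dot -sumrN; apply: eq_bigr => i _; rewrite mxE mulrN. Qed.

Lemma dotDl p q x : dot (p + q) x = dot p x + dot q x.
Proof. by rewrite /dot -big_split; apply: eq_bigr => i _; rewrite mxE mulrDl. Qed.

Lemma dotZl (c : R) q x : dot (c *: q) x = c * dot q x.
Proof. by rewrite /dot mulr_sumr; apply: eq_bigr => i _; rewrite mxE mulrA. Qed.

Lemma dotC q x : dot q x = dot x q.
Proof. by apply: eq_bigr => i _; rewrite mulrC. Qed.

End vector_integral.

(** * Gaussian integrals *)

Section gaussian.
Variable R : realType.
Local Notation mu := (@lebesgue_measure R).

Lemma expR_sum_ord n (f : 'I_n -> R) : expR (\sum_i f i) = \prod_i expR (f i).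
Proof. by apply: (big_morph expR); [exact: expRD|exact: expR0]. Qed.

(** With prefactors written as exponentials of logarithms, an identity between products of Gaussians
    becomes an identity between exponents, which [field] settles. *)
Lemma sqrt_exprn n (x : R) : 0 < x -> Num.sqrt x ^+ n = expR (n%:R / 2 * ln x).
Proof.
move=> x0; rewrite -{1}(lnK x0); rewrite (_ : expR (ln x) = expR (ln x / 2) ^+ 2).
  rewrite sqrtr_sqr ger0_norm ?expR_ge0// -expRM_natl; congr expR; ring.
by rewrite -expRM_natl; congr expR; field.
Qed.

Lemma integral_gaussian1 (P q : R) : 0 < P ->
  (\int[mu]_x (expR (- (P / 2) * x ^+ 2 + q * x))%:E =
   (Num.sqrt (2 * pi / P) * expR (q ^+ 2 / (2 * P)))%:E)%E.
Proof.
move=> P0.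
have sP : 0 < Num.sqrt P^-1 by rewrite sqrtr_gt0 invr_gt0.
have peak0 : 0 < Num.sqrt (2 * pi / P).
  by rewrite sqrtr_gt0 divr_gt0// mulr_gt0// pi_gt0.
(* Completing the square: up to a constant this is the normal density of mean [q / P] and variance
   [1 / P]. *)
have E x : expR (- (P / 2) * x ^+ 2 + q * x) =
    Num.sqrt (2 * pi / P) * expR (q ^+ 2 / (2 * P)) * normal_pdf (q / P) (Num.sqrt P^-1) x.
  rewrite normal_pdfE ?gt_eqF//= /normal_peak /normal_fun.
  rewrite sqr_sqrtr ?invr_ge0 ?ltW//.
  have -> : P^-1 * pi *+ 2 = 2 * pi / P by rewrite -mulr_natr; ring.
  rewrite mulrACA divff ?gt_eqF// mul1r -expRD; congr expR.
  rewrite -mulr_natr; field; by rewrite gt_eqF.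
under eq_integral do rewrite E EFinM.
rewrite ge0_integralZl_EFin//; first by rewrite integral_normal_pdf mule1.
- by move=> x _; rewrite lee_fin normal_pdf_ge0.
- by apply/measurable_EFinP; exact: measurable_normal_pdf.
Qed.

Local Open Scope ereal_scope.

Lemma meas_coord_prod n (f : nat -> R -> R) : (forall i, measurable_fun setT (f i)) ->
  meas_coord n (fun v => (\prod_(i < n) f i (v i))%:E).
Proof.
move=> mf; apply/measurable_EFinP; apply: measurable_prod => i _.
apply: measurableT_comp => //.
rewrite (_ : (fun t => _) = (fun t : n.-tuple R => tnth t i)); last first.
  by apply/funext => t; rewrite (tnth_nth 0%R).
exact: measurable_tnth.
Qed.

Lemma prod_upd n (f : nat -> R -> R) v t :
  (\prod_(i < n.+1) f i (upd v n t i) = f n t * \prod_(i < n) f i (v i))%R.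
Proof.
rewrite big_ord_recr/= mulrC; congr (_ * _)%R.
  by rewrite /upd eqxx.
by apply: eq_bigr => i _; rewrite /upd ltn_eqF.
Qed.

Lemma iint_finiteZ n (F : (nat -> R) -> \bar R) (k : R) : meas_coord n F -> (forall v, 0 <= F v) -> (0 <= k)%R ->
  iint_finite n F -> iint_finite n (fun v => k%:E * F v).
Proof.
elim: n F => [|n IH] F mF F0 k0 /=; first by move=> ?; rewrite fin_numM.
move=> [Ft Ff]; split.
  move=> t; apply: IH => //; exact: (meas_param_coord t (meas_coord_upd mF)).
have := iintZl mF F0 k0; rewrite iintS => ->.
by rewrite fin_numM.
Qed.

Lemma iint_finiteD n (F G : (nat -> R) -> \bar R) : meas_coord n F -> meas_coord n G ->
  (forall v, 0 <= F v) -> (forall v, 0 <= G v) ->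
  iint_finite n F -> iint_finite n G -> iint_finite n (fun v => F v + G v).
Proof.
elim: n F G => [|n IH] F G mF mG F0 G0 /=; first by move=> ? ?; rewrite fin_numD; apply/andP.
move=> [Ft Ff] [Gt Gf]; split.
  move=> t; apply: IH => //.
  - exact: (meas_param_coord t (meas_coord_upd mF)).
  - exact: (meas_param_coord t (meas_coord_upd mG)).
have := iintD mF mG F0 G0; rewrite iintS => ->.
by rewrite fin_numD; apply/andP.
Qed.

Lemma iint_prod n (f : nat -> R -> R) (c : nat -> R) :
  (forall i, measurable_fun setT (f i)) -> (forall i t, 0 <= f i t)%R ->
  (forall i, \int[mu]_t (f i t)%:E = (c i)%:E) ->
  iint n (fun v => (\prod_(i < n) f i (v i))%:E) = (\prod_(i < n) c i)%:E /\
  iint_finite n (fun v => (\prod_(i < n) f i (v i))%:E).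
Proof.
move=> mf f0 fc; have p0 n' v : 0 <= (\prod_(i < n') f i (v i))%:E.
  by rewrite lee_fin; apply: prodr_ge0.
elim: n => [|n [IH IHf]]; first by rewrite /= !big_ord0.
have e t : iint n (fun v => (\prod_(i < n.+1) f i (upd v n t i))%:E) =
    (f n t)%:E * (\prod_(i < n) c i)%:E.
  under eq_fun do rewrite prod_upd EFinM.
  by rewrite iintZl// ?IH//; exact: meas_coord_prod.
have E : iint n.+1 (fun v => (\prod_(i < n.+1) f i (v i))%:E) = (\prod_(i < n.+1) c i)%:E.
  rewrite iintS; under eq_integral do rewrite e muleC.
  rewrite ge0_integralZl//.
  - by rewrite fc -EFinM big_ord_recr.
  - by apply/measurable_EFinP; exact: mf.
  - by move=> t _; rewrite lee_fin.
  - rewrite lee_fin; apply: prodr_ge0 => i _; rewrite -lee_fin -fc.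
    by apply: integral_ge0 => t _; rewrite lee_fin.
split=> //; split; last by move: E; rewrite iintS => ->.
move=> t; under eq_fun do rewrite prod_upd EFinM.
by apply: iint_finiteZ => //; exact: meas_coord_prod.
Qed.

Variable d : nat.
Implicit Types q x y : 'rV[R]_d.

Lemma integral_gaussian (P : R) q : (0 < P)%R ->
  integral_Rd (fun x => (expR (- (P / 2) * sqnorm x + dot q x))%:E) =
    (expR (d%:R / 2 * ln (2 * pi / P) + sqnorm q / (2 * P)))%:E /\
  Rd_finite (fun x => (expR (- (P / 2) * sqnorm x + dot q x))%:E).
Proof.
move=> P0; pose qn i := nth 0%R [seq q ord0 j | j <- enum 'I_d] i.
have qnE (i : 'I_d) : qn i = q ord0 i.
  by rewrite /qn (nth_map i) ?size_enum_ord// nth_ord_enum.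
pose f i t := expR (- (P / 2) * t ^+ 2 + qn i * t)%R.
have fE v : expR (- (P / 2) * sqnorm (\row_(i < d) v i) + dot q (\row_(i < d) v i)) =
   (\prod_(i < d) f i (v i))%R.
  rewrite -expR_sum_ord; congr expR; rewrite big_split/=; congr (_ + _)%R.
    by rewrite /sqnorm mulr_sumr; apply: eq_bigr => i _; rewrite mxE.
  by apply: eq_bigr => i _; rewrite mxE qnE.
have := @iint_prod d f (fun i => Num.sqrt (2 * pi / P) * expR (qn i ^+ 2 / (2 * P)))%R.
case.
- move=> i; apply: measurableT_comp => //; apply: measurable_funD.
    by apply: measurable_funM => //; exact: measurable_funX.
  exact: measurable_funM.
- by move=> i t; exact: expR_ge0.
- by move=> i; rewrite integral_gaussian1.
move=> E Ef; rewrite /integral_Rd /Rd_finite; under eq_fun do rewrite fE.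
split=> //; rewrite E; congr EFin.
rewrite big_split/= prodr_const card_ord sqrt_exprn; last first.
  by rewrite divr_gt0// mulr_gt0// pi_gt0.
rewrite expRD; congr (_ * _)%R; rewrite -expR_sum_ord; congr expR.
by rewrite /sqnorm mulr_suml; apply: eq_bigr => i _; rewrite qnE.
Qed.

Local Open Scope ring_scope.

Lemma phiE x (s2 : R) : 0 < s2 ->
  phi x s2 = expR (- (d%:R / 2 * ln (2 * pi * s2)) - sqnorm x / (2 * s2)).
Proof.
move=> s0; rewrite /phi sqrt_exprn ?mulr_gt0 ?pi_gt0// expRD -expRN.
by rewrite mulNr.
Qed.

Lemma phi_gt0 x (s2 : R) : 0 < s2 -> 0 < phi x s2.
Proof. by move=> s0; rewrite phiE// expR_gt0. Qed.

Lemma phi_sym x y (s2 : R) : phi (x - y) s2 = phi (y - x) s2.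
Proof. by rewrite /phi sqnormB_sym. Qed.

(** With [r = |x|^2 / (2 v)], this is the convolution of [exp (- s |x|^2 / (2 v))] with the centred
    Gaussian of variance [v tau]. It is used beyond that range too: [tau = -1] undoes a convolution,
    and negative [s] gives growing exponentials. *)
Definition gmix (tau r s : R) : R :=
  expR (- (d%:R / 2 * ln (1 + s * tau)) - r * (s / (1 + s * tau))).

Lemma gmix_gt0 tau r s : 0 < gmix tau r s. Proof. exact: expR_gt0. Qed.

(** The semigroup property in [tau] under an exponential tilt: the tilt by [q] moves the centre by
    [v e q]. Total mass, Laplace transform and convolution of Gaussians are later read off as
    special cases. *)
Lemma gaussian_gmix_integral (v e tau s : R) q x :
  0 < v -> 0 < e -> 0 < 1 + s * tau -> 0 < 1 + s * (tau + e) ->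
  integral_Rd (fun y => (phi (y - x) (v * e) * expR (dot q (y - x)) *
                         gmix tau (sqnorm y / (2 * v)) s)%:E) =
  (expR (v * e * sqnorm q / 2) *
   gmix (tau + e) (sqnorm (x + (v * e) *: q) / (2 * v)) s)%:E.
Proof.
move=> v0 e0 D0 D1.
(* The sum of the two precisions [1 / (v e)] and [s / (v (1 + s tau))]. *)
pose P := (1 + s * (tau + e)) / ((1 + s * tau) * (v * e)).
have ve0 : 0 < v * e by rewrite mulr_gt0.
have P0 : 0 < P by rewrite divr_gt0// mulr_gt0.
pose q' := q + (v * e)^-1 *: x.
pose K := expR (- (d%:R / 2 * ln (2 * pi * (v * e))) - (sqnorm x) / (2 * (v * e))
   - dot q x - (d%:R / 2 * ln (1 + s * tau))).
have E y : phi (y - x) (v * e) * expR (dot q (y - x)) * gmix tau (sqnorm y / (2 * v)) s =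
    K * expR (- (P / 2) * sqnorm y + dot q' y).
  rewrite phiE// -!expRD; congr expR.
  rewrite sqnormB dotDr dotNr dotDl dotZl (dotC x y) /P.
  field; by rewrite !gt_eqF.
under eq_fun do rewrite E EFinM.
rewrite integral_RdZl ?expR_ge0//; last first.
  apply: meas_vec_EFin; apply: measurableT_comp => //; apply: measurable_funD.
    by apply: measurable_funM => //; apply: measurable_sqnorm; apply: coord_meas_tvec.
  by apply: measurable_dot; exact: coord_meas_tvec.
rewrite (integral_gaussian q' P0).1 -EFinM; congr EFin; rewrite -!expRD; congr expR.
have lnE : ln (2 * pi / P) = ln (2 * pi * (v * e)) + ln (1 + s * tau) - ln (1 + s * (tau + e)).
  have p0 : 0 < 2 * pi :> R by rewrite mulr_gt0// pi_gt0.
  rewrite (_ : 2 * pi / P = 2 * pi * (v * e) * (1 + s * tau) / (1 + s * (tau + e))).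
    by rewrite ln_div ?posrE ?mulr_gt0 ?pi_gt0// lnM ?posrE ?mulr_gt0 ?pi_gt0.
  rewrite /P; field; by rewrite !gt_eqF.
rewrite lnE /q' !sqnorm_DZ (dotC q x) /P.
field; by rewrite !gt_eqF.
Qed.

End gaussian.

(** * The mixing law *)

Section mixing_measure.
Variable R : realType.
Local Notation mu := (@lebesgue_measure R).
Local Notation Rm := (measurableTypeR R).
Implicit Types f g : R -> R.

Definition root_map (a : R) (V : Rm) : Rm := V `^ a^-1.
Lemma measurable_root_map a : measurable_fun setT (root_map a).
Proof. exact: measurable_powR. Qed.
HB.instance Definition _ a :=
  isMeasurableFun.Build _ _ _ _ (root_map a) (measurable_root_map a).

Definition sum_map (p : Rm * Rm) : Rm := p.1 + p.2.
Lemma measurable_sum_map : measurable_fun setT sum_map.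
Proof. exact: measurable_funD. Qed.
HB.instance Definition _ := isMeasurableFun.Build _ _ _ _ sum_map measurable_sum_map.

Definition unif01 : probability Rm R := uniform_prob (@ltr01 R).

(* Law of V^(1/a), i.e. the density a u^(a-1) on [0,1]. *)
Definition nu1 (a : R) : probability Rm R := distribution unif01 (root_map a).

Fixpoint nu (a : R) (k : nat) : probability Rm R :=
  if k is k'.+1 then distribution (nu1 a \x nu a k')%E sum_map
  else @dirac _ Rm (0 : R) R.

(** Bounds are asked on [[0, N]] only, because expressions such as [1 / (1 + s tau)] may blow up at
    negative [s]. For a law carried by some [[0, N]] this suffices for integrability. *)
Definition locally_bounded f := measurable_fun setT f /\
  forall N : nat, exists C : R, forall s : R, 0 <= s <= N%:R -> `|f s| <= C.

Lemma lbd_cst c : locally_bounded (fun=> c).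
Proof. by split=> // N; exists `|c|. Qed.

Lemma lbd_id : locally_bounded id.
Proof. by split=> // N; exists N%:R => s /andP[s0 sN]; rewrite ger0_norm. Qed.

Lemma lbdD f g : locally_bounded f -> locally_bounded g ->
  locally_bounded (fun s => f s + g s).
Proof.
move=> [mf bf] [mg bg]; split; first exact: measurable_funD.
move=> N; have [C hC] := bf N; have [D hD] := bg N.
by exists (C + D) => s sN; rewrite (le_trans (ler_normD _ _))// lerD ?hC ?hD.
Qed.

Lemma lbdM f g : locally_bounded f -> locally_bounded g ->
  locally_bounded (fun s => f s * g s).
Proof.
move=> [mf bf] [mg bg]; split; first exact: measurable_funM.
move=> N; have [C hC] := bf N; have [D hD] := bg N.
by exists (C * D) => s sN; rewrite normrM ler_pM ?hC ?hD.
Qed.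

Lemma lbdZ (c : R) f : locally_bounded f -> locally_bounded (fun s => c * f s).
Proof. by move=> bf; apply: lbdM => //; exact: lbd_cst. Qed.

Lemma lbdN f : locally_bounded f -> locally_bounded (fun s => - f s).
Proof.
by move=> bf; under eq_fun do rewrite -mulN1r; exact: lbdZ.
Qed.

Lemma lbdB f g : locally_bounded f -> locally_bounded g ->
  locally_bounded (fun s => f s - g s).
Proof. by move=> bf bg; apply: lbdD => //; exact: lbdN. Qed.

Lemma lbd_shift f u : 0 <= u -> locally_bounded f -> locally_bounded (fun s => f (u + s)).
Proof.
move=> u0 [mf bf]; split.
  by apply: measurableT_comp => //; exact: measurable_funD.
move=> N; have [C hC] := bf (N + (Num.truncn u).+1)%N; exists C => s /andP[s0 sN].
apply: hC; rewrite addr_ge0//= natrD addrC lerD//.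
by rewrite ltW// truncnS_gt.
Qed.

Local Notation Esp m f := (\int[m]_s (f s)).

Definition supported (m : probability Rm R) (N : nat) :=
  m (~` `[0 : R, N%:R]%classic) = 0%E.

Section supported.
Variables (m : probability Rm R) (N : nat).
Hypothesis mN : supported m N.

Let mI : measurable (`[0 : R, N%:R]%classic : set Rm).
Proof. exact: measurable_itv. Qed.

Lemma supported_integrable f : locally_bounded f -> m.-integrable setT (EFin \o f).
Proof.
move=> [mf bf]; have [C hC] := bf N; apply/integrableP; split.
  exact/measurable_EFinP.
have C0 : 0 <= C by apply: le_trans (hC 0 _) => //; rewrite lexx/=.
apply: (@le_lt_trans _ _ (\int[m]_s (cst C%:E s))%E); last first.
  by rewrite integral_cst// [X in (_ * X)%E](@probability_setT _ _ _ m) mule1 ltry.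
apply: ae_ge0_le_integral => //.
- by do 2 apply: measurableT_comp => //.
exists (~` `[0, N%:R]%classic); split => //; first exact: measurableC.
move=> s /= h; rewrite in_itv/= => sN; apply: h => _.
by rewrite lee_fin hC.
Qed.

Lemma supported_restrict f : locally_bounded f ->
  \int[m]_s f s = \int[m]_(s in `[0, N%:R]) f s.
Proof.
move=> bf; rewrite /Rintegral (negligible_integral _ _ (supported_integrable bf) mN)//.
  by rewrite setTD setCK.
exact: measurableC.
Qed.

Lemma supported_integrableI f : locally_bounded f ->
  m.-integrable `[0, N%:R] (EFin \o f).
Proof. by move=> bf; apply: integrableS (supported_integrable bf). Qed.

Lemma supported_le f g : locally_bounded f -> locally_bounded g ->
  (forall s, 0 <= s <= N%:R -> f s <= g s) -> \int[m]_s f s <= \int[m]_s g s.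
Proof.
move=> bf bg fg; rewrite !supported_restrict//; apply: le_Rintegral => //.
- exact: supported_integrableI.
- exact: supported_integrableI.
Qed.

Lemma supported_eq f g : locally_bounded f -> locally_bounded g ->
  (forall s, 0 <= s <= N%:R -> f s = g s) -> \int[m]_s f s = \int[m]_s g s.
Proof.
move=> bf bg fg; rewrite !supported_restrict//; apply: eq_Rintegral => s.
by rewrite inE/= in_itv/=; exact: fg.
Qed.

Lemma supportedD f g : locally_bounded f -> locally_bounded g ->
  \int[m]_s (f s + g s) = \int[m]_s f s + \int[m]_s g s.
Proof. by move=> bf bg; rewrite RintegralD//; exact: supported_integrable. Qed.

Lemma supportedB f g : locally_bounded f -> locally_bounded g ->
  \int[m]_s (f s - g s) = \int[m]_s f s - \int[m]_s g s.
Proof. by move=> bf bg; rewrite RintegralB//; exact: supported_integrable. Qed.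

Lemma supportedZ (c : R) f : locally_bounded f ->
  \int[m]_s (c * f s) = c * \int[m]_s f s.
Proof. by move=> bf; rewrite RintegralZl//; exact: supported_integrable. Qed.

Lemma supported_cst (c : R) : \int[m]_s c = c.
Proof. by rewrite Rintegral_cst// [X in _ * fine X](@probability_setT _ _ _ m)/= mulr1. Qed.

(** Tonelli gives measurability of the integrals of the positive and the negative part
    separately. *)
Lemma measurable_Rintegral_param d0 (X : measurableType d0) (h : X -> R -> R) :
  measurable_fun setT (fun p : X * Rm => h p.1 p.2) ->
  measurable_fun setT (fun x => \int[m]_s h x s).
Proof.
move=> mh; apply: (measurableT_comp (f := fine)) => //.
pose p x := (\int[m]_s (fun s => (h x s)%:E)^\+ s)%E.
pose n x := (\int[m]_s (fun s => (h x s)%:E)^\- s)%E.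
rewrite (_ : (fun x => _) = (fun x => p x - n x)%E); last first.
  by apply/funext => x; rewrite integralE.
have mE : measurable_fun setT (fun p : X * Rm => (h p.1 p.2)%:E) by exact/measurable_EFinP.
apply: emeasurable_funB.
- have hm : measurable_fun setT (fubini_F m (fun q : X * Rm => (h q.1 q.2)%:E)^\+%E).
    by apply: measurable_fun_fubini_tonelli_F => //; exact: measurable_funepos.
  rewrite (_ : p = fubini_F m (fun q : X * Rm => (h q.1 q.2)%:E)^\+%E)//.
  by apply/funext => x; apply: eq_integral => s _; rewrite !funepos.unlock.
- have hm : measurable_fun setT (fubini_F m (fun q : X * Rm => (h q.1 q.2)%:E)^\-%E).
    by apply: measurable_fun_fubini_tonelli_F => //; exact: measurable_funeneg.
  rewrite (_ : n = fubini_F m (fun q : X * Rm => (h q.1 q.2)%:E)^\-%E)//.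
  by apply/funext => x; apply: eq_integral => s _; rewrite !funeneg.unlock.
Qed.

Lemma lbd_Rintegral f : locally_bounded f -> locally_bounded (fun u => \int[m]_s f (u + s)).
Proof.
move=> [mf bf]; split.
  apply: (@measurable_Rintegral_param _ Rm (fun u s => f (u + s))).
  by apply: measurableT_comp => //; exact: measurable_funD.
move=> M; have [C hC] := bf (M + N)%N; exists C => u /andP[u0 uM].
have bu := lbd_shift u0 (conj mf bf).
rewrite ler_norml; apply/andP; split.
  rewrite -(supported_cst (- C)); apply: supported_le => //; first exact: lbd_cst.
  move=> s /andP[s0 sN]; have := hC (u + s); rewrite ler_norml => /(_ _)/andP[]//.
  by rewrite addr_ge0//= natrD lerD.
rewrite -(supported_cst C); apply: supported_le => //; first exact: lbd_cst.
move=> s /andP[s0 sN]; have := hC (u + s); rewrite ler_norml => /(_ _)/andP[]//.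
by rewrite addr_ge0//= natrD lerD.
Qed.

Lemma lbd_Rintegralr f : locally_bounded f -> locally_bounded (fun u => \int[m]_s f (s + u)).
Proof.
by move=> bf; under eq_fun do under eq_Rintegral do rewrite addrC; exact: lbd_Rintegral.
Qed.

End supported.

Lemma lbd_shiftr f u : 0 <= u -> locally_bounded f -> locally_bounded (fun s => f (s + u)).
Proof. by move=> u0 bf; under eq_fun do rewrite addrC; exact: lbd_shift. Qed.

Variables (a : R) (a0 : 0 < a).

Lemma root_map01 V : 0 <= V <= 1 -> 0 <= root_map a V <= 1.
Proof.
move=> /andP[V0 V1]; rewrite powR_ge0/= /root_map.
have -> : 1 = 1 `^ a^-1 :> R by rewrite powR1.
by apply: ge0_ler_powR; rewrite ?nnegrE ?invr_ge0// ltW.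
Qed.

Lemma nu1_supported : supported (nu1 a) 1.
Proof.
rewrite /supported /nu1 /distribution /= /pushforward/=.
apply: (@subset_measure0 _ _ _ unif01 _ (~` `[0, 1]%classic)) => //=.
- rewrite -[X in measurable X]setTI; apply: measurable_root_map => //.
  by apply: measurableC; exact: measurable_itv.
- by apply: measurableC; exact: measurable_itv.
- move=> V /= h; rewrite in_itv/= => V01; apply: h; rewrite in_itv/=.
  exact: root_map01.
rewrite /unif01/= /uniform_prob integral0_eq// => x /= x01.
rewrite /uniform_pdf; case: ifPn => // h; exfalso; exact: x01.
Qed.

(** A sum outside [[0, k + 1]] forces one of its two summands out of its own interval, so the event
    lies in a union of two null sets. *)
Lemma nu_supported k : supported (nu a k) k.
Proof.
elim: k => [|k IH].
  rewrite /supported /= diracE memNset//= => h; apply: h.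
  by rewrite in_itv/= lexx.
rewrite /supported /= /distribution /pushforward/=.
have mC n : measurable (~` `[0, n%:R]%classic : set Rm).
  by apply: measurableC; exact: measurable_itv.
apply: (@subset_measure0 _ _ _ (nu1 a \x nu a k)%E _
   (((~` `[0, 1%:R]) `*` setT) `|` (setT `*` (~` `[0, k%:R])))%classic) => //=.
- rewrite -[X in measurable X]setTI; apply: measurable_sum_map => //.
- by apply: measurableU; apply: measurableX.
- move=> [u s] /= h; apply: contrapT => h2; apply: h.
  have [u1 s1] : `[0, 1%:R]%classic u /\ `[0, k%:R]%classic s.
    split; apply: contrapT => h3; apply: h2; [by left|by right].
  move: u1 s1; rewrite /= !in_itv/= => /andP[u0 u1] /andP[s0 s1].
  by rewrite addr_ge0//= -addn1 natrD addrC lerD.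
- rewrite measureU0//; [|exact: measurableX|exact: measurableX|].
  + transitivity (nu1 a (~` `[0%R, 1%:R%R]%classic) * nu a k setT)%E.
      exact: product_measure1E.
    by rewrite [X in (X * _)%E]nu1_supported mul0e.
  + transitivity (nu1 a setT * nu a k (~` `[0%R, k%:R%R]%classic))%E.
      exact: product_measure1E.
    by rewrite [X in (_ * X)%E]IH mule0.
Qed.

Lemma lbd_norm f : locally_bounded f -> locally_bounded (fun s => `|f s|).
Proof.
move=> [mf bf]; split; first exact: measurableT_comp.
by move=> N; have [C hC] := bf N; exists C => s sN; rewrite normr_id hC.
Qed.

Lemma integrable_sum_map k f : locally_bounded f ->
  (nu1 a \x nu a k)%E.-integrable setT (fun p : Rm * Rm => (f (p.1 + p.2))%:E).
Proof.
move=> bf; have mf : measurable_fun setT (fun p : Rm * Rm => (f (p.1 + p.2))%:E).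
  apply/measurable_EFinP; apply: (measurableT_comp (f := f)); first exact: bf.1.
  exact: measurable_funD.
have [C hC] := bf.2 k.+1.
apply/integrable12ltyP => //.
apply: (@le_lt_trans _ _ (\int[nu1 a]_u (cst C%:E u))%E); last first.
  by rewrite integral_cst// [X in (_ * X)%E](@probability_setT _ _ _ (nu1 a)) mule1 ltry.
have C0 : 0 <= C by apply: le_trans (hC 0 _) => //; rewrite lexx/=.
apply: ae_ge0_le_integral => //.
- by move=> u _; apply: integral_ge0.
- apply: (measurable_fun_fubini_tonelli_F (m2 := nu a k) (fun p : Rm * Rm => `|(f (p.1 + p.2))%:E|%E)) => //.
  exact: measurableT_comp.
exists (~` `[0, 1%:R]%classic); split => //.
- by apply: measurableC; exact: measurable_itv.
- exact: nu1_supported.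
move=> u /= h; rewrite in_itv/= => /andP[u0 u1]; apply: h => _.
apply: (@le_trans _ _ (\int[nu a k]_s (cst C%:E s))%E); last first.
  by rewrite integral_cst// [X in (_ * X)%E](@probability_setT _ _ _ (nu a k)) mule1.
apply: ae_ge0_le_integral => //.
- by apply/measurable_EFinP; exact: (lbd_norm (lbd_shift u0 bf)).1.
exists (~` `[0, k%:R]%classic); split => //.
- by apply: measurableC; exact: measurable_itv.
- exact: nu_supported.
move=> s /= h; rewrite in_itv/= => /andP[s0 s1]; apply: h => _.
by rewrite lee_fin hC// addr_ge0//= -addn1 natrD addrC lerD.
Qed.

Lemma nuS k f : locally_bounded f ->
  \int[nu a k.+1]_s f s = \int[nu1 a]_u \int[nu a k]_s f (u + s).
Proof.
move=> bf; rewrite /Rintegral [nu a k.+1]/= integral_distribution//; last 2 first.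
- by apply/measurable_EFinP; exact: bf.1.
- exact: integrable_sum_map.
rewrite -(integral12_prod_meas1 (integrable_sum_map k bf)).
congr fine; apply: ae_eq_integral => //.
- exact: (measurable_fubini_F (integrable_sum_map k bf)).
- apply/measurable_EFinP; exact: (lbd_Rintegral (nu_supported k) bf).1.
exists (~` `[0, 1%:R]%classic); split => //.
- by apply: measurableC; exact: measurable_itv.
- exact: nu1_supported.
move=> u /= h; rewrite in_itv/= => /andP[u0 u1]; apply: h => _.
rewrite /fubini_F/= fineK//.
exact: integrable_fin_num (supported_integrable (nu_supported k) (lbd_shift u0 bf)).
Qed.

(** The split of [nuS] with the new summand integrated first, the order in which a one-variable
    identity can be applied at fixed [s]. *)
Lemma nuSr k f : locally_bounded f ->
  \int[nu a k.+1]_s f s = \int[nu a k]_s \int[nu1 a]_u f (u + s).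
Proof.
move=> bf; rewrite /Rintegral [nu a k.+1]/= integral_distribution//; last 2 first.
- by apply/measurable_EFinP; exact: bf.1.
- exact: integrable_sum_map.
rewrite -(integral21_prod_meas1 (integrable_sum_map k bf)).
congr fine; apply: ae_eq_integral => //.
- exact: (measurable_fubini_G (integrable_sum_map k bf)).
- apply/measurable_EFinP; exact: (lbd_Rintegralr nu1_supported bf).1.
exists (~` `[0, k%:R]%classic); split => //.
- by apply: measurableC; exact: measurable_itv.
- exact: nu_supported.
move=> s /= h; rewrite in_itv/= => /andP[s0 s1]; apply: h => _.
rewrite /fubini_G/= fineK//.
exact: integrable_fin_num (supported_integrable nu1_supported (lbd_shiftr s0 bf)).
Qed.

Lemma nu0 f : locally_bounded f -> \int[nu a 0]_s f s = f 0.
Proof.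
move=> [mf _]; rewrite /Rintegral /= integral_dirac//; last exact/measurable_EFinP.
by rewrite diracT mul1e.
Qed.

End mixing_measure.

(** * Integration by parts for the mixing law *)

Section mixing_calculus.
Variable R : realType.
Local Notation mu := (@lebesgue_measure R).
Local Notation Rm := (measurableTypeR R).
Implicit Types (f g : R -> R) (h : R -> R -> R).

Definition locally_bounded2 h :=
  measurable_fun setT (fun p : Rm * Rm => h p.1 p.2) /\
  forall N : nat, exists C : R, forall u s : R,
    0 <= u <= N%:R -> 0 <= s <= N%:R -> `|h u s| <= C.

Lemma lbd2_add f : locally_bounded f -> locally_bounded2 (fun u s => f (u + s)).
Proof.
move=> [mf bf]; split.
  by apply: (measurableT_comp (f := f)) => //; exact: measurable_funD.
move=> N; have [C hC] := bf (N + N)%N; exists C => u s /andP[u0 uN] /andP[s0 sN].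
by apply: hC; rewrite addr_ge0//= natrD lerD.
Qed.

Lemma lbd2_fst f : locally_bounded f -> locally_bounded2 (fun u s => f u).
Proof.
move=> [mf bf]; split; first by apply: (measurableT_comp (f := f)).
by move=> N; have [C hC] := bf N; exists C => u s uN _; exact: hC.
Qed.

Lemma lbd2_snd f : locally_bounded f -> locally_bounded2 (fun u s => f s).
Proof.
move=> [mf bf]; split; first by apply: (measurableT_comp (f := f)).
by move=> N; have [C hC] := bf N; exists C => u s _ uN; exact: hC.
Qed.

Lemma lbd2M h k : locally_bounded2 h -> locally_bounded2 k ->
  locally_bounded2 (fun u s => h u s * k u s).
Proof.
move=> [mf bf] [mg bg]; split; first exact: measurable_funM.
move=> N; have [C hC] := bf N; have [D hD] := bg N.
by exists (C * D) => u s uN sN; rewrite normrM ler_pM ?hC ?hD.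
Qed.

Lemma lbd2_swap h : locally_bounded2 h -> locally_bounded2 (fun u s => h s u).
Proof.
move=> [mf bf]; split.
  apply: (measurableT_comp (g := fun p : Rm * Rm => (p.2, p.1)) mf).
  exact: measurable_fun_pair.
by move=> N; have [C hC] := bf N; exists C => u s uN sN; exact: hC.
Qed.

Lemma lbd2_sect h u : 0 <= u -> locally_bounded2 h -> locally_bounded (h u).
Proof.
move=> u0 [mf bf]; split.
  apply: (measurableT_comp (g := fun s : Rm => (u, s)) mf).
  exact: measurable_fun_pair.
move=> N; have [C hC] := bf (N + (Num.truncn u).+1)%N; exists C => s /andP[s0 sN].
apply: hC; rewrite ?u0 ?s0/= natrD.
  by rewrite (le_trans (ltW (truncnS_gt u)))// lerDr.
by rewrite (le_trans sN)// lerDl.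
Qed.

Section supported2.
Variables (m1 m2 : probability Rm R) (N1 N2 : nat).
Hypotheses (s1 : supported m1 N1) (s2 : supported m2 N2).

Lemma lbd2_Rintegral h : locally_bounded2 h -> locally_bounded (fun u => \int[m2]_s h u s).
Proof.
move=> bh; split; first by apply: measurable_Rintegral_param; exact: bh.1.
move=> M; have [C hC] := bh.2 (M + N2)%N; exists C => u /andP[u0 uM].
have bu := lbd2_sect u0 bh.
have hC' s : 0 <= s <= N2%:R -> `|h u s| <= C.
  move=> /andP[s0 sN]; apply: hC; rewrite ?u0 ?s0/= natrD.
    by rewrite (le_trans uM)// lerDl.
  by rewrite (le_trans sN)// lerDr.
rewrite ler_norml; apply/andP; split.
  rewrite -(supported_cst m2 (- C)); apply: (supported_le s2) => //; first exact: lbd_cst.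
  by move=> s sN; have := hC' s sN; rewrite ler_norml => /andP[].
rewrite -(supported_cst m2 C); apply: (supported_le s2) => //; first exact: lbd_cst.
by move=> s sN; have := hC' s sN; rewrite ler_norml => /andP[].
Qed.

Lemma supported_fubini_integrable h : locally_bounded2 h ->
  (m1 \x m2)%E.-integrable setT (fun p : Rm * Rm => (h p.1 p.2)%:E).
Proof.
move=> bh; have mf : measurable_fun setT (fun p : Rm * Rm => (h p.1 p.2)%:E).
  by apply/measurable_EFinP; exact: bh.1.
have [C hC] := bh.2 (N1 + N2)%N.
have C0 : 0 <= C by apply: le_trans (hC 0 0 _ _) => //; rewrite lexx/=.
apply/integrable12ltyP => //.
apply: (@le_lt_trans _ _ (\int[m1]_u (cst C%:E u))%E); last first.
  by rewrite integral_cst// [X in (_ * X)%E](@probability_setT _ _ _ m1) mule1 ltry.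
apply: ae_ge0_le_integral => //.
- by move=> u _; apply: integral_ge0.
- apply: (measurable_fun_fubini_tonelli_F (m2 := m2) (fun p : Rm * Rm => `|(h p.1 p.2)%:E|%E)) => //.
  exact: measurableT_comp.
exists (~` `[0, N1%:R]%classic); split => //.
  by apply: measurableC; exact: measurable_itv.
move=> u /= hu; rewrite in_itv/= => /andP[u0 u1]; apply: hu => _.
apply: (@le_trans _ _ (\int[m2]_s (cst C%:E s))%E); last first.
  by rewrite integral_cst// [X in (_ * X)%E](@probability_setT _ _ _ m2) mule1.
apply: ae_ge0_le_integral => //.
  by apply/measurable_EFinP; exact: (lbd_norm (lbd2_sect u0 bh)).1.
exists (~` `[0, N2%:R]%classic); split => //.
  by apply: measurableC; exact: measurable_itv.
move=> s /= hs; rewrite in_itv/= => /andP[s0 sN]; apply: hs => _.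
rewrite lee_fin hC// ?u0 ?s0/= natrD.
  by rewrite (le_trans u1)// lerDl.
by rewrite (le_trans sN)// lerDr.
Qed.

Lemma supported_fubini_half h : locally_bounded2 h ->
  \int[m1]_u \int[m2]_s h u s = fine (\int[m1 \x m2]_p (h p.1 p.2)%:E)%E.
Proof.
move=> bh; have ih := supported_fubini_integrable bh.
rewrite /Rintegral -(integral12_prod_meas1 ih); congr fine; apply: ae_eq_integral => //.
- apply/measurable_EFinP; exact: (lbd2_Rintegral bh).1.
- exact: (measurable_fubini_F ih).
exists (~` `[0, N1%:R]%classic); split => //.
  by apply: measurableC; exact: measurable_itv.
move=> u /= hu; rewrite in_itv/= => /andP[u0 u1]; apply: hu => _.
rewrite /fubini_F/= fineK//.
exact: integrable_fin_num (supported_integrable s2 (lbd2_sect u0 bh)).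
Qed.

End supported2.

Lemma supported_fubini (m1 m2 : probability Rm R) (N1 N2 : nat) h :
  supported m1 N1 -> supported m2 N2 -> locally_bounded2 h ->
  \int[m1]_u \int[m2]_s h u s = \int[m2]_s \int[m1]_u h u s.
Proof.
move=> s1 s2 bh; have ih := supported_fubini_integrable s1 s2 bh.
rewrite (supported_fubini_half s1 s2 bh) /Rintegral -(integral21_prod_meas1 ih).
congr fine; apply: ae_eq_integral => //.
- exact: (measurable_fubini_G ih).
- apply/measurable_EFinP; exact: (lbd2_Rintegral s1 (lbd2_swap bh)).1.
exists (~` `[0, N2%:R]%classic); split => //.
  by apply: measurableC; exact: measurable_itv.
move=> s /= hs; rewrite in_itv/= => /andP[u0 u1]; apply: hs => _.
rewrite /fubini_G/= fineK//.
exact: integrable_fin_num (supported_integrable s1 (lbd2_sect u0 (lbd2_swap bh))).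
Qed.

Variables (a : R) (a0 : 0 < a).

Lemma lbd_root f : locally_bounded f -> locally_bounded (fun V => f (root_map a V)).
Proof.
move=> [mf bf]; split.
  by apply: (measurableT_comp (f := f)) => //; exact: measurable_root_map.
move=> N; have [C hC] := bf (Num.truncn (root_map a N%:R)).+1; exists C => V /andP[V0 VN].
apply: hC; rewrite powR_ge0/=.
apply: le_trans (ltW (truncnS_gt _)).
by apply: ge0_ler_powR; rewrite ?nnegrE ?invr_ge0// ltW.
Qed.

Lemma unif01_supported : supported (unif01 R) 1.
Proof.
rewrite /supported /unif01/= /uniform_prob integral0_eq// => x /= x01.
by rewrite /uniform_pdf; case: ifPn => // h; exfalso; exact: x01.
Qed.

Lemma nu1E f : locally_bounded f ->
  \int[nu1 a]_u f u = \int[mu]_(V in `[0, 1]) f (root_map a V).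
Proof.
move=> bf; have iu := supported_integrable unif01_supported (lbd_root bf).
have mfr : measurable_fun setT (fun V : Rm => (f (root_map a V))%:E).
  by apply/measurable_EFinP; exact: (lbd_root bf).1.
rewrite /Rintegral /nu1 integral_distribution//; last first.
  by apply/measurable_EFinP; exact: bf.1.
pose h V := (f (root_map a V))%:E.
congr fine; transitivity (\int[unif01 R]_V h^\+ V - \int[unif01 R]_V h^\- V)%E.
  exact: integralE.
rewrite [RHS]integralE /unif01.
rewrite !integral_uniform//; last 2 first.
- exact: (measurable_funeneg mfr).
- exact: (measurable_funepos mfr).
by rewrite subr0 invr1 !mul1e.
Qed.

Lemma is_derive1_continuous f (df x : R) : is_derive x 1 f df -> {for x, continuous f}.
Proof.
by move=> [h _]; exact: (differentiable_continuous (proj1 (derivable1_diffP f x) h)).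
Qed.

Lemma is_derive1_mul f g (df dg x : R) : is_derive x 1 f df -> is_derive x 1 g dg ->
  is_derive x 1 (fun y => f y * g y) (df * g x + f x * dg).
Proof.
move=> hf hg; apply: (is_derive_eq (is_deriveM hf hg)).
by rewrite addrC; congr (_ + _); exact: mulrC.
Qed.

Lemma is_derive1_add f g (df dg x : R) : is_derive x 1 f df -> is_derive x 1 g dg ->
  is_derive x 1 (fun y => f y + g y) (df + dg).
Proof. by move=> hf hg; exact: is_deriveD. Qed.

Lemma is_derive1_compose f g (df dg x : R) : is_derive (g x) 1 f df -> is_derive x 1 g dg ->
  is_derive x 1 (fun y => f (g y)) (df * dg).
Proof. by move=> hf hg; exact: is_derive1_comp. Qed.

Lemma is_derive1_id (x : R) : is_derive x 1 (fun y : R => y) (1 : R).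
Proof. exact: is_derive_id. Qed.

Lemma is_derive1_const (c x : R) : is_derive x 1 (fun _ : R => c) (0 : R).
Proof. exact: is_derive_cst. Qed.

Definition smooth_pair f g := [/\ locally_bounded f, locally_bounded g,
  (forall s : R, 0 <= s -> is_derive s 1 f (g s)) &
  (forall s : R, 0 <= s -> {for s, continuous g})].

Lemma smooth_shift f g u : 0 <= u -> smooth_pair f g ->
  smooth_pair (fun s => f (u + s)) (fun s => g (u + s)).
Proof.
move=> u0 [bf bg df cg]; split; [exact: lbd_shift|exact: lbd_shift| |].
- move=> s s0; have us : 0 <= u + s by rewrite addr_ge0.
  apply: (is_derive_eq (is_derive1_compose (df _ us)
    (is_derive1_add (is_derive1_const u s) (is_derive1_id s)))).
  by rewrite add0r mulr1.
- move=> s s0; apply: continuous_comp; last by apply: cg; rewrite addr_ge0.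
  by apply: cvgD; [exact: cvg_cst|exact: cvg_id].
Qed.

(** Integration by parts against the density [a u^(a-1)]: the derivative of [u^a f] is
    [a u^(a-1) f + u^a g], and only the endpoint [u = 1] contributes. *)
Lemma nu1_euler f g (s0 : R) : 0 <= s0 -> smooth_pair f g ->
  a * \int[nu1 a]_u f (u + s0) + \int[nu1 a]_u (u * g (u + s0)) = a * f (1 + s0).
Proof.
move=> s00 [bf bg df cg].
have bf' := lbd_shiftr s00 bf; have bg' := lbd_shiftr s00 bg.
rewrite -(supportedZ (nu1_supported a0))// -(supportedD (nu1_supported a0)); last 2 first.
- exact: lbdZ.
- by apply: lbdM => //; exact: lbd_id.
rewrite nu1E; last by apply: lbdD; [exact: lbdZ|apply: lbdM => //; exact: lbd_id].
rewrite /root_map; pose u V := V `^ a^-1 : R.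
(* In the variable [V = u^a] the reference law is uniform and [F] is the primitive. *)
pose F V := a * (V * f (u V + s0)).
have ai : 0 < a^-1 by rewrite invr_gt0.
have u_cvg (Fl : set_system R) (FF : Filter Fl) (V : R) : 0 <= u V ->
    u x @[x --> Fl] --> u V -> x @[x --> Fl] --> V ->
    a * f (u x + s0) + u x * g (u x + s0) @[x --> Fl] --> a * f (u V + s0) + u V * g (u V + s0)
    /\ F x @[x --> Fl] --> F V.
  move=> u0 cu cx.
  have us : 0 <= u V + s0 by rewrite addr_ge0.
  have cs : u x + s0 @[x --> Fl] --> u V + s0 by apply: cvgD => //; exact: cvg_cst.
  have cf : f (u x + s0) @[x --> Fl] --> f (u V + s0).
    by apply: (cvg_comp _ _ cs); exact: is_derive1_continuous (df _ us).
  have cgs : g (u x + s0) @[x --> Fl] --> g (u V + s0).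
    by apply: (cvg_comp _ _ cs); exact: cg.
  split.
    by apply: cvgD; [apply: cvgM => //; exact: cvg_cst|exact: cvgM].
  by apply: cvgM; [exact: cvg_cst|exact: cvgM].
have du (V : R) : 0 < V -> is_derive V 1 u (a^-1 * V `^ (a^-1 - 1)).
  by move=> V0; exact: is_derive1_powR.
have cu (V : R) : 0 < V -> {for V, continuous u}.
  by move=> V0; exact: is_derive1_continuous (du V V0).
have u0 : u 0 = 0 by rewrite /u powR0// gt_eqF.
have dF (V : R) : 0 < V -> is_derive V 1 F (a * f (u V + s0) + u V * g (u V + s0)).
  move=> V0; have us : 0 <= u V + s0 by rewrite addr_ge0// powR_ge0.
  have d1 := du V V0; have d2 := df _ us.
  have d3 := is_derive1_compose (g := fun y => u y + s0) d2 (is_derive1_add d1 (is_derive1_const s0 V)).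
  apply: (is_derive_eq (is_derive1_mul (is_derive1_const a V)
    (is_derive1_mul (is_derive1_id V) d3))); rewrite mul0r add0r mul1r addr0 mulrDr; congr (_ + _).
  have -> : u V = V * V `^ (a^-1 - 1) by rewrite mulr_powRB1// ltW.
  field; by rewrite gt_eqF.
(* At [V = 0] the root need not be differentiable; the fundamental theorem asks only for continuity
   at the endpoints. *)
have cR0 : u x @[x --> 0^'+] --> u 0 by rewrite u0; exact: powR_cvg0.
have cL1 : u x @[x --> 1^'-] --> u 1 by apply: cvg_at_left_filter; exact: cu.
have u1 : 0 <= u 1 by exact: powR_ge0.
have [f0 F0] := u_cvg _ _ 0 (powR_ge0 _ _) cR0 (cvg_at_right_filter cvg_id).
have [f1 F1] := u_cvg _ _ 1 (powR_ge0 _ _) cL1 (cvg_at_left_filter cvg_id).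
rewrite /Rintegral (@continuous_FTC2 _ _ F)//.
- by rewrite /= /F /u powR1 mul1r mul0r mulr0 subr0.
- apply/continuous_within_itvP => //; split => // V; rewrite in_itv/= => /andP[V0 _].
  by have [] := u_cvg _ _ V (powR_ge0 _ _) (cu V V0) cvg_id.
- split => // V; rewrite in_itv/= => /andP[V0 _].
  by have [] := dF V V0.
- by move=> V; rewrite in_itv/= => /andP[V0 _]; rewrite derive1E; have [_ ->] := dF V V0.
Qed.

Local Notation I k f := (\int[nu a k]_s f s).
Local Notation J f := (\int[nu1 a]_u f u).

(** Each of the [k + 1] exchangeable summands gives one boundary term, in which it is frozen at 1.
    In the induction the factor is split as [u + s]: [nu1_euler] handles [u], and the induction
    hypothesis for the shifted function handles [s]. *)
Lemma nu_euler k f g : smooth_pair f g ->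
  \int[nu a k.+1]_s (s * g s) =
  a * k.+1%:R * (\int[nu a k]_s f (1 + s) - \int[nu a k.+1]_s f s).
Proof.
have S1 := nu1_supported a0; have Sk := nu_supported a0.
elim: k f g => [|k IH] f g sm; have [bf bg df cg] := sm.
  rewrite (nuSr a0 0 (f := fun s => s * g s)); last by apply: lbdM => //; exact: lbd_id.
  rewrite [in X in _ = _ * (_ - X)](nuSr a0 0)// !(nu0 a); last first.
  - by apply: (lbd_Rintegralr S1 (f := fun s => s * g s)); apply: lbdM => //; exact: lbd_id.
  - exact: lbd_shift.
  - exact: (lbd_Rintegralr S1).
  have := nu1_euler (lexx 0) sm.
  under [X in _ + X = _]eq_Rintegral do rewrite -[X in X * _]addr0.
  by move=> h; rewrite mulr1 mulrBr -h addrAC subrr add0r.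
have b1 : locally_bounded2 (fun u s => u * g (u + s)).
  by apply: lbd2M; [exact: lbd2_fst (lbd_id R)|exact: lbd2_add].
have b2 : locally_bounded2 (fun u s => s * g (u + s)).
  by apply: lbd2M; [exact: lbd2_snd (lbd_id R)|exact: lbd2_add].
have bsg : locally_bounded (fun s => s * g s) by apply: lbdM => //; exact: lbd_id.
rewrite nuS//.
transitivity (\int[nu1 a]_u (\int[nu a k.+1]_s (u * g (u + s)) + \int[nu a k.+1]_s (s * g (u + s)))).
  apply: (supported_eq S1).
  - exact: (lbd_Rintegral (Sk _) bsg).
  - by apply: lbdD; exact: (lbd2_Rintegral (Sk _)).
  move=> u /andP[u0 _]; rewrite -(supportedD (Sk _)); last 2 first.
  - exact: (lbd2_sect u0 b1).
  - exact: (lbd2_sect u0 b2).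
  by apply: eq_Rintegral => s _; rewrite mulrDl.
rewrite (supportedD S1); last 2 first.
- exact: (lbd2_Rintegral (Sk _) b1).
- exact: (lbd2_Rintegral (Sk _) b2).
have E1 : \int[nu1 a]_u \int[nu a k.+1]_s (u * g (u + s)) =
    a * \int[nu a k.+1]_s f (1 + s) - a * \int[nu a k.+2]_s f s.
  rewrite (supported_fubini S1 (Sk _) b1) (nuSr a0 k.+1 bf).
  rewrite -!(supportedZ (Sk _)) -?(supportedB (Sk _)); last first.
  - exact: lbd_shift.
  - exact: (lbd_Rintegralr S1).
  - by apply: lbdZ; exact: (lbd_Rintegralr S1).
  - by apply: lbdZ; exact: lbd_shift.
  apply: (supported_eq (Sk _)).
  - exact: (lbd2_Rintegral S1 (lbd2_swap b1)).
  - by apply: lbdB; apply: lbdZ; [exact: lbd_shift|exact: (lbd_Rintegralr S1)].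
  move=> s /andP[s0 _]; apply/eqP; rewrite -subr_eq opprK addrC.
  by rewrite nu1_euler// eqxx.
have E2 : \int[nu1 a]_u \int[nu a k.+1]_s (s * g (u + s)) =
    a * k.+1%:R * (\int[nu a k.+1]_s f (1 + s) - \int[nu a k.+2]_s f s).
  rewrite (nuS a0 k.+1 bf) (nuS a0 k (lbd_shift (ler01) bf)).
  have c1 : locally_bounded (fun u => \int[nu a k]_s f (1 + (u + s))).
    exact: (lbd_Rintegral (Sk _) (lbd_shift ler01 bf)).
  have c2 : locally_bounded (fun u => \int[nu a k.+1]_s f (u + s)).
    exact: (lbd_Rintegral (Sk _) bf).
  rewrite -(supportedB S1)// -(supportedZ S1); last exact: lbdB.
  apply: (supported_eq S1).
  - exact: (lbd2_Rintegral (Sk _) b2).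
  - by apply: lbdZ; exact: lbdB.
  move=> u /andP[u0 _]; rewrite (IH _ _ (smooth_shift u0 sm)).
  by congr (_ * (_ - _)); apply: eq_Rintegral => s _; rewrite addrCA.
rewrite E1 E2 -[k.+2%:R]natr1; ring.
Qed.

End mixing_calculus.

(** * Moment inequalities for the mixing law *)

Section moment_inequalities.
Variable R : realType.
Local Notation Rm := (measurableTypeR R).
Variables (a : R) (a0 : 0 < a).
Implicit Types f G : R -> R.

Let S1 := nu1_supported a0.
Let Sk := nu_supported a0.
Let lid := lbd_id R.

Lemma smooth_id : smooth_pair (fun s : R => s) (fun=> 1).
Proof.
split; [exact: lid|exact: lbd_cst| |].
- by move=> s _; exact: is_derive1_id.
- by move=> s _; exact: cvg_cst.
Qed.

Lemma smooth_sqr : smooth_pair (fun s : R => s * s) (fun s => s + s).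
Proof.
split; [exact: lbdM|exact: lbdD| |].
- move=> s _; apply: (is_derive_eq (is_derive1_mul (is_derive1_id s) (is_derive1_id s))).
  by rewrite mul1r mulr1.
- by move=> s _; apply: cvgD; exact: cvg_id.
Qed.

Lemma nu1_mean : \int[nu1 a]_u u = a / (a + 1).
Proof.
have := nu1_euler a0 (lexx 0) smooth_id.
under eq_Rintegral do rewrite addr0; under [X in _ + X = _]eq_Rintegral do rewrite mulr1.
move=> h; have a1 : a + 1 != 0 by rewrite gt_eqF// addr_gt0.
apply: (mulIf a1); rewrite divfK//; lra.
Qed.

Lemma nu1_mean_sqr : \int[nu1 a]_u (u * u) = a / (a + 2).
Proof.
have := nu1_euler a0 (lexx 0) smooth_sqr.
under eq_Rintegral do rewrite addr0.
under [X in _ + X = _]eq_Rintegral => u _ do rewrite addr0 -mulr2n -mulr_natl mulrCA.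
rewrite (supportedZ S1); last exact: lbdM.
move=> h; have a2 : a + 2 != 0 by rewrite gt_eqF// addr_gt0.
apply: (mulIf a2); rewrite divfK//; lra.
Qed.

(* Chebyshev's association inequality, via (c - u)(G u - G c) >= 0 with c
   chosen so that the integral of the weighted c - u vanishes. *)
Lemma nu1_pivot1 G : locally_bounded G ->
  (forall x y : R, 0 <= x -> x <= y -> G y <= G x) ->
  0 <= \int[nu1 a]_u ((a / (a + 1) - u) * G u).
Proof.
move=> bG dG; set c := a / (a + 1).
have c0 : 0 <= c by rewrite divr_ge0 ?addr_ge0// ltW.
have b1 : locally_bounded (fun u => c - u) by apply: lbdB => //; exact: lbd_cst.
apply: (@le_trans _ _ (\int[nu1 a]_u (G c * (c - u)))); last first.
  apply: (supported_le S1); [exact: lbdZ|exact: lbdM|].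
  move=> u /andP[u0 _]; have [uc|cu] := leP u c.
    by rewrite mulrC ler_wpM2l ?subr_ge0//; exact: dG.
  rewrite mulrC ler_wnM2l ?subr_le0//; first exact: ltW.
  by apply: dG => //; exact: ltW.
rewrite (supportedZ S1)// (supportedB S1)//; last exact: lbd_cst.
by rewrite supported_cst nu1_mean subrr mulr0.
Qed.

(** Here the weight is [u], so the pivot is [E U^2 / E U = (a + 1) / (a + 2)], for which the
    integral of [u (c - u)] vanishes. *)
Lemma nu1_pivot2 G : locally_bounded G ->
  (forall x y : R, 0 <= x -> x <= y -> G y <= G x) ->
  0 <= \int[nu1 a]_u (u * ((a + 1) / (a + 2) - u) * G u).
Proof.
move=> bG dG; set c := (a + 1) / (a + 2).
have c0 : 0 <= c by rewrite divr_ge0 ?addr_ge0// ltW.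
have b1 : locally_bounded (fun u => c - u) by apply: lbdB => //; exact: lbd_cst.
have b2 : locally_bounded (fun u => u * (c - u)) by exact: lbdM.
apply: (@le_trans _ _ (\int[nu1 a]_u (G c * (u * (c - u))))); last first.
  apply: (supported_le S1); [exact: lbdZ|exact: lbdM|].
  move=> u /andP[u0 _]; have [uc|cu] := leP u c.
    by rewrite mulrC ler_wpM2l ?mulr_ge0 ?subr_ge0//; exact: dG.
  rewrite mulrC ler_wnM2l//; first by rewrite mulr_ge0_le0// subr_le0 ltW.
  by apply: dG => //; exact: ltW.
have -> : \int[nu1 a]_u (G c * (u * (c - u))) = G c * (c * \int[nu1 a]_u u - \int[nu1 a]_u (u * u)).
  rewrite (supportedZ S1)//; congr (_ * _).
  rewrite -(supportedZ S1)// -(supportedB S1); [|exact: lbdZ|exact: lbdM].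
  by apply: eq_Rintegral => u _; rewrite mulrBr (mulrC u c).
rewrite nu1_mean nu1_mean_sqr (_ : c * _ - _ = 0) ?mulr0// /c.
have a1 : a + 1 != 0 by rewrite gt_eqF// addr_gt0.
have a2 : a + 2 != 0 by rewrite gt_eqF// addr_gt0.
by field; rewrite a1 a2.
Qed.

Let c := (a + 1) / (a + 2).

(** This is [E U <= E U^2 / E U]; it lets the single constant [c] serve in the first-order
    inequalities as well. *)
Lemma pivot_le : a / (a + 1) <= c.
Proof.
rewrite /c ler_pdivlMr ?addr_gt0// mulrAC ler_pdivrMr ?addr_gt0//; have := a0; nra.
Qed.

Lemma nu_pivot1 k G : locally_bounded G ->
  (forall x y : R, 0 <= x -> x <= y -> G y <= G x) -> (forall x : R, 0 <= x -> 0 <= G x) ->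
  0 <= \int[nu a k]_s ((k%:R * c - s) * G s).
Proof.
elim: k G => [|k IH] G bG dG G0.
  by rewrite (nu0 a) ?mul0r ?subrr ?mul0r//; apply: lbdM => //; apply: lbdB => //; exact: lbd_cst.
have bS : locally_bounded (fun s => (k.+1%:R * c - s) * G s).
  by apply: lbdM => //; apply: lbdB => //; exact: lbd_cst.
rewrite (nuS a0 k bS).
have b1 : locally_bounded2 (fun u s => (c - u) * G (u + s)).
  apply: lbd2M; last exact: lbd2_add.
  by apply: (@lbd2_fst _ (fun u => c - u)); apply: lbdB => //; exact: lbd_cst.
have b2 : locally_bounded2 (fun u s => (k%:R * c - s) * G (u + s)).
  apply: lbd2M; last exact: lbd2_add.
  by apply: (@lbd2_snd _ (fun u => k%:R * c - u)); apply: lbdB => //; exact: lbd_cst.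
have -> : \int[nu1 a]_u \int[nu a k]_s ((k.+1%:R * c - (u + s)) * G (u + s)) =
    \int[nu1 a]_u \int[nu a k]_s ((c - u) * G (u + s)) +
    \int[nu1 a]_u \int[nu a k]_s ((k%:R * c - s) * G (u + s)).
  rewrite -(supportedD S1); [|exact: (lbd2_Rintegral (Sk k) b1)|exact: (lbd2_Rintegral (Sk k) b2)].
  apply: (supported_eq S1).
  - exact: (lbd_Rintegral (Sk k) bS).
  - by apply: lbdD; [exact: (lbd2_Rintegral (Sk k) b1)|exact: (lbd2_Rintegral (Sk k) b2)].
  move=> u /andP[u0 _]; rewrite -(supportedD (Sk k)); [|exact: (lbd2_sect u0 b1)|exact: (lbd2_sect u0 b2)].
  by apply: eq_Rintegral => s _; rewrite -natr1; ring.
apply: addr_ge0.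
- rewrite (supported_fubini S1 (Sk k) b1) -[leLHS](supported_cst (nu a k)).
  apply: (supported_le (Sk k)); [exact: lbd_cst|exact: (lbd2_Rintegral S1 (lbd2_swap b1))|].
  move=> s /andP[s0 _].
  have bGs := lbd_shiftr s0 bG.
  apply: (@le_trans _ _ (\int[nu1 a]_u ((a / (a + 1) - u) * G (u + s)))).
    by apply: nu1_pivot1 => // x y x0 xy; apply: dG; rewrite ?addr_ge0// lerD2r.
  apply: (supported_le S1).
  + by apply: lbdM => //; apply: lbdB => //; exact: lbd_cst.
  + by apply: lbdM => //; apply: lbdB => //; exact: lbd_cst.
  by move=> u /andP[u0 _]; rewrite ler_wpM2r ?lerD2r ?pivot_le// G0// addr_ge0.
- rewrite -[leLHS](supported_cst (nu1 a)).
  apply: (supported_le S1); [exact: lbd_cst|exact: (lbd2_Rintegral (Sk k) b2)|].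
  move=> u /andP[u0 _]; apply: IH => //; first exact: lbd_shift.
    by move=> x y x0 xy; apply: dG; rewrite ?addr_ge0// lerD2l.
  by move=> x x0; rewrite G0// addr_ge0.
Qed.

(** With [s] replaced by [u + s], the polynomial splits as [u (c - u) + s (k c - s) + u (k c - s) +
    s (c - u)]. The first two terms are [nu1_pivot2] and the induction hypothesis; the cross terms
    need only the first-order inequalities, at fixed [u] or at fixed [s]. *)
Lemma nu_pivot2 k G : locally_bounded G ->
  (forall x y : R, 0 <= x -> x <= y -> G y <= G x) -> (forall x : R, 0 <= x -> 0 <= G x) ->
  0 <= \int[nu a k]_s (s * (k%:R * c - s) * G s).
Proof.
elim: k G => [|k IH] G bG dG G0.
  rewrite (nu0 a) ?mul0r//; apply: lbdM => //; apply: lbdM => //.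
  by apply: lbdB => //; exact: lbd_cst.
have bS : locally_bounded (fun s => s * (k.+1%:R * c - s) * G s).
  by apply: lbdM => //; apply: lbdM => //; apply: lbdB => //; exact: lbd_cst.
rewrite (nuS a0 k bS).
have bc : locally_bounded (fun u => c - u) by apply: lbdB => //; exact: lbd_cst.
have bk : locally_bounded (fun u => k%:R * c - u) by apply: lbdB => //; exact: lbd_cst.
have b1 : locally_bounded2 (fun u s => (u * (c - u)) * G (u + s)).
  apply: lbd2M; last exact: lbd2_add.
  by apply: (@lbd2_fst _ (fun u => u * (c - u))); exact: lbdM.
have b2 : locally_bounded2 (fun u s => (s * (k%:R * c - s)) * G (u + s)).
  apply: lbd2M; last exact: lbd2_add.
  by apply: (@lbd2_snd _ (fun u => u * (k%:R * c - u))); exact: lbdM.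
have b3 : locally_bounded2 (fun u s => u * ((k%:R * c - s) * G (u + s))).
  apply: lbd2M; first exact: (lbd2_fst lid).
  apply: lbd2M; last exact: lbd2_add.
  exact: (@lbd2_snd _ (fun u => k%:R * c - u)).
have b4 : locally_bounded2 (fun u s => s * ((c - u) * G (u + s))).
  apply: lbd2M; first exact: (lbd2_snd lid).
  apply: lbd2M; last exact: lbd2_add.
  exact: (@lbd2_fst _ (fun u => c - u)).
have li h : locally_bounded2 h -> locally_bounded (fun u => \int[nu a k]_s h u s).
  by move=> bh; exact: (lbd2_Rintegral (Sk k) bh).
have -> : \int[nu1 a]_u \int[nu a k]_s ((u + s) * (k.+1%:R * c - (u + s)) * G (u + s)) =
    (\int[nu1 a]_u \int[nu a k]_s ((u * (c - u)) * G (u + s)) +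
     \int[nu1 a]_u \int[nu a k]_s ((s * (k%:R * c - s)) * G (u + s))) +
    (\int[nu1 a]_u \int[nu a k]_s (u * ((k%:R * c - s) * G (u + s))) +
     \int[nu1 a]_u \int[nu a k]_s (s * ((c - u) * G (u + s)))).
  rewrite -!(supportedD S1); try (by apply: li); try (by apply: lbdD; apply: li).
  apply: (supported_eq S1).
  - exact: (lbd_Rintegral (Sk k) bS).
  - by apply: lbdD; apply: lbdD; apply: li.
  move=> u /andP[u0 _].
  have l2 h : locally_bounded2 h -> locally_bounded (h u) by move=> bh; exact: (lbd2_sect u0 bh).
  rewrite -!(supportedD (Sk k)); try (by apply: (l2 _ b1)); try (by apply: (l2 _ b2));
    try (by apply: (l2 _ b3)); try (by apply: (l2 _ b4));
    try (by apply: lbdD; [apply: (l2 _ b1)|apply: (l2 _ b2)]);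
    try (by apply: lbdD; [apply: (l2 _ b3)|apply: (l2 _ b4)]).
  by apply: eq_Rintegral => s _; rewrite -natr1; ring.
apply: addr_ge0; apply: addr_ge0.
- rewrite (supported_fubini S1 (Sk k) b1) -[leLHS](supported_cst (nu a k)).
  apply: (supported_le (Sk k)); [exact: lbd_cst|exact: (lbd2_Rintegral S1 (lbd2_swap b1))|].
  move=> s /andP[s0 _]; apply: nu1_pivot2; first exact: lbd_shiftr.
  by move=> x y x0 xy; apply: dG; rewrite ?addr_ge0// lerD2r.
- rewrite -[leLHS](supported_cst (nu1 a)).
  apply: (supported_le S1); [exact: lbd_cst|exact: li|].
  move=> u /andP[u0 _]; apply: IH => //; first exact: lbd_shift.
    by move=> x y x0 xy; apply: dG; rewrite ?addr_ge0// lerD2l.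
  by move=> x x0; rewrite G0// addr_ge0.
- rewrite -[leLHS](supported_cst (nu1 a)).
  apply: (supported_le S1); [exact: lbd_cst|exact: li|].
  move=> u /andP[u0 _]; rewrite (supportedZ (Sk k)); last first.
    by apply: lbdM => //; exact: lbd_shift.
  apply: mulr_ge0 => //; apply: nu_pivot1 => //; first exact: lbd_shift.
    by move=> x y x0 xy; apply: dG; rewrite ?addr_ge0// lerD2l.
  by move=> x x0; rewrite G0// addr_ge0.
- rewrite (supported_fubini S1 (Sk k) b4) -[leLHS](supported_cst (nu a k)).
  apply: (supported_le (Sk k)); [exact: lbd_cst|exact: (lbd2_Rintegral S1 (lbd2_swap b4))|].
  move=> s /andP[s0 _].
  have bGs := lbd_shiftr s0 bG.
  rewrite (supportedZ S1); last exact: lbdM.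
  apply: mulr_ge0 => //.
  apply: (@le_trans _ _ (\int[nu1 a]_u ((a / (a + 1) - u) * G (u + s)))).
    by apply: nu1_pivot1 => // x y x0 xy; apply: dG; rewrite ?addr_ge0// lerD2r.
  apply: (supported_le S1).
  + by apply: lbdM => //; apply: lbdB => //; exact: lbd_cst.
  + exact: lbdM.
  by move=> u /andP[u0 _]; rewrite ler_wpM2r ?lerD2r ?pivot_le// G0// addr_ge0.
Qed.

End moment_inequalities.

(** * Superharmonicity of the mixture *)

Section key_inequality.
Variable R : realType.
Local Notation Rm := (measurableTypeR R).

Lemma measurable_funinv d0 (X : measurableType d0) (f : X -> R) :
  measurable_fun setT f -> measurable_fun setT (fun x => (f x)^-1).
Proof.
(* [powR] with exponent -1 is the inverse on nonnegative bases, hence the square; at a zero of [f]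
   both sides are 0. *)
move=> mf; rewrite (_ : (fun x => _) = (fun x => f x * ((f x ^+ 2) `^ (-1)))); last first.
  apply/funext => x; rewrite powR_inv1 ?sqr_ge0// expr2 invfM.
  by have [->|f0] := eqVneq (f x) 0; rewrite ?invr0 ?mul0r// mulrA divff// mul1r.
apply: measurable_funM => //.
apply: (measurableT_comp (measurable_powR (-1))); exact: measurable_funX.
Qed.

Variable d : nat.

Definition den (tau s : R) : R := 1 + s * tau.
(** The exponential rate [s] after time [tau]. The mixture depends on [r] through
    [exp (- r * smap tau s)], so each derivative in [r] brings down a factor [- smap tau s]. *)
Definition smap (tau s : R) : R := s / (1 + s * tau).

Lemma measurable_gmix d0 (X : measurableType d0) (tau : R) (r s : X -> R) :
  measurable_fun setT r -> measurable_fun setT s ->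
  measurable_fun setT (fun x => gmix d tau (r x) (s x)).
Proof.
move=> mr ms; have mD : measurable_fun setT (fun x => 1 + s x * tau).
  by apply: measurable_funD => //; exact: measurable_funM.
apply: measurableT_comp => //; apply: measurable_funB.
  apply: measurableT_comp => //; apply: measurable_funM => //.
  exact: (measurableT_comp (@measurable_ln R)).
by apply: measurable_funM => //; apply: measurable_funM => //; exact: measurable_funinv.
Qed.

Variables (a : R) (a0 : 0 < a) (ad : d%:R / 2 = a + 1).
Variables (tau r : R) (tau0 : 0 <= tau) (r0 : 0 <= r).

Local Notation D := (den tau).
Local Notation sig := (smap tau).
Local Notation W := (gmix d tau r).
Local Notation S1 := (nu1_supported a0).
Local Notation Sk := (nu_supported a0).
Local Notation lid := (lbd_id R).

Lemma den_ge1 (s : R) : 0 <= s -> 1 <= D s.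
Proof. by move=> s0; rewrite lerDl mulr_ge0. Qed.

Lemma den_gt0 (s : R) : 0 <= s -> 0 < D s.
Proof. by move=> /den_ge1; exact: lt_le_trans. Qed.

Lemma smap_ge0 (s : R) : 0 <= s -> 0 <= sig s.
Proof. by move=> s0; rewrite divr_ge0// ltW// den_gt0. Qed.

Lemma smap_le (s : R) : 0 <= s -> sig s <= s.
Proof. by move=> s0; rewrite ler_pdivrMr ?den_gt0// ler_peMr// den_ge1. Qed.

Lemma gmix_le1 (s : R) : 0 <= s -> W s <= 1.
Proof.
move=> s0; rewrite -expR0 ler_expR subr_le0 (@le_trans _ _ 0)//.
  by rewrite oppr_le0 mulr_ge0// ln_ge0// den_ge1.
by rewrite mulr_ge0// smap_ge0.
Qed.

Lemma lbd_gmix : locally_bounded W.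
Proof.
split; first exact: measurable_gmix.
by move=> N; exists 1 => s /andP[s0 _]; rewrite ger0_norm ?gmix_le1// ltW ?gmix_gt0.
Qed.

Lemma lbd_smap : locally_bounded sig.
Proof.
split.
  apply: measurable_funM => //; apply: measurable_funinv.
  by apply: measurable_funD => //; exact: measurable_funM.
move=> N; exists N%:R => s /andP[s0 sN].
by rewrite ger0_norm ?smap_ge0// (le_trans (smap_le s0)).
Qed.

Lemma lbd_den : locally_bounded D.
Proof. by apply: lbdD; [exact: lbd_cst|apply: lbdM => //; [exact: lid|exact: lbd_cst]]. Qed.

Lemma lbd_invden : locally_bounded (fun s => (D s)^-1).
Proof.
split; first by apply: measurable_funinv; exact: lbd_den.1.
move=> N; exists 1 => s /andP[s0 _].
rewrite ger0_norm; last by rewrite invr_ge0 ltW// den_gt0.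
by rewrite invf_le1 ?den_ge1// den_gt0.
Qed.

Lemma lbd_denW : locally_bounded (fun s => D s * W s).
Proof. exact: lbdM lbd_den lbd_gmix. Qed.

Lemma lbd_sW : locally_bounded (fun s => s * W s).
Proof. exact: lbdM lid lbd_gmix. Qed.

Lemma lbd_sigW : locally_bounded (fun s => sig s * W s).
Proof. exact: lbdM lbd_smap lbd_gmix. Qed.

Lemma lbd_sig2W : locally_bounded (fun s => sig s ^+ 2 * W s).
Proof. by apply: lbdM lbd_gmix; exact: lbdM lbd_smap lbd_smap. Qed.

Lemma is_derive_den (s : R) : is_derive s 1 D tau.
Proof.
apply: (is_derive_eq (is_derive1_add (is_derive1_const 1 s)
  (is_derive1_mul (is_derive1_id s) (is_derive1_const tau s)))).
by rewrite add0r mul1r mulr0 addr0.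
Qed.

Lemma is_derive_invden (s : R) : 0 <= s ->
  is_derive s 1 (fun s => (D s)^-1) (- tau / D s ^+ 2).
Proof.
move=> s0; apply: (is_derive_eq (is_deriveV _ (is_derive_den s))).
  by rewrite gt_eqF// den_gt0.
by rewrite -[LHS]/(- D s ^- 2 * tau) mulNr mulrC mulNr.
Qed.

Lemma is_derive_gmix (s : R) : 0 <= s ->
  is_derive s 1 W (W s * (- (a + 1) * tau / D s - r / D s ^+ 2)).
Proof.
move=> s0; have Dn : D s != 0 by rewrite gt_eqF// den_gt0.
have d1 := is_derive1_compose (g := D) (is_derive1_ln (den_gt0 s0)) (is_derive_den s).
have d2 := is_derive1_mul (is_derive1_const (- (d%:R / 2)) s) d1.
have d3 := is_derive1_mul (is_derive1_const (- r) s)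
  (is_derive1_mul (is_derive1_id s) (is_derive_invden s0)).
have d4 := is_derive1_compose (g := fun y => - (d%:R / 2) * ln (D y) + - r * (y * (D y)^-1))
  (is_derive_expR _) (is_derive1_add d2 d3).
have -> : W = (fun y => expR (- (d%:R / 2) * ln (D y) + - r * (y * (D y)^-1))).
  by apply/funext => y; rewrite /gmix !mulNr.
apply: (is_derive_eq d4); congr (_ * _); rewrite ad.
rewrite /den in Dn *; by field.
Qed.

Lemma continuous_invden (s : R) : 0 <= s -> {for s, continuous (fun s => (D s)^-1)}.
Proof. by move=> s0; exact: is_derive1_continuous (is_derive_invden s0). Qed.

Lemma continuous_gmix (s : R) : 0 <= s -> {for s, continuous W}.
Proof. by move=> s0; exact: is_derive1_continuous (is_derive_gmix s0). Qed.

Lemma smooth_denW : smooth_pair (fun s => D s * W s)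
  (fun s => W s * (- (a * tau) + - r * (D s)^-1)).
Proof.
split; first exact: lbd_denW.
- apply: lbdM; first exact: lbd_gmix.
  by apply: lbdD; [exact: lbd_cst|exact: lbdZ lbd_invden].
- move=> s s0; apply: (is_derive_eq (is_derive1_mul (is_derive_den s) (is_derive_gmix s0))).
  have Dn : D s != 0 by rewrite gt_eqF// den_gt0.
  by move: (W s) (D s) Dn => w D Dn; field.
- move=> s s0; apply: cvgM; first exact: continuous_gmix.
  apply: cvgD; first exact: cvg_cst.
  by apply: cvgM; [exact: cvg_cst|exact: continuous_invden].
Qed.

Lemma smooth_sW : smooth_pair (fun s => s * W s)
  (fun s => W s + s * (W s * (- ((a + 1) * tau) * (D s)^-1 + - r * ((D s)^-1 * (D s)^-1)))).
Proof.
split; first exact: lbd_sW.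
- apply: lbdD; first exact: lbd_gmix.
  apply: lbdM; first exact: lid.
  apply: lbdM; first exact: lbd_gmix.
  by apply: lbdD; apply: lbdZ; [exact: lbd_invden|exact: lbdM lbd_invden lbd_invden].
- move=> s s0; apply: (is_derive_eq (is_derive1_mul (is_derive1_id s) (is_derive_gmix s0))).
  have Dn : D s != 0 by rewrite gt_eqF// den_gt0.
  by move: (W s) (D s) Dn => w D Dn; field.
- move=> s s0; apply: cvgD; first exact: continuous_gmix.
  apply: cvgM; first exact: cvg_id.
  apply: cvgM; first exact: continuous_gmix.
  apply: cvgD; apply: cvgM; [exact: cvg_cst|exact: continuous_invden|exact: cvg_cst|].
  by apply: cvgM; exact: continuous_invden.
Qed.

Lemma smap_diff (s : R) : 0 <= s -> s - sig s = tau * (s * sig s).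
Proof.
move=> s0; have : D s != 0 by rewrite gt_eqF// den_gt0.
by rewrite /smap /den => Dn; field.
Qed.

Variable k : nat.
Local Notation I f := (\int[nu a k.+1]_s f s).
Local Notation dI f := (\int[nu a k]_s f (1 + s)).

(** The choice [f = D W] is dictated by [d / 2 = a + 1]: the factor [D] lowers the power of the
    denominator to [a], and [s f'] becomes a combination of [s W] and [sig W] alone. *)
Lemma euler_denW :
  r * I (fun s => sig s * W s) = k.+1%:R * a * I W + a * tau * k%:R * I (fun s => s * W s)
    - a * k.+1%:R * dI (fun s => D s * W s).
Proof.
have := nu_euler a0 k smooth_denW.
have -> : I (fun s => s * (W s * (- (a * tau) + - r * (D s)^-1))) =
   - (a * tau) * I (fun s => s * W s) + - r * I (fun s => sig s * W s).
  rewrite -(supportedZ (Sk _) _ lbd_sW) -(supportedZ (Sk _) _ lbd_sigW).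
  rewrite -(supportedD (Sk _)); [|exact: lbdZ lbd_sW|exact: lbdZ lbd_sigW].
  apply: eq_Rintegral => s _; rewrite /smap -/(den tau s).
  by move: (W s) (D s)^-1 => w D; ring.
have -> : I (fun s => D s * W s) = I W + tau * I (fun s => s * W s).
  rewrite -(supportedZ (Sk _) _ lbd_sW) -(supportedD (Sk _) lbd_gmix); last exact: lbdZ lbd_sW.
  by apply: eq_Rintegral => s _; rewrite /den; move: (W s) => w; ring.
move: (I W) (I (fun s => s * W s)) (I (fun s => sig s * W s)) (dI (fun s => D s * W s)).
move=> x y z t; rewrite -natr1; move: (k%:R : R) => K h; lra.
Qed.

(** With [f = s W] the derivative produces [sig^2 W] and a mixed term [tau s sig W]; the latter is
    [(s - sig) W] by [smap_diff]. *)
Lemma euler_sW :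
  r * I (fun s => sig s ^+ 2 * W s) = a * k%:R * I (fun s => s * W s)
    + (a + 1) * I (fun s => sig s * W s) - a * k.+1%:R * dI (fun s => s * W s).
Proof.
have := nu_euler a0 k smooth_sW.
set L := \int[_]_s _.
have -> : L = - a * I (fun s => s * W s) + ((a + 1) * I (fun s => sig s * W s)
    + - r * I (fun s => sig s ^+ 2 * W s)).
  rewrite -(supportedZ (Sk _) _ lbd_sW) -(supportedZ (Sk _) _ lbd_sigW).
  rewrite -(supportedZ (Sk _) _ lbd_sig2W).
  rewrite -(supportedD (Sk _) (lbdZ _ lbd_sigW)); last exact: lbdZ lbd_sig2W.
  rewrite -(supportedD (Sk _) (lbdZ _ lbd_sW)); last first.
    by apply: lbdD; [exact: lbdZ lbd_sigW|exact: lbdZ lbd_sig2W].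
  apply: (supported_eq (Sk _)).
  - have [_ h _ _] := smooth_sW; exact: lbdM lid h.
  - apply: lbdD; first exact: lbdZ lbd_sW.
    by apply: lbdD; [exact: lbdZ lbd_sigW|exact: lbdZ lbd_sig2W].
  move=> s /andP[s0 _]; have : D s != 0 by rewrite gt_eqF// den_gt0.
  move: (W s) => w; rewrite /smap /den => Dn; by field.
move: (I (fun s => s * W s)) (I (fun s => sig s * W s)) (I (fun s => sig s ^+ 2 * W s)) (dI (fun s => s * W s)).
move=> x y z t; rewrite -natr1; move: (k%:R : R) => K h; lra.
Qed.

End key_inequality.

(** * Boundary and moment estimates for the superharmonicity inequality *)

Section superharmonicity.
Variable R : realType.
Local Notation Rm := (measurableTypeR R).
Variables (d : nat) (a : R) (a0 : 0 < a) (ad : d%:R / 2 = a + 1).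
Variables (tau r : R) (tau0 : 0 <= tau) (r0 : 0 <= r).

Local Notation D := (den tau).
Local Notation sig := (smap tau).
Local Notation W := (gmix d tau r).
Local Notation S1 := (nu1_supported a0).
Local Notation Sk := (nu_supported a0).
Local Notation lid := (lbd_id R).
Local Notation lW := (lbd_gmix d tau0 r0).
Local Notation lsW := (lbd_sW d tau0 r0).
Local Notation lsigW := (lbd_sigW d tau0 r0).
Local Notation lVW := (lbd_denW d tau0 r0).

Lemma smap_sub (x y : R) : 0 <= x -> 0 <= y -> sig y - sig x = (y - x) / (D x * D y).
Proof.
move=> x0 y0; have := den_gt0 tau0 x0; have := den_gt0 tau0 y0.
by rewrite /smap /den => h1 h2; field; rewrite !gt_eqF.
Qed.

Lemma smap_mono (x y : R) : 0 <= x -> x <= y -> sig x <= sig y.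
Proof.
move=> x0 xy; have y0 := le_trans x0 xy; rewrite -subr_ge0 smap_sub//.
by rewrite divr_ge0 ?subr_ge0// mulr_ge0// ltW// den_gt0.
Qed.

Lemma den_mono (x y : R) : x <= y -> D x <= D y.
Proof. by move=> xy; rewrite lerD2l ler_wpM2r. Qed.

Lemma gmix_anti (x y : R) : 0 <= x -> x <= y -> W y <= W x.
Proof.
move=> x0 xy; have y0 := le_trans x0 xy; rewrite ler_expR lerD// lerN2.
  rewrite ler_wpM2l// ?divr_ge0// ler_ln ?posrE ?den_gt0//.
  exact: den_mono.
by rewrite ler_wpM2l// smap_mono.
Qed.

(* log-convexity of W, in product form *)
Lemma gmix_logconvex (u s t : R) : 0 <= u <= 1 -> 0 <= s -> s <= t ->
  W (1 + s) * W (u + t) <= W (1 + t) * W (u + s).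
Proof.
move=> /andP[u0 u1] s0 st; have t0 := le_trans s0 st.
have p1 : 0 <= 1 + s by rewrite addr_ge0.
have p2 : 0 <= 1 + t by rewrite addr_ge0.
have p3 : 0 <= u + s by rewrite addr_ge0.
have p4 : 0 <= u + t by rewrite addr_ge0.
have q1 := den_gt0 tau0 p1; have q2 := den_gt0 tau0 p2.
have q3 := den_gt0 tau0 p3; have q4 := den_gt0 tau0 p4.
have h1 : ln (D (1 + t)) + ln (D (u + s)) <= ln (D (1 + s)) + ln (D (u + t)).
  rewrite -!lnM ?posrE// ler_ln ?posrE ?mulr_gt0// -subr_ge0 /den.
  rewrite (_ : _ - _ = tau ^+ 2 * ((t - s) * (1 - u))); last by ring.
  by rewrite !mulr_ge0 ?sqr_ge0 ?subr_ge0.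
have h2 : sig (1 + t) + sig (u + s) <= sig (1 + s) + sig (u + t).
  have : sig (1 + t) - sig (u + t) <= sig (1 + s) - sig (u + s).
    rewrite (smap_sub p4 p2) (smap_sub p3 p1).
    have -> : 1 + t - (u + t) = 1 - u by ring.
    have -> : 1 + s - (u + s) = 1 - u by ring.
    rewrite ler_wpM2l ?subr_ge0// lef_pV2 ?posrE ?mulr_gt0//.
    by rewrite ler_pM ?den_mono ?lerD2l// ltW.
  by lra.
rewrite -!expRD ler_expR.
have := ler_wpM2l r0 h2; have dd : 0 <= d%:R / 2 :> R by rewrite divr_ge0.
have := ler_wpM2l dd h1; rewrite /gmix -/(den tau _) -/(smap tau _).
rewrite -!/(den tau _) -!/(smap tau _).
move: (ln (D (1 + s))) (ln (D (1 + t))) (ln (D (u + s))) (ln (D (u + t))).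
move: (sig (1 + s)) (sig (1 + t)) (sig (u + s)) (sig (u + t)).
move: (d%:R / 2) => dd2 y1 y2 y3 y4 l1 l2 l3 l4; lra.
Qed.

Variable k : nat.
Local Notation I f := (\int[nu a k.+1]_s f s).
Local Notation dI f := (\int[nu a k]_s f (1 + s)).

Lemma I_gmix_gt0 : 0 < I W.
Proof.
apply: (@lt_le_trans _ _ (W k.+1%:R)); first exact: gmix_gt0.
rewrite -[leLHS](supported_cst (nu a k.+1)); apply: (supported_le (Sk _)); [exact: lbd_cst|exact: lW|].
by move=> s /andP[s0 sk]; exact: gmix_anti.
Qed.

Lemma I_sigW_ge0 : 0 <= I (fun s => sig s * W s).
Proof.
rewrite -[leLHS](supported_cst (nu a k.+1)); apply: (supported_le (Sk _)); [exact: lbd_cst|exact: lsigW|].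
by move=> s /andP[s0 sk]; rewrite mulr_ge0 ?smap_ge0// ltW// gmix_gt0.
Qed.

Lemma I_sW_ge0 : 0 <= I (fun s => s * W s).
Proof.
rewrite -[leLHS](supported_cst (nu a k.+1)); apply: (supported_le (Sk _)); [exact: lbd_cst|exact: lsW|].
by move=> s /andP[s0 sk]; rewrite mulr_ge0// ltW// gmix_gt0.
Qed.

Lemma boundary_sW_ge0 : 0 <= dI (fun s => s * W s).
Proof.
rewrite -[leLHS](supported_cst (nu a k)).
apply: (supported_le (Sk _)); [exact: lbd_cst|exact: (lbd_shift ler01 lsW)|].
by move=> s /andP[s0 sk]; rewrite mulr_ge0 ?addr_ge0// ltW// gmix_gt0.
Qed.

(* Conditioning one of the variables to its maximal value 1 increases the mean
   of sig: by log-convexity of W this only shifts weight to larger s. *)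
Lemma boundary_mean :
  I (fun s => sig s * W s) * dI (fun s => D s * W s) <=
  dI (fun s => s * W s) * I W.
Proof.
have IW0 := I_gmix_gt0.
(* [eta] is the mean of [sig] under the weight [W]; the claim becomes the nonnegativity of the
   centred boundary integral [Q] below. *)
set eta := I (fun s => sig s * W s) / I W.
have etaE : I (fun s => sig s * W s) = eta * I W by rewrite divfK// gt_eqF.
rewrite etaE mulrAC ler_wpM2r ?(ltW IW0)//.
have eta0 : 0 <= eta by rewrite divr_ge0 ?I_sigW_ge0// ltW.
have es : eta <= sig k.+1%:R.
  rewrite ler_pdivrMr// -(supportedZ (Sk _) _ lW).
  apply: (supported_le (Sk _)); [exact: lsigW|exact: lbdZ lW|].
  by move=> s /andP[s0 sk]; rewrite ler_wpM2r ?smap_mono// ltW// gmix_gt0.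
clearbody eta.
have lQ : locally_bounded (fun s => (sig s - eta) * (D s * W s)).
  by apply: lbdM lVW; apply: lbdB; [exact: lbd_smap|exact: lbd_cst].
have lq : locally_bounded (fun s => (sig s - eta) * W s).
  by apply: lbdM lW; apply: lbdB; [exact: lbd_smap|exact: lbd_cst].
have [Q Qdef] : {Q | Q = dI (fun s => (sig s - eta) * (D s * W s))} by eexists.
suff Q0 : 0 <= Q.
  have QE : Q = dI (fun s => s * W s) - eta * dI (fun s => D s * W s).
    have lV1 := lbd_shift (@ler01 R) lVW.
    rewrite Qdef -(supportedZ (Sk k) eta lV1) -(supportedB (Sk k) (lbd_shift ler01 lsW) (lbdZ eta lV1)).
    apply: (supported_eq (Sk k)); first exact: (lbd_shift ler01 lQ).
      by apply: lbdB; [exact: (lbd_shift ler01 lsW)|exact: lbdZ].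
    move=> s /andP[s0 _]; have s1 : 0 <= 1 + s by rewrite addr_ge0.
    have Dn : D (1 + s) != 0 by rewrite gt_eqF// den_gt0.
    have -> : 1 + s = sig (1 + s) * D (1 + s) :> R by rewrite /smap divfK.
    rewrite (_ : sig (1 + s) * D (1 + s) = 1 + s); last by rewrite /smap divfK.
    move: (W _) => w; rewrite /smap -/(den tau (1 + s)); field.
    exact: Dn.
  by move: Q0; rewrite QE subr_ge0.
have q_int : \int[nu1 a]_u \int[nu a k]_s ((sig (u + s) - eta) * W (u + s)) = 0.
  rewrite -(nuS a0 k lq).
  have -> : I (fun s => (sig s - eta) * W s) = I (fun s => sig s * W s) - eta * I W.
    rewrite -(supportedZ (Sk _) eta lW) -(supportedB (Sk _) lsigW (lbdZ eta lW)).
    by apply: eq_Rintegral => s _; rewrite mulrBl.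
  by rewrite etaE subrr.
(* If [eta <= sig 1], the integrand of [Q] is nonnegative, since [sig] is evaluated at
   [1 + s >= 1]. *)
have [eta1|eta1] := leP eta (sig 1).
  rewrite Qdef -[leLHS](supported_cst (nu a k)); apply: (supported_le (Sk k)).
  - exact: lbd_cst.
  - exact: (lbd_shift ler01 lQ).
  move=> s /andP[s0 _]; have s1 : 0 <= 1 + s by rewrite addr_ge0.
  rewrite !mulr_ge0 ?(ltW (gmix_gt0 _ _ _ _)) ?(ltW (den_gt0 _ _))// subr_ge0.
  by rewrite (le_trans eta1)// smap_mono ?ler01// lerDl.
have teta : tau * eta < 1.
  apply: le_lt_trans (ler_wpM2l tau0 es) _.
  have Dk := den_gt0 tau0 (ler0n R k.+1).
  by rewrite /smap -/(den tau k.+1%:R) mulrA ltr_pdivrMr// mul1r /den mulrC ltrDr.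
pose s1 := eta / (1 - tau * eta).
have te0 : 0 < 1 - tau * eta by rewrite subr_gt0.
have s1_ge1 : 1 <= s1.
  rewrite ler_pdivlMr// mul1r; move: eta1.
  have t1 : 0 < 1 + tau by rewrite ltr_pwDl.
  by rewrite /smap ltr_pdivrMr mul1r// => h; lra.
have sig_s1 : sig s1 = eta.
  rewrite /smap /s1; field.
  by rewrite (gt_eqF te0)/= (_ : _ + _ = 1) ?oner_eq0//; ring.
pose z := s1 - 1.
have z0 : 0 <= z by rewrite subr_ge0.
have s1z : 1 + z = s1 by rewrite addrC subrK.
clearbody z; clearbody s1.
rewrite leNgt; apply/negP => Qneg.
have lQ1 := lbd_shift (@ler01 R) lQ.
(* The weights are compared by freezing them at the crossing [z]: log-convexity acts in opposite
   directions on the two sides of [z], where [sig (1 + s) - eta] has opposite signs. Averaged over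
   [u], the left side vanishes by [q_int] while the right side is negative. *)
have key u : 0 <= u <= 1 ->
    (D (1 + z) * W (1 + z)) * \int[nu a k]_s ((sig (u + s) - eta) * W (u + s)) <=
    W (1 + z) * Q.
  move=> u01; have /andP[u0 u1] := u01.
  apply: (@le_trans _ _ (W (u + z) * Q)); last first.
    have uz : 0 <= u + z by exact: addr_ge0.
    have u1z : u + z <= 1 + z by rewrite lerD2r.
    exact: (ler_wnM2r (ltW Qneg) (gmix_anti uz u1z)).
  rewrite Qdef -(supportedZ (Sk k) _ lQ1) -(supportedZ (Sk k) _ (lbd_shift u0 lq)).
  apply: (supported_le (Sk k)); [exact: lbdZ (lbd_shift u0 lq)|exact: lbdZ lQ1|].
  move=> s /andP[s0 _]; have s10 : 0 <= 1 + s by rewrite addr_ge0.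
  have z10 : 0 <= 1 + z by rewrite addr_ge0.
  apply: (@le_trans _ _ ((sig (1 + s) - eta) * (D (1 + z) * W (1 + z) * W (u + s)))).
    rewrite mulrCA ler_pM2r; last by rewrite !mulr_gt0 ?gmix_gt0// den_gt0.
    by rewrite lerD2r smap_mono ?addr_ge0// lerD2r.
  rewrite [leRHS]mulrCA -{1}sig_s1 -s1z.
  have [zs|sz] := leP z s.
    rewrite -{1}sig_s1 -s1z ler_wpM2l//; first by rewrite subr_ge0 smap_mono// lerD2l.
    rewrite -!mulrA [leRHS]mulrCA ler_pM ?(ltW (den_gt0 _ _))//.
    - by rewrite mulr_ge0// ltW// gmix_gt0.
    - by apply: den_mono; rewrite lerD2l.
    - by rewrite [leRHS]mulrC gmix_logconvex.
  rewrite -{1}sig_s1 -s1z ler_wnM2l//; first by rewrite subr_le0 smap_mono// lerD2l ltW.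
  rewrite -!mulrA [leLHS]mulrCA ler_pM ?(ltW (den_gt0 _ _))//.
  - by rewrite mulr_ge0// ltW// gmix_gt0.
  - by apply: den_mono; rewrite lerD2l ltW.
  - by rewrite [leLHS]mulrC gmix_logconvex// ltW.
have : \int[nu1 a]_u ((D (1 + z) * W (1 + z)) * \int[nu a k]_s ((sig (u + s) - eta) * W (u + s)))
    <= \int[nu1 a]_u (W (1 + z) * Q).
  apply: (supported_le S1); [|exact: lbd_cst|exact: key].
  by apply: lbdZ; exact: (lbd_Rintegral (Sk k) lq).
rewrite supported_cst (supportedZ S1); last exact: (lbd_Rintegral (Sk k) lq).
by rewrite q_int mulr0 leNgt nmulr_llt0 ?gmix_gt0// pmulr_rlt0 ?gmix_gt0// Qneg.
Qed.

(** With the decreasing function [G = W / D] one has [s sig W = s^2 G] and [sig W = s G], so this is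
    [nu_pivot2]. The constant [(a + 1) / (a + 2) = d / (d + 2)] of the hypothesis on the variances
    comes from here. *)
Lemma mixed_second_moment :
  I (fun s => tau * (s * sig s) * W s) <=
  tau * (k.+1%:R * ((a + 1) / (a + 2))) * I (fun s => sig s * W s).
Proof.
pose G s := (D s)^-1 * W s.
have lG : locally_bounded G by exact: lbdM (lbd_invden tau0) lW.
have := @nu_pivot2 _ a a0 k.+1 G lG _ _.
set c := (a + 1) / (a + 2) => h.
have lsm : locally_bounded (fun s => s * sig s * W s).
  by apply: lbdM lW; exact: lbdM lid (lbd_smap tau0).
have E : \int[nu a k.+1]_s (s * (k.+1%:R * c - s) * G s) =
    k.+1%:R * c * I (fun s => sig s * W s) - I (fun s => s * sig s * W s).
  rewrite -(supportedZ (Sk _) _ lsigW) -(supportedB (Sk _) (lbdZ _ lsigW) lsm).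
  apply: eq_Rintegral => s _; rewrite /G /smap -/(den tau s).
  by move: (W s) (D s)^-1 => w D'; ring.
have -> : I (fun s => tau * (s * sig s) * W s) = tau * I (fun s => s * sig s * W s).
  by rewrite -(supportedZ (Sk _) _ lsm); apply: eq_Rintegral => s _; rewrite !mulrA.
rewrite -mulrA ler_wpM2l// -subr_ge0 -E; apply: h.
- move=> x y x0 xy; have y0 := le_trans x0 xy.
  apply: ler_pM; rewrite ?(ltW (gmix_gt0 _ _ _ _)) ?invr_ge0 ?(ltW (den_gt0 _ _))//.
    by rewrite lef_pV2 ?posrE ?den_gt0// den_mono.
  exact: gmix_anti.
- by move=> x x0; rewrite mulr_ge0 ?invr_ge0 ?(ltW (den_gt0 _ _))// ltW ?gmix_gt0.
Qed.

(* In terms of A = I W as a function of x with |x|^2 = 2 v r, this says that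
   A^(s) is superharmonic for s = (1 - b)/2. *)
Lemma gmix_superharmonic (th b : R) : 0 < th -> th < 1 ->
  (1 + b) * k.+1%:R = 2 * k%:R + th ->
  2 * k%:R * tau * (k.+1%:R * ((a + 1) / (a + 2))) <= th ->
  2 * r * I (fun s => sig s ^+ 2 * W s) * I W <=
  d%:R * I (fun s => sig s * W s) * I W + (1 + b) * r * I (fun s => sig s * W s) ^+ 2.
Proof.
move=> th0 th1 bE tauE.
have e1 := euler_denW a0 ad tau0 r0 k.
have e2 := euler_sW a0 ad tau0 r0 k.
have bm := boundary_mean; have mm := mixed_second_moment.
have IW0 := I_gmix_gt0; have Is0 := I_sigW_ge0; have Iss0 := I_sW_ge0; have bs0 := boundary_sW_ge0.
have sub : I (fun s => s * W s) - I (fun s => sig s * W s) = I (fun s => tau * (s * sig s) * W s).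
  rewrite -(supportedB (Sk _) lsW lsigW); apply: (supported_eq (Sk _)).
  - exact: lbdB lsW lsigW.
  - by apply: lbdM lW; apply: lbdZ; exact: lbdM lid (lbd_smap tau0).
  by move=> s /andP[s0 _]; rewrite -mulrBl smap_diff.
move: e1 e2 bm mm IW0 Is0 Iss0 bs0 sub.
move: (I W) (I (fun s => s * W s)) (I (fun s => sig s * W s)) (I (fun s => sig s ^+ 2 * W s))
  (I (fun s => tau * (s * sig s) * W s)) (dI (fun s => s * W s)) (dI (fun s => D s * W s)).
move=> A Y Z Z2 X B V e1 e2 bm mm A0 Z0 Y0 B0 sub.
have dE : d%:R = 2 * (a + 1) by rewrite -ad; field.
have k0 : 0 <= k%:R :> R by exact: ler0n.
move: bE tauE e1 e2 mm; rewrite -natr1; move: (k%:R : R) k0 => K K0 bE tauE e1 e2 mm.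
have b1 : 1 + b <= 2 by nra.
have b0 : 0 <= 1 + b by nra.
(* after Euler's identities the claim splits into a moment part and a boundary part *)
have m1 : 2 * a * K * (Y - Z) <= a * th * Z.
  rewrite sub; have : 2 * K * X <= th * Z.
    have := ler_wpM2l (_ : 0 <= 2 * K) mm; rewrite mulr_ge0// => /(_ isT) h.
    have := ler_wpM2r Z0 tauE; lra.
  by move=> h; have := ler_wpM2l (ltW a0) h; lra.
have m2 : (1 + b) * (a * (K + 1)) * (Z * V) <= 2 * (a * (K + 1)) * (B * A).
  have aK : 0 <= a * (K + 1) by rewrite mulr_ge0 ?addr_ge0// ltW.
  have p1 : (1 + b) * (a * (K + 1)) * (Z * V) <= (1 + b) * (a * (K + 1)) * (B * A).
    by rewrite ler_wpM2l// mulr_ge0.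
  have p2 : (1 + b) * (a * (K + 1)) * (B * A) <= 2 * (a * (K + 1)) * (B * A).
    rewrite ler_wpM2r ?mulr_ge0 ?(ltW A0)//.
    by rewrite ler_wpM2r.
  exact: le_trans p1 p2.
have m3 : 0 <= (1 + b) * (a * tau * K * Y * Z).
  by rewrite !mulr_ge0// ltW.
have m4 := ler_wpM2r (ltW A0) m1.
have E1 : 2 * r * Z2 * A = 2 * (a * K * Y + (a + 1) * Z - a * (K + 1) * B) * A.
  by rewrite -e2; ring.
have E2 : (1 + b) * r * Z ^+ 2 = (1 + b) * ((K + 1) * a * A + a * tau * K * Y - a * (K + 1) * V) * Z.
  by rewrite -e1; ring.
rewrite E1 E2 dE.
have E3 : (1 + b) * ((K + 1) * a * A) * Z = a * (2 * K + th) * A * Z by rewrite -bE; ring.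
rewrite (_ : (1 + b) * ((K + 1) * a * A + a * tau * K * Y - a * (K + 1) * V) * Z =
  (1 + b) * ((K + 1) * a * A) * Z + (1 + b) * (a * tau * K * Y * Z) - (1 + b) * (a * (K + 1)) * (Z * V));
  last by ring.
rewrite E3; lra.
Qed.

End superharmonicity.

(** * The heat flow *)

Section local_step.
Variable R : realType.
Variables (d : nat) (a : R) (a0 : 0 < a) (ad : d%:R / 2 = a + 1).
Variable k : nat.
Local Notation Sk := (nu_supported a0).

Definition gmean (tau r : R) : R := \int[nu a k.+1]_s gmix d tau r s.
(** Minus the logarithmic derivative of [gmean tau] in [r]: the gradient of
    [ln (gmean tau (|x|^2 / (2 v)))] is [- gslope * x / v]. *)
Definition gslope (tau r : R) : R :=
  (\int[nu a k.+1]_s (smap tau s * gmix d tau r s)) / gmean tau r.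

(** From [(1 - x) exp x <= 1] one gets [exp x <= 1 + x exp x]; for [x >= 0] this is iterated once,
    and for [x < 0] it is combined with [1 + x <= exp x]. *)
Lemma expR_le_quadratic (x y : R) : `|x| <= y -> expR x <= 1 + x + y ^+ 2 * expR y.
Proof.
move=> xy; have y0 : 0 <= y by exact: le_trans xy.
have e1 : 1 <= expR y by rewrite -expR0 ler_expR.
have x2 : x ^+ 2 <= y ^+ 2 by rewrite -real_normK ?num_real// ler_sqr ?nnegrE.
have [x0|x0] := leP 0 x.
  have ey : expR x <= expR y by rewrite ler_expR -(ger0_norm x0).
  have := expR_ge1Dx (- x); rewrite expRN => h.
  have ex := expR_gt0 x.
  have h2 : (1 - x) * expR x <= 1.
    by rewrite -ler_pdivlMr// mul1r.
  have h3 : expR x <= 1 + x * expR x by lra.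
  have h4 : x * expR x <= x * (1 + x * expR x) by rewrite ler_wpM2l.
  have h5 : x ^+ 2 * expR x <= y ^+ 2 * expR y by rewrite ler_pM ?sqr_ge0// ltW.
  by rewrite expr2 in h5; lra.
have := expR_ge1Dx (- x); rewrite expRN => h.
have ex := expR_gt0 x.
have h2 : (1 - x) * expR x <= 1 by rewrite -ler_pdivlMr// mul1r.
have h4 : 1 + x <= expR x by exact: expR_ge1Dx.
have h5 : x * expR x <= x * (1 + x) by rewrite ler_wnM2l// ltW.
have h6 : x ^+ 2 <= y ^+ 2 * expR y by rewrite (le_trans x2)// ler_peMr// sqr_ge0.
by rewrite expr2 in h6; lra.
Qed.

Lemma ln_lower (y : R) : 0 <= y -> y - y ^+ 2 <= ln (1 + y).
Proof.
move=> y0; have y1 : 0 < 1 + y by rewrite ltr_pwDl.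
have h : ln (1 + y)^-1 <= (1 + y)^-1 - 1.
  have /le_ln1Dx : -1 < (1 + y)^-1 - 1 by rewrite ltrBrDr addNr invr_gt0.
  by rewrite addrC subrK.
rewrite lnV ?posrE// in h.
apply: (@le_trans _ _ (1 - (1 + y)^-1)); last by lra.
rewrite -subr_ge0.
rewrite (_ : _ - _ = y ^+ 3 / (1 + y)); last by field; rewrite gt_eqF.
by rewrite divr_ge0 ?exprn_ge0// ltW.
Qed.

Lemma sqr_le_expR (y : R) : 0 <= y -> y ^+ 2 <= 4 * expR y.
Proof.
move=> y0; have h : 1 + y / 2 <= expR (y / 2) by exact: expR_ge1Dx.
have E : expR y = expR (y / 2) ^+ 2 by rewrite -expRM_natl; congr expR; field.
have p : 0 <= y / 2 by rewrite divr_ge0.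
have : (y / 2) ^+ 2 <= expR (y / 2) ^+ 2 by rewrite ler_sqr ?nnegrE ?expR_ge0//; lra.
rewrite -E; nra.
Qed.

Section step.
Variables (tau r : R) (tau0 : 0 <= tau) (r0 : 0 <= r).
Local Notation A := (gmean tau r).
Local Notation eta := (gslope tau r).

Lemma gmean_gt0 : 0 < A. Proof. exact: I_gmix_gt0. Qed.

Lemma gslope_ge0 : 0 <= eta.
Proof. by rewrite divr_ge0 ?I_sigW_ge0// ltW// gmean_gt0. Qed.

Lemma gslope_le : eta <= k.+1%:R.
Proof.
rewrite ler_pdivrMr ?gmean_gt0// /gmean -(supportedZ (Sk _)); last exact: lbd_gmix.
apply: (supported_le (Sk _)); [exact: lbd_sigW|exact: lbdZ (lbd_gmix _ _ _)|].
move=> s /andP[s0 sk]; rewrite ler_wpM2r ?(ltW (gmix_gt0 _ _ _ _))//.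
by rewrite (le_trans (smap_le tau0 s0)).
Qed.

Lemma gmix_step (b e s : R) : 0 <= b -> 0 < e -> 0 <= s ->
  expR ((b + 1) ^+ 2 * e * eta ^+ 2 * r) *
    gmix d (tau + 2 * e) (r * (1 + (b + 1) * e * eta) ^+ 2) s <=
  gmix d tau r s * expR (e * ((b + 1) ^+ 2 * eta ^+ 2 * r - d%:R * smap tau s
      + 2 * r * smap tau s ^+ 2 - 2 * (b + 1) * r * smap tau s * eta)
    + e ^+ 2 * (2 * d%:R * smap tau s ^+ 2 + 4 * (b + 1) * r * eta * smap tau s ^+ 2)).
Proof.
move=> b0 e0 s0; rewrite -!expRD ler_expR.
have eta0 := gslope_ge0; move: (eta) eta0 => h h0.
have D0 := den_gt0 tau0 s0.
have D2 : 0 < 1 + s * (tau + 2 * e).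
  by rewrite ltr_pwDl// mulr_ge0// addr_ge0// mulr_ge0// ltW.
have sg0 := smap_ge0 tau0 s0.
have sgE : s / (1 + s * tau) = smap tau s by [].
move: (smap tau s) sg0 sgE => sg sg0 sgE.
have y0 : 0 <= 2 * e * sg by rewrite !mulr_ge0// ltW.
have y1 : 0 < 1 + 2 * e * sg by rewrite ltr_pwDl.
(* This factorisation isolates the increment in time as a function of [sg = sig s]. *)
have E : 1 + s * (tau + 2 * e) = (1 + s * tau) * (1 + 2 * e * sg).
  rewrite -sgE; field; exact: lt0r_neq0.
have E2 : s / (1 + s * (tau + 2 * e)) = sg / (1 + 2 * e * sg).
  by rewrite E invfM mulrA sgE.
rewrite sgE E2 E lnM ?posrE//.
have l1 := ln_lower y0.
have l2 : (1 + 2 * ((b + 1) * e * h)) * (1 - 2 * e * sg) * sg <=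
    (1 + (b + 1) * e * h) ^+ 2 * (sg / (1 + 2 * e * sg)).
  have p1 : 1 - 2 * e * sg <= (1 + 2 * e * sg)^-1.
    by rewrite -[leRHS]mul1r ler_pdivlMr//; nra.
  have p2 : 0 <= (b + 1) * e * h by rewrite !mulr_ge0 ?addr_ge0// ltW.
  have p3 : 1 + 2 * ((b + 1) * e * h) <= (1 + (b + 1) * e * h) ^+ 2 by nra.
  have p4 : 0 <= (1 + 2 * e * sg)^-1 by rewrite invr_ge0 ltW.
  rewrite [leRHS]mulrA [leRHS]mulrAC ler_wpM2r//.
  apply: (@le_trans _ _ ((1 + 2 * ((b + 1) * e * h)) / (1 + 2 * e * sg))).
    by rewrite ler_wpM2l// addr_ge0// mulr_ge0.
  by rewrite ler_wpM2r.
have l3 := ler_wpM2l r0 l2.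
have dd : 0 <= d%:R / 2 :> R by rewrite divr_ge0.
have l4 := ler_wpM2l dd l1.
move: l3 l4; move: (ln (1 + s * tau)) (ln (1 + 2 * e * sg)) => L1 L2.
move: (sg / (1 + 2 * e * sg)) (d%:R : R) => q dR l3 l4; lra.
Qed.

Local Notation dR := (d%:R : R).
Local Notation kR := (k.+1%:R : R).

(** [step_lin * (1 + r)] and [step_quad * (1 + r)] bound the first- and second-order coefficients in
    the exponent of [gmix_step], using [b <= 1] and [sig, eta <= k + 1]. In [step_err] the first
    summand is the second-order term itself, and the other is the Taylor remainder of the
    exponential. *)
Definition step_lin : R := 10 * kR ^+ 2 + dR * kR.
Definition step_quad : R := 2 * dR * kR ^+ 2 + 8 * kR ^+ 3.
Definition step_err (e : R) : R :=
  e ^+ 2 * step_quad * (1 + r) +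
  (e * (step_lin + step_quad) * (1 + r)) ^+ 2 * expR (e * (step_lin + step_quad) * (1 + r)).

Lemma gmix_step_linear (b e s : R) : 0 <= b <= 1 -> 0 < e <= 1 -> 0 <= s <= kR ->
  expR ((b + 1) ^+ 2 * e * eta ^+ 2 * r) *
    gmix d (tau + 2 * e) (r * (1 + (b + 1) * e * eta) ^+ 2) s <=
  (1 + e * (b + 1) ^+ 2 * eta ^+ 2 * r + step_err e) * gmix d tau r s
  + (- (e * (d%:R + 2 * (b + 1) * r * eta)) * (smap tau s * gmix d tau r s)
  + 2 * e * r * (smap tau s ^+ 2 * gmix d tau r s)).
Proof.
move=> /andP[b0 b1] /andP[e0 e1] /andP[s0 sk].
apply: le_trans (gmix_step b0 e0 s0) _.
have W0 := gmix_gt0 d tau r s.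
have eta0 := gslope_ge0; have etak := gslope_le.
have sg0 := smap_ge0 tau0 s0; have sgk : smap tau s <= kR := le_trans (smap_le tau0 s0) sk.
have dR0 : 0 <= dR by exact: ler0n.
have kR1 : 1 <= kR by rewrite ler1n.
rewrite /step_err /step_lin /step_quad.
move: (gmix d tau r s) W0 (eta) eta0 etak (smap tau s) sg0 sgk => W W0 h h0 hk g g0 gk.
move: (k.+1%:R : R) (d%:R : R) kR1 dR0 hk gk {sk} => kR dR kR1 dR0 hk gk.
have k0 : 0 <= kR by exact: le_trans kR1.
set X1 := (b + 1) ^+ 2 * h ^+ 2 * r - dR * g + 2 * r * g ^+ 2 - 2 * (b + 1) * r * g * h.
set X2 := 2 * dR * g ^+ 2 + 4 * (b + 1) * r * h * g ^+ 2.
set C1 := 10 * kR ^+ 2 + dR * kR; set C2 := 2 * dR * kR ^+ 2 + 8 * kR ^+ 3.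
have h2 : h ^+ 2 <= kR ^+ 2 by rewrite ler_sqr ?nnegrE.
have g2 : g ^+ 2 <= kR ^+ 2 by rewrite ler_sqr ?nnegrE.
have gh : g * h <= kR ^+ 2 by rewrite expr2 ler_pM.
have hg2 : h * g ^+ 2 <= kR ^+ 3 by rewrite exprS ler_pM ?sqr_ge0.
have rk : 0 <= r * kR ^+ 2 by rewrite mulr_ge0 ?sqr_ge0.
have dk : 0 <= dR * kR by rewrite mulr_ge0.
have k2 : 0 <= kR ^+ 2 by rewrite sqr_ge0.
have k3 : 0 <= kR ^+ 3 by rewrite exprn_ge0.
have C10 : 0 <= C1 by rewrite addr_ge0// mulr_ge0.
have C20 : 0 <= C2 by rewrite addr_ge0// mulr_ge0// mulr_ge0.
have dg : dR * g <= dR * kR by rewrite ler_wpM2l.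
have dg0 : 0 <= dR * g by rewrite mulr_ge0.
have r1 : 1 <= 1 + r by rewrite lerDl.
have B1 : `|X1| <= C1 * (1 + r).
  have a1 : (b + 1) ^+ 2 * h ^+ 2 * r <= 4 * kR ^+ 2 * r.
    by rewrite ler_wpM2r// ler_pM ?sqr_ge0//; nra.
  have a2 : r * g ^+ 2 <= r * kR ^+ 2 by rewrite ler_wpM2l.
  have a3 : (b + 1) * r * g * h <= 2 * (r * kR ^+ 2).
    by rewrite -!mulrA ler_pM ?mulr_ge0 ?addr_ge0// ?ler_wpM2l//; lra.
  have a4 : 0 <= (b + 1) * r * g * h by rewrite !mulr_ge0// addr_ge0.
  have a5 : 0 <= (b + 1) ^+ 2 * h ^+ 2 * r.
    by rewrite mulr_ge0// mulr_ge0 ?sqr_ge0.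
  have a6 : 0 <= r * g ^+ 2 by rewrite mulr_ge0 ?sqr_ge0.
  have a7 : 0 <= r * (dR * kR) by rewrite mulr_ge0.
  rewrite ler_norml /X1 /C1; apply/andP; split; lra.
have B20 : 0 <= X2.
  apply: addr_ge0; first by rewrite mulr_ge0 ?sqr_ge0// mulr_ge0.
  by rewrite mulr_ge0 ?sqr_ge0// !mulr_ge0// addr_ge0.
have B2 : X2 <= C2 * (1 + r).
  have a1 : dR * g ^+ 2 <= dR * kR ^+ 2 by rewrite ler_wpM2l.
  have a2 : (b + 1) * (r * (h * g ^+ 2)) <= 2 * (r * kR ^+ 3).
    by rewrite ler_pM ?mulr_ge0 ?addr_ge0 ?sqr_ge0// ?ler_wpM2l//; lra.
  have a3 : 0 <= dR * kR ^+ 2 * r by rewrite mulr_ge0// mulr_ge0.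
  have a4 : 0 <= r * kR ^+ 3 by rewrite mulr_ge0.
  rewrite /X2 /C2; lra.
have Y : `|e * X1 + e ^+ 2 * X2| <= e * (C1 + C2) * (1 + r).
  apply: (le_trans (ler_normD _ _)).
  rewrite (normrM e X1) (ger0_norm (ltW e0)) (ger0_norm (mulr_ge0 (sqr_ge0 e) B20)).
  have a1 : e * `|X1| <= e * (C1 * (1 + r)) by rewrite ler_wpM2l// ltW.
  have a2 : e ^+ 2 * X2 <= e * (C2 * (1 + r)).
    by rewrite ler_pM ?sqr_ge0// expr2 ler_piMr// ltW.
  lra.
have := expR_le_quadratic Y; set Q := (_ ^+ 2 * expR _) => hQ.
have hX2 : e ^+ 2 * X2 <= e ^+ 2 * (C2 * (1 + r)) by rewrite ler_wpM2l ?sqr_ge0.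
have hh : expR (e * X1 + e ^+ 2 * X2) <= 1 + e * X1 + (e ^+ 2 * C2 * (1 + r) + Q) by lra.
apply: le_trans (ler_wpM2l (ltW W0) hh) _.
rewrite /X1 le_eqVlt; apply/orP; left; apply/eqP; ring.
Qed.

(* One time step of length e: after tilting by exp (b + 1) k.(y - x), the
   first-order terms are controlled by superharmonicity. *)
Lemma gmean_step (b e : R) : 0 <= b <= 1 -> 0 < e <= 1 ->
  2 * r * (\int[nu a k.+1]_s (smap tau s ^+ 2 * gmix d tau r s)) * A <=
    d%:R * (\int[nu a k.+1]_s (smap tau s * gmix d tau r s)) * A
    + (1 + b) * r * (\int[nu a k.+1]_s (smap tau s * gmix d tau r s)) ^+ 2 ->
  1 + b * (expR ((b + 1) ^+ 2 * e * eta ^+ 2 * r) *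
    gmean (tau + 2 * e) (r * (1 + (b + 1) * e * eta) ^+ 2) / A) <=
  (1 + b) * expR (b ^+ 2 * e * eta ^+ 2 * r) + step_err e.
Proof.
move=> b01 e01; have /andP[b0 b1] := b01; have /andP[e0 e1] := e01.
have A0 := gmean_gt0; have eta0 := gslope_ge0.
set S2 := \int[_]_s (_ ^+ 2 * _); set S1 := \int[_]_s (smap _ _ * _) => T.
have S1E : S1 = eta * A by rewrite divfK// gt_eqF.
have t0 : 0 <= tau + 2 * e by rewrite addr_ge0// mulr_ge0// ltW.
have rr0 : 0 <= r * (1 + (b + 1) * e * eta) ^+ 2 by rewrite mulr_ge0// sqr_ge0.
have lW := lbd_gmix d tau0 r0; have lS := lbd_sigW d tau0 r0; have lS2 := lbd_sig2W d tau0 r0.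
have lW' := lbd_gmix d t0 rr0.
have M : expR ((b + 1) ^+ 2 * e * eta ^+ 2 * r) *
    gmean (tau + 2 * e) (r * (1 + (b + 1) * e * eta) ^+ 2) <=
  (1 + e * (b + 1) ^+ 2 * eta ^+ 2 * r + step_err e) * A
  + (- (e * (d%:R + 2 * (b + 1) * r * eta)) * S1 + 2 * e * r * S2).
  rewrite /gmean /S1 /S2 -(supportedZ (Sk _) _ lW') -(supportedZ (Sk _) _ lW).
  rewrite -(supportedZ (Sk _) _ lS) -(supportedZ (Sk _) _ lS2).
  rewrite -(supportedD (Sk _) (lbdZ _ lS) (lbdZ _ lS2)).
  rewrite -(supportedD (Sk _) (lbdZ _ lW) (lbdD (lbdZ _ lS) (lbdZ _ lS2))).
  apply: (supported_le (Sk _)); [exact: lbdZ|exact: lbdD (lbdZ _ lW) (lbdD (lbdZ _ lS) (lbdZ _ lS2))|].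
  by move=> s sk; exact: gmix_step_linear.
have err0 : 0 <= step_err e.
  have kk : 0 <= kR by exact: ler0n.
  have dd : 0 <= dR by exact: ler0n.
  have r1 : 0 <= 1 + r by rewrite addr_ge0.
  have C0 : 0 <= step_quad by rewrite addr_ge0 ?mulr_ge0 ?sqr_ge0 ?exprn_ge0.
  by rewrite addr_ge0// mulr_ge0 ?sqr_ge0 ?expR_ge0// mulr_ge0 ?sqr_ge0.
have exb := expR_ge1Dx (b ^+ 2 * e * eta ^+ 2 * r).
have T' : 2 * r * S2 <= d%:R * eta * A + (1 + b) * r * eta ^+ 2 * A.
  rewrite -(ler_pM2r A0); move: T; rewrite S1E; move: (A) (eta) => AA h.
  by rewrite exprMn; lra.
move: M T' A0 exb err0; rewrite S1E; clear T; clearbody S2.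
move: (expR _) (expR (b ^+ 2 * _ * _ * _)) (step_err e) => E1 E2 err.
move: (gmean (tau + 2 * e) (r * (1 + (b + 1) * e * eta) ^+ 2)) => A'.
move: (A) (eta) S2 eta0 (d%:R : R) => AA h Z h0 dd.
move=> M T' A0 exb err0.
(* The inequality [T'] cancels the terms in [d], and the coefficients of [r h^2] add up to [(b +
   1)^2 - 2 (b + 1) + (b + 1) = b (b + 1)]. After multiplication by [b] this matches the linear part
   of [(1 + b) exp (b^2 e h^2 r)]. *)
have Q : E1 * A' / AA <= 1 + e * (b * (b + 1) * h ^+ 2 * r) + err.
  rewrite ler_pdivrMr//; apply: le_trans M _.
  have := ler_wpM2l (ltW e0) T'; lra.
have := ler_wpM2l b0 Q.
have : b * err <= err by rewrite ler_piMl.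
have : 0 <= e * b ^+ 2 * h ^+ 2 * r.
  by rewrite mulr_ge0// mulr_ge0 ?sqr_ge0// mulr_ge0 ?sqr_ge0// ltW.
have := ler_wpM2l (_ : 0 <= 1 + b) exb; rewrite addr_ge0// => /(_ isT).
lra.
Qed.

End step.
End local_step.

(** * One Gaussian step for negative powers of the mixture *)

Section gaussian_step.
Variable R : realType.
Variables (d : nat) (a : R) (a0 : 0 < a) (ad : d%:R / 2 = a + 1).
Variable k : nat.
Local Notation Rm := (measurableTypeR R).
Local Notation Sk := (nu_supported a0).
Local Notation gmean := (gmean d a k).
Local Notation gslope := (gslope d a k).
Implicit Types q x y w : 'rV[R]_d.

Lemma measurable_gmean d0 (X : measurableType d0) (tau : R) (r : X -> R) :
  measurable_fun setT r -> measurable_fun setT (fun p => gmean tau (r p)).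
Proof.
move=> mr; apply: (@measurable_Rintegral_param _ _ _ X (fun p s => gmix d tau (r p) s)).
by apply: measurable_gmix => //; exact: measurableT_comp.
Qed.

Lemma gmean_EFin (tau r : R) : 0 <= tau -> 0 <= r ->
  (gmean tau r)%:E = (\int[nu a k.+1]_s (gmix d tau r s)%:E)%E.
Proof.
move=> tau0 r0; rewrite /gmean /Rintegral fineK//.
exact: integrable_fin_num (supported_integrable (Sk _) (lbd_gmix d tau0 r0)).
Qed.

Variables (v : R) (v0 : 0 < v).
Local Notation rad x := (sqnorm x / (2 * v)).

Lemma rad_ge0 x : 0 <= rad x.
Proof. by rewrite divr_ge0 ?sqnorm_ge0// mulr_ge0// ltW. Qed.

Lemma gaussian_gmean_integral (e tau : R) q x : 0 < e -> 0 <= tau ->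
  integral_Rd (fun y => (phi (y - x) (v * e) * expR (dot q (y - x)) * gmean tau (rad y))%:E) =
  (expR (v * e * sqnorm q / 2) * gmean (tau + e) (rad (x + (v * e) *: q)))%:E.
Proof.
move=> e0 tau0; have ve0 : 0 < v * e by rewrite mulr_gt0.
have te0 : 0 <= tau + e by rewrite addr_ge0// ltW.
pose F (s : Rm) y := (phi (y - x) (v * e) * expR (dot q (y - x)) * gmix d tau (rad y) s)%:E.
have mF : meas_pvec F.
  apply: meas_pvec_EFin.
  have cm : coord_meas (fun p : Rm * d.-tuple R => tvec p.2) by exact: coord_meas_tvec.
  have cmx : coord_meas (fun p : Rm * d.-tuple R => tvec p.2 - x).
    by apply: coord_measD => //; exact: coord_meas_cst.
  apply: measurable_funM; first apply: measurable_funM.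
  - exact: measurable_phi.
  - by apply: measurableT_comp => //; exact: measurable_dot.
  - apply: measurable_gmix => //; apply: measurable_funM => //; exact: measurable_sqnorm.
have F0 s y : (0 <= F s y)%E.
  by rewrite lee_fin !mulr_ge0 ?expR_ge0// ltW// ?phi_gt0// gmix_gt0.
have E y : (phi (y - x) (v * e) * expR (dot q (y - x)) * gmean tau (rad y))%:E =
    (\int[nu a k.+1]_s F s y)%E.
  rewrite EFinM (gmean_EFin tau0 (rad_ge0 y)) -ge0_integralZl_EFin//.
  - by move=> s _; rewrite lee_fin ltW// gmix_gt0.
  - by apply/measurable_EFinP; apply: measurable_gmix.
  - by rewrite mulr_ge0 ?expR_ge0// ltW// phi_gt0.
under eq_fun do rewrite E.
rewrite -(integral_Rd_fubini (nu a k.+1) mF F0).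
rewrite EFinM (gmean_EFin te0 (rad_ge0 _)) -ge0_integralZl_EFin ?expR_ge0//; last 2 first.
- by move=> s _; rewrite lee_fin ltW// gmix_gt0.
- by apply/measurable_EFinP; apply: measurable_gmix.
apply: ae_eq_integral => //.
- exact: measurable_integral_Rd.
- apply: measurable_funeM; apply/measurable_EFinP; exact: measurable_gmix.
(* The Gaussian formula needs positive denominators, so it is used for [s >= 0] only, which holds
   almost surely. *)
exists (~` `[0, k.+1%:R]%classic); split.
- by apply: measurableC; exact: measurable_itv.
- exact: Sk.
move=> s /= h; rewrite in_itv/= => /andP[s0 sN]; apply: h => _.
rewrite gaussian_gmix_integral ?EFinM//.
- by rewrite ltr_pwDl// mulr_ge0.
- by rewrite ltr_pwDl// mulr_ge0.
Qed.

Lemma gmix_s0 (tau r : R) : gmix d tau r 0 = 1.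
Proof. by rewrite /gmix !mul0r addr0 ln1 !mulr0 subr0 oppr0 expR0. Qed.

Lemma gaussian_laplace (e : R) q x : 0 < e ->
  integral_Rd (fun y => (phi (y - x) (v * e) * expR (dot q (y - x)))%:E) =
  (expR (v * e * sqnorm q / 2))%:E.
Proof.
move=> e0; have := @gaussian_gmix_integral R d v e 0 0 q x v0 e0.
rewrite !mul0r addr0 => /(_ ltr01 ltr01).
rewrite gmix_s0 mulr1.
by under eq_fun do rewrite gmix_s0 mulr1.
Qed.

Lemma phi_total x (s2 : R) : 0 < s2 -> integral_Rd (fun y => (phi (y - x) s2)%:E) = 1%E.
Proof.
move=> s0; have e0 : 0 < s2 / v by rewrite divr_gt0.
have := gaussian_laplace 0 x e0; rewrite (_ : v * (s2 / v) = s2); last first.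
  by rewrite mulrC divfK// gt_eqF.
rewrite (_ : sqnorm 0 = 0) ?mulr0 ?mul0r ?expR0; last first.
  by apply: big1 => i _; rewrite mxE expr0n.
move=> <-; congr integral_Rd; apply/funext => y.
rewrite (_ : dot 0 _ = 0) ?expR0 ?mulr1//.
by apply: big1 => i _; rewrite mxE mul0r.
Qed.

(** The Gaussian of variance [t] is, up to its prefactor, [gmix d 0 (|z|^2 / (2 t)) 1], so the
    semigroup property applies with [v = t] and [e = s / t]. *)
Lemma phi_convolution x y (s t : R) : 0 < s -> 0 < t ->
  integral_Rd (fun z => (phi (z - x) s * phi (y - z) t)%:E) = (phi (y - x) (s + t))%:E.
Proof.
move=> s0 t0.
have st0 : 0 < s / t by rewrite divr_gt0.
have m1 : meas_vec (fun z => (phi (z - x) s * phi (y - z) t)%:E).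
  apply: meas_vec_EFin; apply: measurable_funM; apply: measurable_phi.
    by apply: coord_measD; [exact: coord_meas_tvec|exact: coord_meas_cst].
  by apply: coord_measD; [exact: coord_meas_cst|apply: coord_measN; exact: coord_meas_tvec].
rewrite (integral_Rd_affine y (@ltr01 R) m1); last first.
  by move=> z; rewrite lee_fin mulr_ge0// ltW// phi_gt0.
rewrite expr1n mul1e; under eq_fun do rewrite scale1r.
pose K := expR (- (d%:R / 2 * ln (2 * pi * t))).
have E z : (phi (y + z - x) s * phi (y - (y + z)) t)%:E =
   (K%:E * (phi (z - (x - y)) (t * (s / t)) * expR (dot 0 (z - (x - y))) * gmix d 0 (sqnorm z / (2 * t)) 1)%:E)%E.
  rewrite -EFinM; congr EFin; rewrite (mulrC t) divfK ?gt_eqF//.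
  rewrite (_ : dot 0 _ = 0); last by apply: big1 => i _; rewrite mxE mul0r.
  rewrite expR0 mulr1 [RHS]mulrCA; congr (_ * _); first by rewrite opprB addrA (addrC y z).
  rewrite phiE// opprD addrA subrr sub0r sqnormN /gmix mulr0 addr0 ln1 mulr0 oppr0 add0r divr1 mulr1.
  by rewrite -expRD.
under eq_fun do rewrite E.
have pt0 : 0 < 2 * pi * t by rewrite !mulr_gt0// pi_gt0.
rewrite integral_RdZl ?expR_ge0//; last 2 first.
- apply: meas_vec_EFin.
  have c1 : coord_meas (fun t : d.-tuple R => tvec t - (x - y)).
    by apply: coord_measD; [exact: coord_meas_tvec|exact: coord_meas_cst].
  apply: measurable_funM; first apply: measurable_funM.
  + exact: measurable_phi.
  + by apply: measurableT_comp => //; exact: measurable_dot.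
  + apply: measurable_gmix => //; apply: measurable_funM => //.
    by apply: measurable_sqnorm; exact: coord_meas_tvec.
- by move=> z; rewrite lee_fin !mulr_ge0 ?expR_ge0// ltW// ?gmix_gt0//.
rewrite gaussian_gmix_integral//; last by rewrite add0r mul1r addr_gt0.
rewrite -EFinM; congr EFin.
rewrite (_ : sqnorm 0 = 0); last by apply: big1 => i _; rewrite mxE expr0n.
rewrite mulr0 mul0r expR0 mul1r scaler0 addr0 phiE ?addr_gt0//.
rewrite -expRD; congr expR.
have -> : ln (2 * pi * (s + t)) = ln (2 * pi * t) + ln (1 + 1 * (0 + s / t)).
  rewrite -lnM ?posrE ?addr_gt0//; last by rewrite add0r mul1r.
  by congr ln; field; rewrite gt_eqF.
rewrite sqnormB_sym; field.
by rewrite !gt_eqF ?addr_gt0.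
Qed.

(** Stated with sums only, since the integral of [f3] may be infinite and nothing can be subtracted
    before integrating. *)
Lemma integral_Rd_le_combination (f1 f2 f3 : 'rV[R]_d -> R) (K1 K2 I1 I2 : R) :
  meas_vec (EFin \o f1) -> meas_vec (EFin \o f2) -> meas_vec (EFin \o f3) ->
  (forall y, 0 <= f1 y) -> (forall y, 0 <= f2 y) -> (forall y, 0 <= f3 y) ->
  0 <= K1 -> 0 <= K2 ->
  integral_Rd (EFin \o f1) = I1%:E -> integral_Rd (EFin \o f2) = I2%:E ->
  (forall y, K1 * f1 y <= f3 y + K2 * f2 y) ->
  ((K1 * I1)%:E <= integral_Rd (EFin \o f3) + (K2 * I2)%:E)%E.
Proof.
move=> m1 m2 m3 p1 p2 p3 K10 K20 i1 i2 h.
have k1 : meas_vec (fun y => K1%:E * (EFin \o f1) y)%E by exact: measurable_funeM.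
have k2 : meas_vec (fun y => K2%:E * (EFin \o f2) y)%E by exact: measurable_funeM.
rewrite !EFinM -i1 -i2 -integral_RdZl// -integral_RdZl//.
rewrite -integral_RdD//; last by move=> y; rewrite -EFinM lee_fin mulr_ge0.
apply: le_integral_Rd => //.
- exact: emeasurable_funD.
- by move=> y; rewrite -EFinM lee_fin mulr_ge0.
Qed.

(** The tangent at [c] of the convex function [y^(-b)], obtained from [exp x >= 1 + x] and
    [ln x <= x - 1]. *)
Lemma powR_tangent (b y c : R) : 0 < b -> 0 < y -> 0 < c ->
  (1 + b) * c `^ (- b) <= y `^ (- b) + b * (c `^ (- b - 1) * y).
Proof.
move=> b0 y0 c0; have t0 : 0 < y / c by rewrite divr_gt0.
have cb : 0 < c `^ (- b) by rewrite powR_gt0.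
have -> : c `^ (- b - 1) * y = c `^ (- b) * (y / c).
  rewrite powRD; last by apply/implyP => _; rewrite gt_eqF.
  by rewrite powR_inv1 ?ltW// -mulrA (mulrC _ y).
have -> : y `^ (- b) = c `^ (- b) * (y / c) `^ (- b).
  by rewrite -powRM ?ltW// (mulrC c) divfK// gt_eqF.
rewrite mulrCA -mulrDr mulrC ler_pM2l//.
have h1 : 1 - b * ln (y / c) <= (y / c) `^ (- b).
  by rewrite /powR (gt_eqF t0) (le_trans _ (expR_ge1Dx _))// mulNr.
have h2 : ln (y / c) <= y / c - 1.
  have := @le_ln1Dx R (y / c - 1); rewrite ltrBrDr addNr => /(_ t0).
  by rewrite addrC subrK.
have := ler_wpM2l (ltW b0) h2; lra.
Qed.

Local Notation P tau x b := ((gmean tau (rad x)) `^ (- b)).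

Lemma measurable_gmean_pow d0 (X : measurableType d0) (tau b : R) (u : X -> 'rV[R]_d) :
  coord_meas u -> measurable_fun setT (fun p => P tau (u p) b).
Proof.
move=> mu; apply: (measurableT_comp (measurable_powR (- b))).
by apply: measurable_gmean; apply: measurable_funM => //; exact: measurable_sqnorm.
Qed.

(** The tangent to [y^(-b)] is taken at a point [c y] varying with [y], the log-linear approximation
    of [gmean tau] around [x]. Both [c^(-b)] and [c^(-b-1)] are then exponentials of linear forms,
    so two of the three integrals are explicit and [gmean_step] compares them. *)
Lemma gmean_pow_step (tau b e : R) x : 0 <= tau -> 0 < b <= 1 -> 0 < e <= 1 ->
  2 * rad x * (\int[nu a k.+1]_s (smap tau s ^+ 2 * gmix d tau (rad x) s)) * gmean tau (rad x) <=
    d%:R * (\int[nu a k.+1]_s (smap tau s * gmix d tau (rad x) s)) * gmean tau (rad x)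
    + (1 + b) * rad x * (\int[nu a k.+1]_s (smap tau s * gmix d tau (rad x) s)) ^+ 2 ->
  ((P tau x b)%:E <=
    integral_Rd (fun y => (phi (y - x) (v * e) * P (tau + e) y b)%:E) +
    (step_err d k (rad x) e * P tau x b)%:E)%E.
Proof.
move=> tau0 /andP[b0 b1] e01 T; have /andP[e0 e1] := e01.
have ve0 : 0 < v * e by rewrite mulr_gt0.
have te0 : 0 <= tau + e by rewrite addr_ge0// ltW.
have b01 : 0 <= b <= 1 by rewrite ltW.
have M := gmean_step a0 tau0 (rad_ge0 x) b01 e01 T.
pose A := gmean tau (rad x); pose h := gslope tau (rad x).
have A0 : 0 < A by exact: (gmean_gt0 d a0 k tau0 (rad_ge0 x)).
(* The tilts carried by [c^(-b)] and [c^(-b-1)], where [- (h / v) x] is the gradient of the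
   logarithm of [gmean tau] at [x]. *)
pose q1 := (b * h / v) *: x; pose q2 := ((b + 1) * h / v) *: x.
pose c y := A * expR (dot (- (h / v) *: x) (y - x)).
have c0 y : 0 < c y by rewrite mulr_gt0// expR_gt0.
have cb y (z : R) : c y `^ z = A `^ z * expR (z * dot (- (h / v) *: x) (y - x)).
  by rewrite powRM ?expR_ge0 ?(ltW A0)// (mulrC z) expRM.
have G0 y : 0 < gmean (tau + e) (rad y) by exact: (gmean_gt0 d a0 k te0 (rad_ge0 y)).
have phi0 y : 0 < phi (y - x) (v * e) by exact: phi_gt0.
have cyx : coord_meas (fun t : d.-tuple R => tvec t - x).
  by apply: coord_measD; [exact: coord_meas_tvec|exact: coord_meas_cst].
have cy : coord_meas (fun t : d.-tuple R => tvec t) by exact: coord_meas_tvec.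
have mphi : measurable_fun setT (fun t : d.-tuple R => phi (tvec t - x) (v * e)).
  exact: measurable_phi.
have mdot q : measurable_fun setT (fun t : d.-tuple R => expR (dot q (tvec t - x))).
  by apply: measurableT_comp => //; exact: measurable_dot.
have mG : measurable_fun setT (fun t : d.-tuple R => gmean (tau + e) (rad (tvec t))).
  by apply: measurable_gmean; apply: measurable_funM => //; exact: measurable_sqnorm.
have m1 : meas_vec (fun y => (phi (y - x) (v * e) * P (tau + e) y b)%:E).
  by apply: meas_vec_EFin; apply: measurable_funM => //; exact: measurable_gmean_pow.
have m2 : meas_vec (fun y => (phi (y - x) (v * e) * expR (dot q2 (y - x)) *
    gmean (tau + e) (rad y))%:E).
  by apply: meas_vec_EFin; apply: measurable_funM => //; exact: measurable_funM.
have m3 : meas_vec (fun y => (phi (y - x) (v * e) * expR (dot q1 (y - x)))%:E).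
  by apply: meas_vec_EFin; exact: measurable_funM.
pose K2 := b * A `^ (- b - 1); pose K1 := (1 + b) * A `^ (- b).
have K20 : 0 <= K2 by rewrite mulr_ge0 ?powR_ge0// ltW.
have K10 : 0 <= K1 by rewrite mulr_ge0 ?powR_ge0// addr_ge0// ltW.
have pw y : K1 * (phi (y - x) (v * e) * expR (dot q1 (y - x))) <=
    phi (y - x) (v * e) * P (tau + e) y b +
    K2 * (phi (y - x) (v * e) * expR (dot q2 (y - x)) * gmean (tau + e) (rad y)).
  have := ler_wpM2l (ltW (phi0 y)) (powR_tangent b0 (G0 y) (c0 y)).
  rewrite !cb.
  have -> : - b * dot (- (h / v) *: x) (y - x) = dot q1 (y - x).
    by rewrite /q1 !dotZl; ring.
  have -> : (- b - 1) * dot (- (h / v) *: x) (y - x) = dot q2 (y - x).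
    by rewrite /q2 !dotZl; ring.
  rewrite /K1 /K2.
  move: (P (tau + e) y b) (phi (y - x) (v * e)) (expR (dot q1 (y - x))) => gb p e1'.
  move: (expR (dot q2 (y - x))) (gmean (tau + e) (rad y)) (A `^ (- b)) (A `^ (- b - 1)).
  by move=> e2' g a1 a2; lra.
have I1 := gaussian_laplace q1 x e0.
have I2 := gaussian_gmean_integral q2 x e0 te0.
have L := integral_Rd_le_combination m3 m2 m1
  (fun y => mulr_ge0 (ltW (phi0 y)) (expR_ge0 _))
  (fun y => mulr_ge0 (mulr_ge0 (ltW (phi0 y)) (expR_ge0 _)) (ltW (G0 y)))
  (fun y => mulr_ge0 (ltW (phi0 y)) (powR_ge0 _ _)) K10 K20 I1 I2 pw.
have E1 : v * e * sqnorm q1 / 2 = b ^+ 2 * e * h ^+ 2 * rad x.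
  by rewrite /q1 sqnormZ; field; rewrite gt_eqF.
have E2 : v * e * sqnorm q2 / 2 = (b + 1) ^+ 2 * e * h ^+ 2 * rad x.
  by rewrite /q2 sqnormZ; field; rewrite gt_eqF.
have E3 : rad (x + (v * e) *: q2) = rad x * (1 + (b + 1) * e * h) ^+ 2.
  rewrite /q2 scalerA -{1}[x]scale1r -scalerDl sqnormZ.
  by field; rewrite gt_eqF.
have E4 : tau + e + e = tau + 2 * e by ring.
move: L; rewrite E1 E2 E3 E4 -leeBlDr// -EFinB => L.
rewrite -leeBlDr//; apply: le_trans L; rewrite -EFinB lee_fin.
rewrite -/A -/h in M *.
rewrite /K1 /K2.
have -> : A `^ (- b - 1) = A `^ (- b) / A.
  rewrite powRD; last by apply/implyP => _; rewrite gt_eqF.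
  by rewrite powR_inv1 ?ltW.
have Ab : 0 <= A `^ (- b) by exact: powR_ge0.
have := ler_wpM2l Ab M.
move: (gmean (tau + 2 * e) (rad x * (1 + (b + 1) * e * h) ^+ 2)) (A `^ (- b)) A^-1.
move: (expR (b ^+ 2 * e * h ^+ 2 * rad x)) (expR ((b + 1) ^+ 2 * e * h ^+ 2 * rad x)).
move: (step_err d k (rad x) e) => x1 x2 x3 x4 x5 x6; lra.
Qed.

End gaussian_step.

(** * Iteration of the Gaussian step and passage to the limit *)

Section heat_flow.
Variable R : realType.
Variables (d : nat) (a : R) (a0 : 0 < a) (ad : d%:R / 2 = a + 1).
Variable k : nat.
Variables (v : R) (v0 : 0 < v).
Variables (tmax b th : R).
Hypotheses (tmax0 : 0 < tmax) (b0 : 0 < b) (b1 : b <= 1) (th0 : 0 < th) (th1 : th < 1).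
Hypothesis bE : (1 + b) * k.+1%:R = 2 * k%:R + th.
Hypothesis tmaxE : 2 * k%:R * tmax * (k.+1%:R * ((a + 1) / (a + 2))) <= th.
Hypothesis btmax : b * k.+1%:R * tmax < 1.
Local Notation Sk := (nu_supported a0).
Local Notation gmean := (gmean d a k).
Local Notation rad x := (sqnorm x / (2 * v)).
Local Notation P tau x := ((gmean tau (rad x)) `^ (- b)).
Local Notation kR := (k.+1%:R : R).
Implicit Types x y w : 'rV[R]_d.

(** Chosen so that [rate * tmax] is the midpoint of [b kR tmax] and 1: the flow grows like
    [exp (b kR rad)], the error may cost a further [exp (2 del rad)], and the product stays
    integrable against variance [v tmax]. *)
Let del : R := (1 - b * kR * tmax) / (4 * tmax).
Let rate : R := b * kR + 2 * del.

Lemma del_gt0 : 0 < del.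
Proof. by rewrite divr_gt0 ?subr_gt0// mulr_gt0. Qed.

Lemma rate_tmax : rate * tmax < 1.
Proof.
have -> : rate * tmax = (1 + b * kR * tmax) / 2.
  by rewrite /rate /del; field; rewrite gt_eqF.
rewrite ltr_pdivrMr// mul1r; move: btmax; lra.
Qed.

Lemma rate_gt0 : 0 < rate.
Proof.
by apply: addr_gt0; apply: mulr_gt0 => //; exact: del_gt0.
Qed.

Lemma superharmonic_condition (tau r : R) : 0 <= tau <= tmax -> 0 <= r ->
  2 * r * (\int[nu a k.+1]_s (smap tau s ^+ 2 * gmix d tau r s)) * gmean tau r <=
    d%:R * (\int[nu a k.+1]_s (smap tau s * gmix d tau r s)) * gmean tau r
    + (1 + b) * r * (\int[nu a k.+1]_s (smap tau s * gmix d tau r s)) ^+ 2.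
Proof.
move=> /andP[t0 tm] r0; apply: (gmix_superharmonic a0 ad t0 r0 th0 th1 bE).
apply: le_trans tmaxE; rewrite ler_wpM2r//.
  by rewrite mulr_ge0// divr_ge0 ?addr_ge0// ltW.
by rewrite ler_wpM2l// mulr_ge0.
Qed.

Let Cs : R := step_lin R d k + step_quad R d k.
Let K1 : R := (step_quad R d k + Cs ^+ 2) * (4 / del ^+ 2) * expR (2 * del).
Let K2 : R := K1 * expR (b * (d%:R / 2 * ln (1 + kR * tmax))).

Lemma step_quad_ge0 : 0 <= step_quad R d k.
Proof. by rewrite addr_ge0 ?mulr_ge0 ?exprn_ge0. Qed.

Lemma step_lin_gt0 : 0 < step_lin R d k.
Proof. by rewrite ltr_wpDr ?mulr_ge0// mulr_gt0// exprn_gt0. Qed.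

Lemma Cs_gt0 : 0 < Cs.
Proof. by rewrite ltr_wpDr ?step_quad_ge0 ?step_lin_gt0. Qed.

Lemma K1_ge0 : 0 <= K1.
Proof.
by rewrite !mulr_ge0 ?expR_ge0 ?invr_ge0 ?addr_ge0 ?sqr_ge0 ?step_quad_ge0.
Qed.

(** One factor [exp (del (1 + r))] pays for [(1 + r)^2], by [y^2 <= 4 exp y]; a second one pays for
    the exponential inside [step_err]. *)
Lemma step_err_le (e r : R) : 0 < e -> e * Cs <= del -> 0 <= r ->
  step_err d k r e <= e ^+ 2 * K1 * expR (2 * del * r).
Proof.
move=> e0 eC r0; rewrite /step_err -/Cs /K1.
have q0 := step_quad_ge0; have C0 := Cs_gt0; have d0 := del_gt0.
move: (step_quad R d k) (Cs) (del) q0 C0 d0 eC => q C D q0 C0 D0 eC.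
have r1 : 1 <= 1 + r by rewrite lerDl.
have r10 : 0 <= 1 + r by rewrite addr_ge0.
have e20 : 0 <= e ^+ 2 by exact: sqr_ge0.
have h1 : (1 + r) ^+ 2 <= 4 / D ^+ 2 * expR (D * (1 + r)).
  have := sqr_le_expR (mulr_ge0 (ltW D0) r10).
  by rewrite [X in _ -> _ <= X]mulrAC ler_pdivlMr ?exprn_gt0// -exprMn (mulrC (1 + r)).
have h2 : expR (e * C * (1 + r)) <= expR (D * (1 + r)) by rewrite ler_expR ler_wpM2r.
have h3 : 1 <= expR (D * (1 + r)) by rewrite -[leLHS]expR0 ler_expR; apply: mulr_ge0 => //; exact: ltW.
have E : expR (2 * D) * expR (2 * D * r) = expR (D * (1 + r)) * expR (D * (1 + r)).
  by rewrite -!expRD; congr expR; ring.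
rewrite -[leRHS]mulrA -[_ * _ * expR (2 * D * r)]mulrA E.
move: (expR (D * (1 + r))) (expR (e * C * (1 + r))) h1 h2 h3 (expR_ge0 (e * C * (1 + r))).
move=> X Y h1 h2 h3 Y0.
have h4 : (1 + r) <= 4 / D ^+ 2 * X * X.
  apply: (@le_trans _ _ ((1 + r) ^+ 2)).
    by rewrite expr2 ler_peMr.
  by rewrite (le_trans h1)// ler_peMr// (le_trans _ h1)// sqr_ge0.
have h5 : (1 + r) ^+ 2 * Y <= 4 / D ^+ 2 * X * X.
  by rewrite ler_pM// sqr_ge0.
have := ler_wpM2l (mulr_ge0 e20 q0) h4.
have := ler_wpM2l (mulr_ge0 e20 (sqr_ge0 C)) h5.
move: (4 / D ^+ 2) => Z; lra.
Qed.

(** The law of [s] lives on [[0, kR]] and [smap tau s <= s], so the mixture decays no faster than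
    [exp (- kR rad)] up to a constant. *)
Lemma gmean_pow_le (tau : R) x : 0 <= tau <= tmax ->
  P tau x <= expR (b * (d%:R / 2 * ln (1 + kR * tmax))) * expR (b * kR * rad x).
Proof.
move=> /andP[t0 tm]; have r0 := rad_ge0 v0 x.
have A0 := gmean_gt0 d a0 k t0 r0.
rewrite /powR (gt_eqF A0) -expRD ler_expR.
have low : - (d%:R / 2 * ln (1 + kR * tmax)) - kR * rad x <= ln (gmean tau (rad x)).
  rewrite -ler_expR lnK ?posrE// -[leLHS](supported_cst (nu a k.+1)).
  apply: (supported_le (Sk _)); [exact: lbd_cst|exact: lbd_gmix|].
  move=> s /andP[s0 sk].
  have ks : 0 <= kR by exact: ler0n.
  rewrite ler_expR lerD// lerN2.
    rewrite ler_wpM2l ?divr_ge0// ler_ln ?posrE ?ltr_pwDl ?mulr_ge0// ?(ltW tmax0)//.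
    by rewrite lerD2l ler_pM.
  by rewrite mulrC ler_wpM2r// (le_trans _ sk)// (smap_le t0 s0).
have := ler_wpM2l (ltW b0) low; lra.
Qed.

Local Notation flow tau w := (integral_Rd (fun x => (phi (x - w) (v * tau) * P tau x)%:E)).

Lemma step_err_bound (tau e : R) x : 0 <= tau <= tmax -> 0 < e -> e * Cs <= del ->
  step_err d k (rad x) e * P tau x <= e ^+ 2 * K2 * expR (rate * rad x).
Proof.
move=> t0 e0 eC; have r0 := rad_ge0 v0 x.
apply: (@le_trans _ _ (e ^+ 2 * K1 * expR (2 * del * rad x) *
   (expR (b * (d%:R / 2 * ln (1 + kR * tmax))) * expR (b * kR * rad x)))).
  apply: ler_pM.
  - apply: addr_ge0; last by apply: mulr_ge0; [exact: sqr_ge0|exact: expR_ge0].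
    apply: mulr_ge0; last exact: addr_ge0.
    by apply: mulr_ge0; [exact: sqr_ge0|exact: step_quad_ge0].
  - exact: powR_ge0.
  - exact: step_err_le.
  - exact: gmean_pow_le.
have -> : expR (rate * rad x) = expR (b * kR * rad x) * expR (2 * del * rad x).
  by rewrite -expRD -mulrDl.
rewrite /K2.
rewrite le_eqVlt; apply/orP; left; apply/eqP; ring.
Qed.

(** At the negative rate [- rate], [gmix] is the Gaussian mean of [exp (rate * rad)]. It increases
    with time, so its value at [tmax] bounds the error of every step. *)
Let Gmax w : R := gmix d tmax (rad w) (- rate).

Lemma gmix_rate_le (tau : R) w : 0 <= tau <= tmax -> gmix d tau (rad w) (- rate) <= Gmax w.
Proof.
move=> /andP[t0 tm]; have r0 := rad_ge0 v0 w.
have h1 := rate_tmax; have rt := rate_gt0.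
have h2 : rate * tau <= rate * tmax by rewrite ler_wpM2l// ltW.
have p1 : 0 < 1 + - rate * tau by move: h1 h2; lra.
have p2 : 0 < 1 + - rate * tmax by move: h1 h2; lra.
have p3 : 1 + - rate * tmax <= 1 + - rate * tau by move: h1 h2; lra.
have p4 : (1 + - rate * tau)^-1 <= (1 + - rate * tmax)^-1 by rewrite lef_pV2 ?posrE.
have nrt : - rate <= 0 by rewrite oppr_le0 ltW.
rewrite ler_expR lerD// lerN2.
  by rewrite ler_wpM2l ?divr_ge0// ler_ln.
by rewrite ler_wpM2l// ler_wnM2l.
Qed.

Lemma rate_integral (tau : R) w : 0 < tau <= tmax ->
  (integral_Rd (fun x => (phi (x - w) (v * tau) * expR (rate * rad x))%:E) <= (Gmax w)%:E)%E.
Proof.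
move=> /andP[t0 tm].
have h1 := rate_tmax; have rt := rate_gt0.
have h2 : rate * tau <= rate * tmax by rewrite ler_wpM2l// ltW.
have := @gaussian_gmix_integral R d v tau 0 (- rate) 0 w v0 t0.
rewrite mulr0 addr0 ltr01 add0r => /(_ isT) h.
have {}h := h (_ : 0 < 1 + - rate * tau).
rewrite (_ : (fun x => _) = (fun y => (phi (y - w) (v * tau) * expR (dot 0 (y - w)) *
     gmix d 0 (rad y) (- rate))%:E)); last first.
  apply/funext => y; congr EFin; rewrite (_ : dot 0 _ = 0); last first.
    by apply: big1 => i _; rewrite mxE mul0r.
  rewrite expR0 mulr1; congr (_ * _).
  by rewrite /gmix mulr0 addr0 ln1 mulr0 oppr0 add0r divr1 mulrN opprK mulrC.
rewrite h; last by move: h1 h2; lra.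
rewrite (_ : sqnorm 0 = 0); last by apply: big1 => i _; rewrite mxE expr0n.
rewrite mulr0 mul0r expR0 mul1r scaler0 addr0 lee_fin gmix_rate_le//.
by rewrite (ltW t0).
Qed.

Lemma K2_ge0 : 0 <= K2. Proof. by rewrite mulr_ge0 ?K1_ge0 ?expR_ge0. Qed.

(** Separate from [flow_step] because the Gaussian kernel degenerates at time 0; the iteration
    starts from the pointwise value at [w] instead. *)
Lemma flow_first (e : R) w : 0 < e <= 1 -> e * Cs <= del ->
  ((P 0 w)%:E <= flow e w + (e ^+ 2 * K2 * Gmax w)%:E)%E.
Proof.
move=> e01 eC; have /andP[e0 e1] := e01.
have t0 : 0 <= (0 : R) <= tmax by rewrite lexx ltW.
have b01 : 0 < b <= 1 by rewrite b0.
have := gmean_pow_step a0 v0 (lexx 0) b01 e01 (superharmonic_condition t0 (rad_ge0 v0 w)).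
rewrite add0r => /le_trans; apply; rewrite leeD2l// lee_fin.
apply: le_trans (step_err_bound w t0 e0 eC) _.
apply: ler_wpM2l; first by apply: mulr_ge0; [exact: sqr_ge0|exact: K2_ge0].
apply: le_trans (gmix_rate_le w t0).
by rewrite /gmix mulr0 addr0 ln1 mulr0 oppr0 add0r divr1 mulrN opprK mulrC.
Qed.

(** The one-step inequality is averaged over [x]; the kernels of variances [v tau] and [v e] merge
    by [phi_convolution], and the averaged error is bounded uniformly in [tau] by
    [rate_integral]. *)
Lemma flow_step (tau e : R) w : 0 < tau -> tau <= tmax -> 0 < e <= 1 -> e * Cs <= del ->
  (flow tau w <= flow (tau + e) w + (e ^+ 2 * K2 * Gmax w)%:E)%E.
Proof.
move=> t0 tm e01 eC; have /andP[e0 e1] := e01.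
have t0' : 0 <= tau <= tmax by rewrite ltW.
have b01 : 0 < b <= 1 by rewrite b0.
have vt : 0 < v * tau by rewrite mulr_gt0.
have ve : 0 < v * e by rewrite mulr_gt0.
have st x := gmean_pow_step a0 v0 (ltW t0) b01 e01 (superharmonic_condition t0' (rad_ge0 v0 x)).
pose F x y := (phi (x - w) (v * tau) * phi (y - x) (v * e) * P (tau + e) y)%:E.
pose H x := integral_Rd (fun y => (phi (y - x) (v * e) * P (tau + e) y)%:E).
have c2 : coord_meas (fun p : d.-tuple R * d.-tuple R => tvec p.2) by exact: coord_meas_tvec.
have c1 : coord_meas (fun p : d.-tuple R * d.-tuple R => tvec p.1) by exact: coord_meas_tvec.
have c21 : coord_meas (fun p : d.-tuple R * d.-tuple R => tvec p.2 - tvec p.1).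
  by apply: coord_measD => //; exact: coord_measN.
have c1w : coord_meas (fun p : d.-tuple R * d.-tuple R => tvec p.1 - w).
  by apply: coord_measD => //; exact: coord_meas_cst.
have mP (X : measurableType _) (u : X -> 'rV[R]_d) t : coord_meas u ->
    measurable_fun setT (fun p => P t (u p)) by move=> ?; exact: measurable_gmean_pow.
have mH2 : meas_vec2 (fun x y => (phi (y - x) (v * e) * P (tau + e) y)%:E).
  by apply: meas_vec2_EFin; apply: measurable_funM; [exact: measurable_phi|exact: measurable_gmean_pow].
have mH : meas_vec H.
  by apply: (meas_vec2_integral mH2) => x y; rewrite lee_fin mulr_ge0 ?powR_ge0// ltW// phi_gt0.
have H0 x : (0 <= H x)%E.
  by apply: integral_Rd_ge0 => y; rewrite lee_fin mulr_ge0 ?powR_ge0// ltW// phi_gt0.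
have ct : coord_meas (fun t : d.-tuple R => tvec t) by exact: coord_meas_tvec.
have ctw : coord_meas (fun t : d.-tuple R => tvec t - w).
  by apply: coord_measD => //; exact: coord_meas_cst.
have mphi : meas_vec (fun x => (phi (x - w) (v * tau))%:E).
  by apply: meas_vec_EFin; exact: measurable_phi.
have phi0 x : 0 <= phi (x - w) (v * tau) by rewrite ltW// phi_gt0.
have mE : meas_vec (fun x => (phi (x - w) (v * tau) * expR (rate * rad x))%:E).
  apply: meas_vec_EFin; apply: measurable_funM; first exact: measurable_phi.
  apply: measurableT_comp => //; apply: measurable_funM => //.
  by apply: measurable_funM => //; exact: measurable_sqnorm.
have eK : 0 <= e ^+ 2 * K2 by rewrite mulr_ge0 ?sqr_ge0 ?K2_ge0.
have pw x : ((phi (x - w) (v * tau) * P tau x)%:E <=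
    (phi (x - w) (v * tau))%:E * H x +
    (e ^+ 2 * K2)%:E * (phi (x - w) (v * tau) * expR (rate * rad x))%:E)%E.
  rewrite EFinM; apply: le_trans (lee_wpmul2l _ (st x)) _; first by rewrite lee_fin.
  rewrite muleDr ?fin_num_adde_defl// leeD2l// -!EFinM lee_fin [leRHS]mulrCA ler_wpM2l//.
  exact: step_err_bound.
apply: (@le_trans _ _ (integral_Rd (fun x => (phi (x - w) (v * tau))%:E * H x)%E +
   (e ^+ 2 * K2)%:E * integral_Rd (fun x => (phi (x - w) (v * tau) * expR (rate * rad x))%:E))%E).
  have m1 : meas_vec (fun x => (phi (x - w) (v * tau))%:E * H x)%E by exact: emeasurable_funM.
  have m2 : meas_vec (fun x => (e ^+ 2 * K2)%:E * (phi (x - w) (v * tau) * expR (rate * rad x))%:E)%E.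
    exact: measurable_funeM.
  have z2 x : (0 <= (phi (x - w) (v * tau) * expR (rate * rad x))%:E)%E.
    by rewrite lee_fin mulr_ge0 ?expR_ge0.
  rewrite -integral_RdZl// -integral_RdD//; last 2 first.
  - by move=> x; rewrite mule_ge0// lee_fin.
  - by move=> x; rewrite mule_ge0// lee_fin.
  apply: le_integral_Rd => //.
  - by apply: meas_vec_EFin; apply: measurable_funM; [exact: measurable_phi|exact: measurable_gmean_pow].
  - exact: emeasurable_funD.
  - by move=> x; rewrite lee_fin mulr_ge0 ?powR_ge0.
apply: leeD.
  have -> : integral_Rd (fun x => (phi (x - w) (v * tau))%:E * H x)%E =
      integral_Rd (fun x => integral_Rd (F x)).
    congr integral_Rd; apply/funext => x; rewrite /H -integral_RdZl//.
    - by congr integral_Rd; apply/funext => y; rewrite /F -EFinM mulrA.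
    - apply: meas_vec_EFin; apply: measurable_funM; last exact: measurable_gmean_pow.
      by apply: measurable_phi; apply: coord_measD => //; exact: coord_meas_cst.
    - by move=> y; rewrite lee_fin mulr_ge0 ?powR_ge0// ltW// phi_gt0.
  have mF : meas_vec2 F.
    apply: meas_vec2_EFin; apply: measurable_funM; last exact: measurable_gmean_pow.
    by apply: measurable_funM; exact: measurable_phi.
  rewrite integral_Rd_swap//; last first.
    by move=> x y; rewrite lee_fin !mulr_ge0 ?powR_ge0// ltW// phi_gt0.
  rewrite le_eqVlt; apply/orP; left; apply/eqP; congr integral_Rd; apply/funext => y.
  rewrite mulrDr EFinM -(phi_convolution w y vt ve) muleC -integral_RdZl ?powR_ge0//.
  - by congr integral_Rd; apply/funext => x; rewrite /F -EFinM mulrC.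
  - apply: meas_vec_EFin; apply: measurable_funM; apply: measurable_phi => //.
    by apply: coord_measD; [exact: coord_meas_cst|exact: coord_measN].
  - by move=> x; rewrite lee_fin mulr_ge0// ltW// phi_gt0.
rewrite [leRHS]EFinM lee_wpmul2l ?lee_fin//.
by apply: rate_integral; rewrite t0.
Qed.

Lemma flow_iter (N n : nat) w : (0 < N)%N -> (n.+1 <= N)%N ->
  tmax / N%:R <= 1 -> tmax / N%:R * Cs <= del ->
  ((P 0 w)%:E <= flow (tmax / N%:R * n.+1%:R) w +
     (n.+1%:R * ((tmax / N%:R) ^+ 2 * K2 * Gmax w))%:E)%E.
Proof.
move=> N0 nN h1 h2; have NR : 0 < N%:R :> R by rewrite ltr0n.
set e := tmax / N%:R; have e0 : 0 < e by rewrite divr_gt0.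
have e01 : 0 < e <= 1 by rewrite e0.
elim: n nN => [|n IH] nN; first by rewrite mulr1 mul1r; exact: flow_first.
have nN' : (n.+1 <= N)%N by exact: ltnW.
apply: le_trans (IH nN') _.
have tn : e * n.+1%:R <= tmax.
  by rewrite /e mulrAC ler_pdivrMr// ler_wpM2l ?(ltW tmax0)// ler_nat.
have t0 : 0 < e * n.+1%:R by rewrite mulr_gt0.
have := flow_step w t0 tn e01 h2.
rewrite (_ : e * n.+1%:R + e = e * n.+2%:R); last by rewrite -[in RHS]natr1 mulrDr mulr1.
move=> h; apply: le_trans (leeD2r _ h) _.
rewrite -addeA -EFinD leeD2l// lee_fin -[n.+2%:R]natr1.
by rewrite [leRHS]mulrDl mul1r addrC.
Qed.

Theorem flow_bound w : ((P 0 w)%:E <= flow tmax w)%E.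
Proof.
apply/lee_addgt0Pr => eps eps0.
pose G := Gmax w; have G0 : 0 < G by exact: expR_gt0.
have K20 := K2_ge0; have C0 := Cs_gt0; have d0 := del_gt0.
(* One summand for each requirement on the step [tmax / N]: it is at most 1, its product with [Cs]
   is at most [del], and the total error [tmax^2 K2 G / N] is at most [eps]. *)
pose B := tmax + tmax * Cs / del + tmax ^+ 2 * K2 * G / eps.
have B1 : 0 <= tmax * Cs / del by rewrite !mulr_ge0 ?invr_ge0// ltW.
have B2 : 0 <= tmax ^+ 2 * K2 * G / eps.
  by rewrite mulr_ge0 ?invr_ge0 ?(ltW eps0)// mulr_ge0 ?(ltW G0)// mulr_ge0 ?sqr_ge0.
have [N N0 BN] : exists2 N : nat, (0 < N)%N & B < N%:R.
  by exists (Num.truncn B).+1 => //; exact: truncnS_gt.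
rewrite /B in BN.
have NR : 0 < N%:R :> R by rewrite ltr0n.
have h1 : tmax / N%:R <= 1 by rewrite ler_pdivrMr// mul1r; lra.
have h2 : tmax / N%:R * Cs <= del.
  rewrite mulrAC ler_pdivrMr// [leRHS]mulrC -ler_pdivrMr//.
  move: BN B1 B2; move: (tmax * Cs / del) (tmax ^+ 2 * K2 * G / eps) => X Y; move: tmax0; lra.
have := @flow_iter N N.-1 w N0 _ h1 h2; rewrite prednK// => /(_ (leqnn _)).
rewrite divfK ?gt_eqF// => /le_trans; apply.
rewrite leeD2l// lee_fin -/G.
rewrite (_ : N%:R * _ = (tmax ^+ 2 * K2 * G) / N%:R); last by field; rewrite gt_eqF.
rewrite ler_pdivrMr// [leRHS]mulrC -ler_pdivrMr//.
move: BN B1 B2; move: (tmax * Cs / del) (tmax ^+ 2 * K2 * G / eps) => X Y; move: tmax0; lra.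
Qed.

End heat_flow.

(** * The harmonic marginal *)

Section harmonic_mixture.
Variable R : realType.
Variables (d : nat) (a : R) (a0 : 0 < a) (ad : d%:R / 2 = a + 1).
Local Notation Rm := (measurableTypeR R).
Local Notation mu := (@lebesgue_measure R).
Local Notation u V := ((V : R) `^ a^-1).
Local Notation G := (gmix d (- 1)).

(** The interval is open so that [s = 1], where [1 - s] vanishes in [gmix d (- 1)], never has to be
    considered. *)
Lemma ge0_integral_nu1 (f : Rm -> \bar R) : measurable_fun setT f ->
  (forall s, 0 <= f s)%E ->
  (\int[nu1 a]_s f s = \int[mu]_(V in `]0%R, 1%R[) f (u V))%E.
Proof.
move=> mf f0; rewrite /nu1 ge0_integral_distribution//.
have mr : measurable_fun setT (fun V : Rm => f (root_map a V)).
  by apply: (measurableT_comp (f := f)) => //; exact: measurable_root_map.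
rewrite /unif01 (@integral_uniform _ 0 1 ltr01 (fun V => f (root_map a V)))// subr0 invr1 mul1e.
apply: (@integral_itv_bndoo _ 0 1 (fun V => f (root_map a V)) true false).
exact: measurable_funTS.
Qed.

Lemma one_powR (x : R) : 1 `^ x = 1 :> R. Proof. by rewrite powR1. Qed.

Lemma root_itv (V : R) : 0 < V < 1 -> 0 < u V < 1.
Proof.
move=> /andP[V0 V1]; rewrite powR_gt0//= -[ltRHS](one_powR a^-1).
by rewrite gt0_ltr_powR ?invr_gt0// nnegrE// ltW.
Qed.

Lemma rootK (V : R) : 0 <= V -> u V `^ a = V.
Proof. by move=> V0; rewrite -powRrM mulVf ?gt_eqF// powRr1. Qed.

Lemma powK (V : R) : 0 <= V -> u (V `^ a) = V.
Proof. by move=> V0; rewrite -powRrM divff ?gt_eqF// powRr1. Qed.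

(* (1+t)^(a+1) e^(-t) <= C / (1+t) with t = s / (1 - s) *)
Lemma gmix_neg1_le (A : R) : 0 < A -> exists2 C : R, 0 <= C & forall s : R, 0 <= s < 1 ->
  G A s <= C * (1 - s).
Proof.
move=> A0; pose b := (a + 2) / A; have b0 : 0 < b by rewrite divr_gt0// addr_gt0.
exists (expR (A + (a + 2) * (ln b - 1))); first exact: expR_ge0.
move=> s /andP[s0 s1]; have s1' : 0 < 1 - s by rewrite subr_gt0.
rewrite -[X in _ * X](lnK (x := 1 - s)) ?posrE// -expRD ler_expR mulrN1.
have hs : s / (1 - s) = (1 - s)^-1 - 1 by field; rewrite gt_eqF.
rewrite hs ad.
have h : ln ((1 - s)^-1 / b) <= (1 - s)^-1 / b - 1.
  have := @le_ln1Dx R ((1 - s)^-1 / b - 1); rewrite ltrBrDr addNr.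
  by rewrite divr_gt0 ?invr_gt0// => /(_ isT); rewrite addrC subrK.
rewrite ln_div ?posrE ?invr_gt0// lnV ?posrE// in h.
have a2 : 0 <= a + 2 by rewrite addr_ge0// ltW.
have {h} := ler_wpM2l a2 h.
have -> : (a + 2) * ((1 - s)^-1 / b - 1) = A * (1 - s)^-1 - (a + 2).
  by rewrite /b; field; rewrite !gt_eqF// addr_gt0.
move: (ln b) (ln (1 - s)) ((1 - s)^-1) => x y z; lra.
Qed.

Lemma root_continuous (V : R) : 0 < V -> {for V, continuous (fun V => u V)}.
Proof. by move=> V0; exact: is_derive1_continuous (is_derive1_powR _ V0). Qed.

Lemma G_continuous (A s : R) : s < 1 -> {for s, continuous (G A)}.
Proof.
move=> s1; have p : 0 < 1 + s * -1 by rewrite mulrN1 subr_gt0.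
have c1 : {for s, continuous (fun s : R => 1 + s * -1)}.
  by apply: cvgD; [exact: cvg_cst|apply: cvgM; [exact: cvg_id|exact: cvg_cst]].
apply: (@continuous_comp _ _ _ _ (@expR R)); last exact: continuous_expR.
apply: cvgB.
  apply: cvgN; apply: cvgM; first exact: cvg_cst.
  by apply: (@continuous_comp _ _ _ (fun s : R => 1 + s * -1) (@ln R)) => //; exact: continuous_ln.
apply: cvgM; first exact: cvg_cst.
apply: cvgM; first exact: cvg_id.
by apply: cvgV => //; rewrite gt_eqF.
Qed.

(** The value 0 at [V = 1] is the limit given by [gmix_neg1_le]; it makes the integrand continuous
    on the closed interval, as the substitution rule requires. *)
Let Gx (A V : R) : R := if V < 1 then G A (u V) else 0.

Lemma Gx_within (A : R) : 0 < A -> {within `[0, 1], continuous (Gx A)}.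
Proof.
move=> A0; apply/continuous_within_itvP => //.
have e (V : R) : V < 1 -> \forall x \near V, G A (u x) = Gx A x.
  move=> V1; near=> x; rewrite /Gx ifT//; near: x; exact: lt_nbhsl.
split.
- move=> V; rewrite in_itv/= => /andP[V0 V1].
  have c : {for V, continuous (fun x => G A (u x))}.
    apply: (@continuous_comp _ _ _ (fun x => u x) (G A)); first exact: root_continuous.
    have V01 : 0 < V < 1 by rewrite V0.
    by apply: G_continuous; have /andP[] := root_itv V01.
  rewrite /continuous_at {2}/Gx V1; apply: cvg_trans c.
  by apply: near_eq_cvg; exact: e.
- have u0 : u 0 = 0 by rewrite powR0// gt_eqF// invr_gt0.
  rewrite {2}/Gx ltr01 u0.
  have c : G A (u x) @[x --> 0^'+] --> G A 0.
    apply: (@cvg_comp _ _ _ (fun x => u x) (G A) _ (nbhs 0)).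
      by apply: powR_cvg0; rewrite invr_gt0.
    exact: G_continuous.
  apply: cvg_trans c; apply: near_eq_cvg.
  by near=> x; rewrite /Gx ifT//; near: x; exact: nbhs_right_lt.
- rewrite {2}/Gx ltxx; have [C C0 hC] := gmix_neg1_le A0.
  apply: (@squeeze_cvgr _ _ _ _ (fun=> 0) (fun x => C * (1 - u x))).
  + near=> x.
    have x01 : 0 < x < 1.
      by apply/andP; split; near: x; [exact: nbhs_left_gt|exact: nbhs_left_lt].
    have /andP[x0 x1] := x01; have /andP[u0 u1] := root_itv x01.
    by rewrite /Gx x1 ltW ?gmix_gt0//= hC// (ltW u0).
  + exact: cvg_cst.
  + have -> : 0 = C * (1 - u 1) by rewrite powR1 subrr mulr0.
    apply: cvgM; first exact: cvg_cst.
    apply: cvgB; first exact: cvg_cst.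
    by apply: cvg_at_left_filter; exact: root_continuous.
Unshelve. all: by end_near. Qed.

Section mobius.
Variables (A : R) (A0 : 0 < A).

(* V |-> V', where V = u^a, V' = u'^a and u'/(1 - u') = A u/(1 - u). *)
Let D (V : R) : R := 1 + (A - 1) * u V.
Let F (V : R) : R := A `^ a * (V * D V `^ (- a)).
Let dF (V : R) : R := A `^ a * D V `^ (- a - 1).

Lemma mobius_den_gt0 (V : R) : 0 <= V <= 1 -> 0 < D V.
Proof.
move=> /andP[V0 V1]; have u0 : 0 <= u V by exact: powR_ge0.
have u1 : u V <= 1.
  rewrite -[leRHS](one_powR a^-1) ge0_ler_powR ?nnegrE ?invr_ge0 ?(ltW a0)//.
rewrite (_ : D V = (1 - u V) + A * u V); last by rewrite /D; ring.
move: u0; rewrite le_eqVlt => /predU1P[<-|u0]; first by rewrite subr0 mulr0 addr0.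
by rewrite ltr_wpDl ?subr_ge0// mulr_gt0.
Qed.

Lemma mobius_den_cvg (Fl : set_system R) (FF : Filter Fl) (V : R) :
  u x @[x --> Fl] --> u V -> D x @[x --> Fl] --> D V.
Proof.
by move=> h; apply: cvgD; [exact: cvg_cst|apply: cvgM => //; exact: cvg_cst].
Qed.

Lemma powR_cvg_at (p V : R) (Fl : set_system R) (FF : Filter Fl) : 0 < D V ->
  D x @[x --> Fl] --> D V -> D x `^ p @[x --> Fl] --> D V `^ p.
Proof.
move=> DV h; apply: (@cvg_comp _ _ _ D (fun y => y `^ p) _ (nbhs (D V))) => //.
exact: (is_derive1_continuous (is_derive1_powR p DV)).
Qed.

Lemma mobius_derive (V : R) : 0 < V < 1 -> is_derive V 1 F (dF V).
Proof.
move=> V01; have /andP[V0 V1] := V01.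
have DV : 0 < D V by apply: mobius_den_gt0; rewrite !ltW.
have du : is_derive V 1 (fun V => u V) (a^-1 * V `^ (a^-1 - 1)) by exact: is_derive1_powR.
have dD := is_derive1_add (is_derive1_const 1 V) (is_derive1_mul (is_derive1_const (A - 1) V) du).
have dp := is_derive1_compose (is_derive1_powR (- a) DV) dD.
have dV := is_derive1_mul (is_derive1_const (A `^ a) V) (is_derive1_mul (is_derive1_id V) dp).
apply: (is_derive_eq dV).
rewrite mul0r !add0r mul0r add0r mul1r /dF; congr (_ * _).
have -> : D V `^ (- a) = D V `^ (- a - 1) * D V.
  rewrite -{3}[D V]powRr1 ?(ltW DV)// -powRD ?subrK//.
  by apply/implyP => _; rewrite gt_eqF.
have uV : V * V `^ (a^-1 - 1) = u V by rewrite mulr_powRB1// ?invr_gt0// ltW.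
transitivity (D V `^ (- a - 1) * (D V - (A - 1) * (V * V `^ (a^-1 - 1)))).
  rewrite /= ; move: (V `^ (a^-1 - 1)) (D V `^ (- a - 1)) => x y.
  by field; rewrite gt_eqF.
by rewrite uV /D addrK mulr1.
Qed.

Lemma mobiusE (V : R) : 0 <= V <= 1 -> F V = (A * u V / D V) `^ a.
Proof.
move=> V01; have DV := mobius_den_gt0 V01; have /andP[V0 _] := V01.
rewrite powRM ?mulr_ge0 ?powR_ge0 ?invr_ge0 ?(ltW A0) ?(ltW DV)//.
rewrite powRM ?powR_ge0 ?(ltW A0)// rootK// /F mulrA; congr (_ * _).
by rewrite -powR_inv1 ?(ltW DV)// -powRrM mulN1r.
Qed.

Lemma gmix_mobius (V : R) : 0 < V < 1 -> Gx 1 (F V) * dF V = A `^ a * G A (u V).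
Proof.
move=> V01; have /andP[V0 V1] := V01; have V01' : 0 <= V <= 1 by rewrite !ltW.
have DV := mobius_den_gt0 V01'.
have /andP[u0 u1] := root_itv V01; have u1' : 0 < 1 - u V by rewrite subr_gt0.
have E : 1 - A * u V / D V = (1 - u V) / D V.
  by rewrite /D in DV *; field; rewrite gt_eqF.
have q0 : 0 < A * u V / D V by rewrite divr_gt0// mulr_gt0.
have q1 : A * u V / D V < 1 by rewrite -subr_gt0 E divr_gt0.
rewrite mobiusE// /Gx ifT; last first.
  by rewrite -[ltRHS](one_powR a) gt0_ltr_powR// nnegrE// ltW.
rewrite powK ?(ltW q0)// /dF mulrCA; congr (_ * _).
rewrite /gmix /powR (gt_eqF DV) -expRD; congr expR.
rewrite !mulrN1 E ad ln_div ?posrE//.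
have -> : A * u V / D V / ((1 - u V) / D V) = A * (u V / (1 - u V)).
  by field; rewrite !gt_eqF.
move: (ln (1 - u V)) (ln (D V)) (A * (u V / (1 - u V))) => x y z; ring.
Qed.

Lemma measurable_gmix_root (B : R) (E : set Rm) : measurable_fun E (fun V : Rm => (G B (u V))%:E).
Proof.
apply: measurable_funTS; apply/measurable_EFinP.
by apply: measurable_gmix => //; exact: measurable_powR.
Qed.

(** With [t = u / (1 - u)] the integral of [G A] becomes that of [a t^(a-1) exp (- A t)] over the
    half-line, a Gamma integral proportional to [A^(-a)]. The Moebius map realises the scaling
    [t |-> A t] without leaving the unit interval. *)
Lemma gmix_neg1_scale :
  ((A `^ a)%:E * \int[nu1 a]_s (G A s)%:E = \int[nu1 a]_s (G 1 s)%:E)%E.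
Proof.
have mG B : measurable_fun setT (fun s : Rm => (G B s)%:E).
  by apply/measurable_EFinP; exact: measurable_gmix.
have G0 B (s : R) : (0 <= (G B s)%:E)%E by rewrite lee_fin ltW// gmix_gt0.
rewrite !ge0_integral_nu1// -ge0_integralZl_EFin ?powR_ge0//; last first.
  exact: measurable_gmix_root.
have dF1 (V : R) : V \in `]0, 1[ -> derive1 F V = dF V.
  by rewrite in_itv/= => V01; rewrite derive1E; have [_ ->] := mobius_derive V01.
have F0 : F 0 = 0 by rewrite /F mul0r mulr0.
have F1 : F 1 = 1.
  rewrite mobiusE ?ler01 ?lexx// powR1 mulr1 /D powR1 mulr1 addrC subrK divff ?gt_eqF//.
  exact: one_powR.
have cdF (Fl : set_system R) (FF : Filter Fl) (V : R) : 0 <= V <= 1 ->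
  u x @[x --> Fl] --> u V -> dF x @[x --> Fl] --> dF V.
  move=> V01 h; apply: cvgM; first exact: cvg_cst.
  by apply: powR_cvg_at; [exact: mobius_den_gt0|exact: mobius_den_cvg].
have cF (Fl : set_system R) (FF : Filter Fl) (V : R) : 0 <= V <= 1 ->
  u x @[x --> Fl] --> u V -> x @[x --> Fl] --> V -> F x @[x --> Fl] --> F V.
  move=> V01 h hx; apply: cvgM; first exact: cvg_cst.
  apply: cvgM => //.
  by apply: powR_cvg_at; [exact: mobius_den_gt0|exact: mobius_den_cvg].
have u0 : u x @[x --> 0^'+] --> u 0.
  by rewrite powR0 ?gt_eqF ?invr_gt0//; apply: powR_cvg0; rewrite invr_gt0.
have u1 : u x @[x --> 1^'-] --> u 1.
  by apply: cvg_at_left_filter; exact: root_continuous.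
have i0 : 0 <= (0 : R) <= 1 by rewrite lexx ler01.
have i1 : 0 <= (1 : R) <= 1 by rewrite lexx ler01.
have mono : {in `[0, 1] &, {homo F : x y / x < y}}.
  move=> x y; rewrite !in_itv/= => x01 y01 xy; rewrite !mobiusE//.
  have Dx := mobius_den_gt0 x01; have Dy := mobius_den_gt0 y01.
  have uxy : u x < u y.
    have /andP[? _] := x01; have /andP[? _] := y01.
    by rewrite gt0_ltr_powR ?invr_gt0.
  rewrite gt0_ltr_powR ?nnegrE ?mulr_ge0 ?powR_ge0 ?invr_ge0 ?(ltW A0) ?(ltW Dx) ?(ltW Dy)//.
  rewrite ltr_pdivrMr// mulrAC ltr_pdivlMr// /D -subr_gt0.
  rewrite (_ : _ - _ = A * (u y - u x)); first by rewrite mulr_gt0// subr_gt0.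
  ring.
have mGx : measurable_fun setT (Gx 1).
  apply: measurable_fun_ifT => //; first exact: measurable_fun_ltr.
  by apply/measurable_EFinP; exact: measurable_gmix_root.
have := @integration_by_substitution_increasing R F (Gx 1) 0 1 ler01 mono.
rewrite F0 F1 => h.
transitivity (\int[mu]_(x in `[0%R, 1%R]) (((Gx 1 \o F) * derive1 F) x)%:E)%E.
  rewrite (@integral_itv_bndoo _ 0 1 _ true false); last first.
    apply: (@eq_measurable_fun _ _ _ _ _ (fun V => (A `^ a * G A (u V))%:E)).
      move=> V; rewrite inE/= => V01; congr EFin.
      by rewrite -gmix_mobius//= -dF1.
    apply: measurable_funTS; apply/measurable_EFinP; apply: measurable_funM => //.
    by apply/measurable_EFinP; exact: measurable_gmix_root.
  apply: eq_integral => V; rewrite inE/= => V01; rewrite -EFinM; congr EFin.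
  by rewrite -gmix_mobius//= -dF1.
rewrite -h//.
- rewrite (@integral_itv_bndoo _ 0 1 _ true false); last exact/measurable_funTS/measurable_EFinP.
  apply: eq_integral => V; rewrite inE/= in_itv/= => /andP[_ V1].
  by rewrite /Gx V1.
- move=> V V01; have := V01; rewrite in_itv/= => /andP[V0 V1].
  rewrite /continuous_at dF1//.
  have c : dF x @[x --> V] --> dF V.
    by apply: cdF; [rewrite !ltW|exact: root_continuous].
  apply: cvg_trans c; apply: near_eq_cvg.
  have : \forall x \near V, x \in `]0, 1[ by exact: near_in_itvoo.
  by apply: filterS => x hx; rewrite dF1.
- apply/cvg_ex; exists (dF 0); apply: cvg_trans (cdF _ _ _ i0 u0).
  apply: near_eq_cvg; near=> x; rewrite dF1// in_itv/=.
  by apply/andP; split; near: x; [exact: nbhs_right_gt|exact: nbhs_right_lt].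
- apply/cvg_ex; exists (dF 1); apply: cvg_trans (cdF _ _ _ i1 u1).
  apply: near_eq_cvg; near=> x; rewrite dF1// in_itv/=.
  by apply/andP; split; near: x; [exact: nbhs_left_gt|exact: nbhs_left_lt].
- split.
  + by move=> V; rewrite in_itv/= => V01; have [] := mobius_derive V01.
  + by apply: cF => //; exact: cvg_at_right_filter cvg_id.
  + by apply: cF => //; exact: cvg_at_left_filter cvg_id.
- exact: Gx_within.
Unshelve. all: by end_near. Qed.

End mobius.

Lemma gmix_neg1_finite : exists c : R, (\int[nu1 a]_s (G 1 s)%:E = c%:E)%E.
Proof.
have [C C0 hC] := gmix_neg1_le (@ltr01 R).
have mG : measurable_fun setT (fun s : Rm => (G 1 s)%:E).
  by apply/measurable_EFinP; exact: measurable_gmix.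
exists (fine (\int[nu1 a]_s (G 1 s)%:E)); rewrite fineK//.
rewrite ge0_fin_numE; last by apply: integral_ge0 => s _; rewrite lee_fin ltW// gmix_gt0.
rewrite ge0_integral_nu1//; last by move=> s; rewrite lee_fin ltW// gmix_gt0.
apply: (@le_lt_trans _ _ (\int[mu]_(V in `]0%R, 1%R[) C%:E)%E).
  apply: ge0_le_integral => //.
  - by move=> V _; rewrite lee_fin ltW// gmix_gt0.
  - exact: measurable_gmix_root.
  move=> V /=; rewrite in_itv/= => V01; have /andP[u0 u1] := root_itv V01.
  rewrite lee_fin (le_trans (hC _ _)) ?(ltW u0)//.
  by rewrite ler_piMr// gerBl ltW.
rewrite (@integral_cst _ _ _ mu)// [X in (_ * X)%E]lebesgue_measure_itv/= lte_fin ltr01.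
by rewrite -EFinB -EFinM ltry.
Qed.

End harmonic_mixture.

(** * The harmonic marginal as a Gaussian mixture *)

Section harmonic_marginal.
Variable R : realType.
Local Notation Rm := (measurableTypeR R).
Local Notation mu := (@lebesgue_measure R).

(** Needed at the origin, where [enorm^-(d-2)] is 0 by convention while its mixture representation
    is infinite. The slice on which the outermost coordinate vanishes is a null set containing the
    origin. *)
Lemma eq_integral_Rd_neq0 (d : nat) (f g : 'rV[R]_d -> \bar R) : (0 < d)%N ->
  meas_vec f -> meas_vec g -> (forall x, 0 <= f x)%E -> (forall x, 0 <= g x)%E ->
  (forall x, x != 0 -> f x = g x) -> integral_Rd f = integral_Rd g.
Proof.
case: d f g => // n f g _ mf mg f0 g0 fg; rewrite /integral_Rd !iintS.
apply: ae_eq_integral => //.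
- by apply: (measurable_iint_coord (F := fun v => f (\row_i v i))) => //; exact: meas_vec_coord.
- by apply: (measurable_iint_coord (F := fun v => g (\row_i v i))) => //; exact: meas_vec_coord.
exists [set 0]; split => //; first exact: lebesgue_measure_set1.
move=> t /= h; apply/eqP; apply/negPn/negP => t0; apply: h => _.
congr iint; apply/funext => v; apply: fg; apply/negP => /eqP/rowP/(_ ord_max).
by rewrite !mxE /upd/= eqxx => /eqP; exact/negP.
Qed.

Variables (d : nat) (d3 : (3 <= d)%N) (a : R) (a0 : 0 < a) (ad : d%:R / 2 = a + 1).
Variables (v : R) (v0 : 0 < v).
Local Notation rad x := (sqnorm x / (2 * v)).
Local Notation G := (gmix d (- 1)).
Local Notation Sk := (nu_supported a0).
Implicit Types x y w : 'rV[R]_d.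


Lemma gmix0_add (r s t : R) : gmix d 0 r (s + t) = gmix d 0 r s * gmix d 0 r t.
Proof.
by rewrite /gmix !mulr0 !addr0 ln1 !mulr0 !oppr0 !add0r !divr1 -expRD mulrDr opprD.
Qed.

Lemma int_gmix0 (k : nat) (r : R) : 0 <= r ->
  \int[nu a k]_s gmix d 0 r s = (\int[nu1 a]_s gmix d 0 r s) ^+ k.
Proof.
move=> r0; have b := lbd_gmix d (lexx (0 : R)) r0.
elim: k => [|k IH]; first by rewrite nu0// gmix_s0.
rewrite (nuS a0)// exprSr -IH -(supportedZ (nu1_supported a0))//.
apply: (supported_eq (nu1_supported a0)).
- exact: (lbd_Rintegral (Sk _) b).
- exact: lbdZ.
move=> u _; rewrite mulrC -(supportedZ (Sk _))//.
by apply: eq_Rintegral => s _; rewrite gmix0_add.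
Qed.

Lemma gmean0_pow (k : nat) (r : R) : 0 <= r -> gmean d a k 0 r = gmean d a 0 0 r ^+ k.+1.
Proof. by move=> r0; rewrite /gmean !int_gmix0// expr1. Qed.

Lemma gmean0_le1 (r : R) : 0 <= r -> gmean d a 0 0 r <= 1.
Proof.
move=> r0; rewrite -[leRHS](supported_cst (nu a 1)); apply: (supported_le (Sk _)).
- exact: lbd_gmix.
- exact: lbd_cst.
- by move=> s /andP[s0 _]; apply: gmix_le1.
Qed.

(** Convolution with variance [v] advances [tau] from -1 to 0, turning each component into
    [exp (- r s)]. *)
Lemma gaussian_neg1_mixture w :
  integral_Rd (fun y => (phi (y - w) v)%:E * \int[nu1 a]_s (G (rad y) s)%:E)%E =
  (gmean d a 0 0 (rad w))%:E.
Proof.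
have r0 := rad_ge0 v0 w.
pose F (s : Rm) y := (phi (y - w) v * G (rad y) s)%:E.
have mF : meas_pvec F.
  apply: meas_pvec_EFin.
  have cm : coord_meas (fun p : Rm * d.-tuple R => tvec p.2) by exact: coord_meas_tvec.
  apply: measurable_funM.
  - by apply: measurable_phi; apply: coord_measD => //; exact: coord_meas_cst.
  - by apply: measurable_gmix => //; apply: measurable_funM => //; exact: measurable_sqnorm.
have F0 s y : (0 <= F s y)%E.
  by rewrite lee_fin mulr_ge0// ltW// ?phi_gt0// gmix_gt0.
have mG B : measurable_fun setT (fun s : Rm => (G B s)%:E).
  by apply/measurable_EFinP; exact: measurable_gmix.
have E y : ((phi (y - w) v)%:E * \int[nu1 a]_s (G (rad y) s)%:E = \int[nu1 a]_s F s y)%E.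
  rewrite -ge0_integralZl_EFin//.
  - by move=> s _; rewrite lee_fin ltW// gmix_gt0.
  - by rewrite ltW// phi_gt0.
under eq_fun do rewrite E.
rewrite -(integral_Rd_fubini (nu1 a) mF F0).
have -> : (gmean d a 0 0 (rad w))%:E = (\int[nu1 a]_s (gmix d 0 (rad w) s)%:E)%E.
  rewrite /gmean int_gmix0// expr1 /Rintegral fineK//.
  exact: integrable_fin_num (supported_integrable (nu1_supported a0) (lbd_gmix d (lexx 0) r0)).
rewrite !ge0_integral_nu1//; last 4 first.
- exact: measurable_integral_Rd.
- by move=> s; exact: integral_Rd_ge0.
- by apply/measurable_EFinP; exact: measurable_gmix.
- by move=> s; rewrite lee_fin ltW// gmix_gt0.
apply: eq_integral => V; rewrite inE/= in_itv/= => V01.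
have /andP[_ u1] := root_itv a0 V01.
have := @gaussian_gmix_integral R d v 1 (- 1) (V `^ a^-1) 0 w v0 ltr01.
rewrite mulr1 addNr mulr0 addr0 mulrN1 subr_gt0 => /(_ u1 ltr01).
rewrite (_ : sqnorm 0 = 0); last by apply: big1 => i _; rewrite mxE expr0n.
rewrite mulr0 mul0r expR0 mul1r scaler0 addr0 => <-.
congr integral_Rd; apply/funext => y; rewrite (_ : dot 0 _ = 0) ?expR0 ?mulr1//.
by apply: big1 => i _; rewrite mxE mul0r.
Qed.

Lemma sqnorm_eq0 x : (sqnorm x == 0) = (x == 0).
Proof.
apply/idP/eqP => [|->]; last by apply/eqP/big1 => i _; rewrite mxE expr0n.
rewrite psumr_eq0 => [/allP h|i _]; last exact: sqr_ge0.
apply/rowP => i; have := h i (mem_index_enum _); rewrite sqrf_eq0 => /eqP ->.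
by rewrite mxE.
Qed.

Lemma dim2 : (d - 2)%:R = 2 * a :> R.
Proof.
have : d%:R = 2 * a + 2 :> R by move: ad; lra.
rewrite natrB ?(leq_trans _ d3)// => ->; ring.
Qed.

Lemma rad_pow x : x != 0 -> (rad x) `^ a = enorm x ^+ (d - 2) / (2 * v) `^ a.
Proof.
move=> x0; have s0 : 0 < sqnorm x by rewrite lt_def sqnorm_eq0 x0 sqnorm_ge0.
have v2 : 0 < 2 * v by rewrite mulr_gt0.
rewrite powRM ?invr_ge0 ?(ltW s0) ?(ltW v2)//; congr (_ * _).
  rewrite -powR_mulrn ?sqrtr_ge0// dim2 powRrM powR_mulrn ?sqrtr_ge0//.
  by rewrite sqr_sqrtr ?(ltW s0).
by rewrite -powR_inv1 ?(ltW v2)// -powRrM mulN1r powRN.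
Qed.

(** By [gmix_neg1_scale] with [A = rad m], the prior [|m|^(-(d-2))] is, up to a factor, a mixture of
    [gmix] at [tau = -1]; [gaussian_neg1_mixture] then convolves it. *)
Lemma m_H_mixture : exists2 K : R, 0 < K & forall w, m_H w v = K * gmean d a 0 0 (rad w).
Proof.
have [c cE] := gmix_neg1_finite a0 ad.
have v2 : 0 < (2 * v) `^ a by rewrite powR_gt0 ?mulr_gt0.
pose K := c * (2 * v) `^ a.
have c0 : 0 <= c.
  by rewrite -lee_fin -cE; apply: integral_ge0 => s _; rewrite lee_fin ltW// gmix_gt0.
have K0 : 0 <= K by rewrite mulr_ge0 ?powR_ge0.
have ct : coord_meas (fun t : d.-tuple R => tvec t) by exact: coord_meas_tvec.
have g0 r : 0 <= r -> 0 < gmean d a 0 0 r by move=> r0; exact: (gmean_gt0 d a0 0 (lexx 0) r0).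
have I w : (K%:E * integral_Rd (fun m => (phi (w - m) v * enorm m ^- (d - 2))%:E) =
    (gmean d a 0 0 (rad w))%:E)%E.
  have m1 : meas_vec (fun m => (phi (w - m) v * enorm m ^- (d - 2))%:E).
    apply: meas_vec_EFin; apply: measurable_funM.
      by apply: measurable_phi; apply: coord_measD; [exact: coord_meas_cst|exact: coord_measN].
    apply: measurable_funinv; apply: measurable_funX.
    rewrite /enorm; apply: (@measurableT_comp _ _ _ _ _ _ (@Num.sqrt R)).
      by apply: continuous_measurable_fun; exact: sqrt_continuous.
    exact: measurable_sqnorm.
  have n1 m : (0 <= (phi (w - m) v * enorm m ^- (d - 2))%:E)%E.
    by rewrite lee_fin mulr_ge0 ?invr_ge0 ?exprn_ge0 ?sqrtr_ge0// ltW// phi_gt0.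
  have n2 (y : 'rV[R]_d) : (0 <= \int[nu1 a]_s (G (rad y) s)%:E)%E.
    by apply: integral_ge0 => s _; rewrite lee_fin ltW// gmix_gt0.
  rewrite -gaussian_neg1_mixture -integral_RdZl//; apply: eq_integral_Rd_neq0.
  - exact: leq_trans d3.
  - exact: measurable_funeM.
  - apply: emeasurable_funM.
      apply/measurable_EFinP; apply: measurable_phi.
      by apply: coord_measD => //; exact: coord_meas_cst.
    apply: (@measurable_fun_fubini_tonelli_F _ _ (d.-tuple R) Rm R (nu1 a)
      (fun p => (G (rad (tvec p.1)) p.2)%:E)).
    + apply/measurable_EFinP; apply: measurable_gmix => //; apply: measurable_funM => //.
      by apply: measurable_sqnorm; exact: coord_meas_tvec.
    + by move=> p; rewrite lee_fin ltW// gmix_gt0.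
  - by move=> m; rewrite mule_ge0.
  - by move=> m; rewrite mule_ge0// lee_fin ltW// phi_gt0.
  move=> m m0.
  have A0 : 0 < rad m.
    by rewrite divr_gt0 ?mulr_gt0// lt_def sqnorm_eq0 m0 sqnorm_ge0.
  have Aa : 0 < (rad m) `^ a by rewrite powR_gt0.
  have := gmix_neg1_scale a0 ad A0; rewrite cE.
  case: (integral _ _ _) => [h| |] //=; last 2 first.
  - by rewrite gt0_muley ?lte_fin.
  - by rewrite gt0_muleNy ?lte_fin.
  rewrite -EFinM => -[hc]; rewrite -!EFinM; congr EFin.
  rewrite phi_sym /K -hc rad_pow//.
  have e0 : enorm m ^+ (d - 2) != 0.
    by rewrite expf_neq0// sqrtr_eq0 -ltNge lt_def sqnorm_eq0 m0 sqnorm_ge0.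
  by field; rewrite e0 gt_eqF.
(* If [K] were 0, the identity [I] would make the positive number [gmean] vanish. *)
have K1 : 0 < K.
  rewrite lt_def K0 andbT; apply/negP => /eqP K00; have := I 0.
  rewrite K00 mul0e => -[h]; have := g0 _ (rad_ge0 v0 (0 : 'rV[R]_d)).
  by rewrite -h ltxx.
exists K^-1; first by rewrite invr_gt0.
move=> w; have := I w; rewrite /m_H.
(* The integral is finite, because its multiple by the positive [K] is. *)
case: (integral_Rd _) => [h| |] //=; last 2 first.
- by rewrite gt0_muley ?lte_fin.
- by rewrite gt0_muleNy ?lte_fin.
by rewrite -EFinM => -[<-]; rewrite mulKf// gt_eqF.
Qed.

End harmonic_marginal.

(** * Bounds on the normalising constant *)

Section normalising_constant.
Variable R : realType.
Variables (d : nat) (a : R) (a0 : 0 < a) (ad : d%:R / 2 = a + 1).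
Variables (v : R) (v0 : 0 < v).
Local Notation rad x := (sqnorm x / (2 * v)).
Implicit Types x y w : 'rV[R]_d.

Lemma inv_powR (z t : R) : 0 <= z -> z^-1 `^ t = (z `^ t)^-1.
Proof. by move=> z0; rewrite -powR_inv1// -powRrM mulN1r powRN. Qed.

(** Young's inequality with exponents [1/t] and [1/(1-t)] gives the tangent at [c] of the concave
    function [y^t]. Integrated with [c] equal to the mean, it is Jensen's inequality. *)
Lemma powR_le_tangent (t y c : R) : 0 < t < 1 -> 0 < y -> 0 < c ->
  y `^ t <= c `^ t * (t / c * y + (1 - t)).
Proof.
move=> /andP[t0 t1] y0 c0; have t1' : 0 < 1 - t by rewrite subr_gt0.
have yc : 0 < y / c by rewrite divr_gt0.
have -> : y `^ t = c `^ t * (y / c) `^ t.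
  by rewrite -powRM ?ltW// (mulrC c) divfK// gt_eqF.
apply: ler_wpM2l; first exact: powR_ge0.
have := @conjugate_powR R ((y / c) `^ t) 1 t^-1 (1 - t)^-1 (powR_ge0 _ _) ler01.
rewrite !invr_gt0 !invrK => /(_ t0 t1'); rewrite addrC subrK => /(_ erefl).
rewrite one_powR mulr1 -powRrM divff ?gt_eqF// powRr1 ?(ltW yc)// mul1r => /le_trans; apply.
by rewrite lerD2r mulrC mulrA (mulrAC t).
Qed.

Lemma gaussian_gmix0_integral (e tau s : R) x : 0 < e ->
  0 < 1 + s * tau -> 0 < 1 + s * (tau + e) ->
  integral_Rd (fun y => (phi (y - x) (v * e) * gmix d tau (rad y) s)%:E) =
  (gmix d (tau + e) (rad x) s)%:E.
Proof.
move=> e0 h1 h2; have := gaussian_gmix_integral 0 x v0 e0 h1 h2.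
rewrite (_ : sqnorm 0 = 0); last by apply: big1 => i _; rewrite mxE expr0n.
rewrite mulr0 mul0r expR0 mul1r scaler0 addr0 => <-.
congr integral_Rd; apply/funext => y; rewrite (_ : dot 0 _ = 0) ?expR0 ?mulr1//.
by apply: big1 => i _; rewrite mxE mul0r.
Qed.

Lemma gaussian_gmean0_integral (k : nat) (e : R) x : 0 < e ->
  integral_Rd (fun y => (phi (y - x) (v * e) * gmean d a k 0 (rad y))%:E) =
  (gmean d a k e (rad x))%:E.
Proof.
move=> e0; have := gaussian_gmean_integral a0 k v0 0 x e0 (lexx 0).
rewrite (_ : sqnorm 0 = 0); last by apply: big1 => i _; rewrite mxE expr0n.
rewrite mulr0 mul0r expR0 mul1r scaler0 addr0 add0r => <-.
congr integral_Rd; apply/funext => y; rewrite (_ : dot 0 _ = 0) ?expR0 ?mulr1//.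
by apply: big1 => i _; rewrite mxE mul0r.
Qed.

Lemma gmean0_ge (r : R) : 0 <= r -> expR (- r) <= gmean d a 0 0 r.
Proof.
move=> r0; rewrite -[leLHS](supported_cst (nu a 1)).
apply: (supported_le (nu_supported a0 1)); [exact: lbd_cst|exact: lbd_gmix|].
move=> s /andP[s0 s1]; rewrite /gmix mulr0 addr0 ln1 mulr0 oppr0 add0r divr1 ler_expR.
by rewrite lerN2 ler_piMr.
Qed.

Lemma gmean00_gt0 w : 0 < gmean d a 0 0 (rad w).
Proof. exact: (gmean_gt0 d a0 0 (lexx 0) (rad_ge0 v0 w)). Qed.

Lemma gmean00_powR (k : nat) (p : R) w :
  gmean d a 0 0 (rad w) `^ p = gmean d a k 0 (rad w) `^ (p / k.+1%:R).
Proof.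
have g0 := gmean00_gt0 w; rewrite (gmean0_pow d a0 k (rad_ge0 v0 w)).
move: (gmean d a 0 0 (rad w)) g0 => g g0.
by rewrite -powR_mulrn ?(ltW g0)// -powRrM mulrC divfK// pnatr_eq0.
Qed.

Variables (K : R) (K0 : 0 < K) (p : R) (p0 : 0 < p) (k : nat) (pk : p < k.+1%:R).

Definition marginal_pow w : R := (K * gmean d a 0 0 (rad w)) `^ p.
Local Notation M := marginal_pow.

Lemma measurable_marginal d0 (X : measurableType d0) (u : X -> 'rV[R]_d) :
  coord_meas u -> measurable_fun setT (fun t => M (u t)).
Proof.
move=> mu; apply: (measurableT_comp (measurable_powR p)); apply: measurable_funM => //.
by apply: measurable_gmean; apply: measurable_funM => //; exact: measurable_sqnorm.
Qed.

Lemma marginal_le w : M w <= K `^ p.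
Proof.
have g0 := gmean00_gt0 w; have g1 := gmean0_le1 d a0 (rad_ge0 v0 w).
rewrite /M; move: (gmean d a 0 0 (rad w)) g0 g1 => g g0 g1.
apply: ge0_ler_powR; rewrite ?nnegrE ?(ltW p0) ?(ltW K0)//.
  by rewrite mulr_ge0 ?ltW.
by rewrite ler_piMr ?(ltW K0).
Qed.

Lemma marginalM w : M w = K `^ p * gmean d a 0 0 (rad w) `^ p.
Proof. by rewrite /M powRM ?(ltW K0)// ltW// gmean00_gt0. Qed.

Lemma marginal_ge w : K `^ p * gmix d 0 (rad w) p <= M w.
Proof.
have g0 := gmean00_gt0 w; have g1 := gmean0_ge (rad_ge0 v0 w).
rewrite marginalM; apply: ler_wpM2l; first exact: powR_ge0.
rewrite /gmix mulr0 addr0 ln1 mulr0 oppr0 add0r divr1 -mulNr expRM.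
by apply: ge0_ler_powR; rewrite ?nnegrE ?expR_ge0 ?(ltW p0) ?(ltW g0).
Qed.

(** The upper bound is Jensen with exponent [p / (k + 1) < 1]: the tangent is taken at [c], the
    Gaussian mean of [gmean d a k 0], so its integral is exactly [c^t]. Positivity comes from
    [marginal_ge], whose right side has an explicit Gaussian integral. *)
Lemma marginal_normaliser (e : R) x : 0 < e -> exists2 E : R, 0 < E &
  integral_Rd (fun w => (M w * phi (w - x) (v * e))%:E) = E%:E /\
  E <= K `^ p * gmean d a k e (rad x) `^ (p / k.+1%:R).
Proof.
move=> e0; have s0 : 0 < v * e by rewrite mulr_gt0.
have ct : coord_meas (fun t : d.-tuple R => tvec t) by exact: coord_meas_tvec.
have ctx : coord_meas (fun t : d.-tuple R => tvec t - x).
  by apply: coord_measD => //; exact: coord_meas_cst.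
have mphi : measurable_fun setT (fun t : d.-tuple R => phi (tvec t - x) (v * e)).
  exact: measurable_phi.
have mr : measurable_fun setT (fun t : d.-tuple R => rad (tvec t)).
  by apply: measurable_funM => //; exact: measurable_sqnorm.
have phi0 y : 0 < phi (y - x) (v * e) by exact: phi_gt0.
have mM : meas_vec (fun w => (M w * phi (w - x) (v * e))%:E).
  by apply: meas_vec_EFin; apply: measurable_funM => //; exact: measurable_marginal.
have M0 w : (0 <= (M w * phi (w - x) (v * e))%:E)%E.
  by rewrite lee_fin mulr_ge0 ?powR_ge0// ltW.
pose t := p / k.+1%:R; have t01 : 0 < t < 1.
  by rewrite divr_gt0//= ltr_pdivrMr// mul1r.
have /andP[t0 t1] := t01.
have h0 y : 0 < gmean d a k 0 (rad y) := gmean_gt0 d a0 k (lexx 0) (rad_ge0 v0 y).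
have up : (integral_Rd (fun w => (M w * phi (w - x) (v * e))%:E) <=
    (K `^ p * gmean d a k e (rad x) `^ t)%:E)%E.
  have c0 : 0 < gmean d a k e (rad x) := gmean_gt0 d a0 k (ltW e0) (rad_ge0 v0 x).
  have I1 := gaussian_gmean0_integral k x e0; have I2 := phi_total v0 x s0.
  move: (gmean d a k e (rad x)) c0 I1 => c c0 I1.
  have Kc : 0 <= K `^ p * c `^ t by rewrite mulr_ge0 ?powR_ge0.
  have tc : 0 <= t / c by rewrite divr_ge0 ?ltW.
  have t1' : 0 <= 1 - t by rewrite subr_ge0 ltW.
  have m1 : meas_vec (fun y => (phi (y - x) (v * e) * gmean d a k 0 (rad y))%:E).
    by apply: meas_vec_EFin; apply: measurable_funM => //; exact: measurable_gmean.
  have m2 : meas_vec (fun y => (phi (y - x) (v * e))%:E) by exact: meas_vec_EFin.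
  have n1 y : (0 <= (phi (y - x) (v * e) * gmean d a k 0 (rad y))%:E)%E.
    by rewrite lee_fin mulr_ge0 ?ltW.
  have n2 y : (0 <= (phi (y - x) (v * e))%:E)%E by rewrite lee_fin ltW.
  have -> : (K `^ p * c `^ t)%:E = (integral_Rd (fun y =>
     (K `^ p * c `^ t)%:E * ((t / c)%:E * (phi (y - x) (v * e) * gmean d a k 0 (rad y))%:E +
       (1 - t)%:E * (phi (y - x) (v * e))%:E)))%E.
    rewrite integral_RdZl//; last 2 first.
    - by apply: emeasurable_funD; exact: measurable_funeM.
    - by move=> y; rewrite adde_ge0// mule_ge0.
    rewrite integral_RdD//; [|exact: measurable_funeM|exact: measurable_funeM| |]; last 2 first.
    - by move=> y; rewrite mule_ge0.
    - by move=> y; rewrite mule_ge0.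
    rewrite !integral_RdZl// I1 I2 mule1 -(EFinM (t / c)) -EFinD -EFinM; congr EFin.
    by field; rewrite gt_eqF.
  apply: le_integral_Rd => //.
    by apply: measurable_funeM; apply: emeasurable_funD; exact: measurable_funeM.
  move=> y; rewrite -[leRHS]/((K `^ p * c `^ t * (t / c *
    (phi (y - x) (v * e) * gmean d a k 0 (rad y)) + (1 - t) * phi (y - x) (v * e)))%:E) lee_fin.
  rewrite marginalM (gmean00_powR k) -/t.
  have := powR_le_tangent t01 (h0 y) c0.
  move=> /(ler_wpM2l (mulr_ge0 (powR_ge0 K p) (ltW (phi0 y)))).
  move: (gmean d a k 0 (rad y)) (phi (y - x) (v * e)) (K `^ p) (c `^ t) (t / c) => g f x1 x2 x3.
  move: (g `^ t) => x4; lra.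
have low : ((K `^ p * gmix d e (rad x) p)%:E <=
    integral_Rd (fun w => (M w * phi (w - x) (v * e))%:E))%E.
  have I : integral_Rd (fun y => (phi (y - x) (v * e) * gmix d 0 (rad y) p)%:E) =
      (gmix d e (rad x) p)%:E.
    rewrite gaussian_gmix0_integral ?add0r//; first by rewrite mulr0 addr0.
    by rewrite ltr_pwDl// mulr_ge0// ltW.
  have m1 : meas_vec (fun y => (phi (y - x) (v * e) * gmix d 0 (rad y) p)%:E).
    by apply: meas_vec_EFin; apply: measurable_funM => //; exact: measurable_gmix.
  have n1 y : (0 <= (phi (y - x) (v * e) * gmix d 0 (rad y) p)%:E)%E.
    by rewrite lee_fin mulr_ge0// ltW// gmix_gt0.
  rewrite EFinM -I -integral_RdZl ?powR_ge0//; apply: le_integral_Rd => //.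
  - exact: measurable_funeM.
  - by move=> y; rewrite mule_ge0// lee_fin powR_ge0.
  move=> y; rewrite -EFinM lee_fin mulrCA mulrC ler_wpM2r ?marginal_ge// ltW//.
have fin : integral_Rd (fun w => (M w * phi (w - x) (v * e))%:E) \is a fin_num.
  by rewrite ge0_fin_numE ?(le_lt_trans up) ?ltry// integral_Rd_ge0.
exists (fine (integral_Rd (fun w => (M w * phi (w - x) (v * e))%:E))).
  rewrite -lte_fin fineK//; apply: lt_le_trans low.
  by rewrite lte_fin mulr_gt0 ?gmix_gt0// powR_gt0.
by rewrite fineK//; split => //; rewrite -lee_fin fineK.
Qed.

Variables (tmax b th q : R).
Hypotheses (tmax0 : 0 < tmax) (b0 : 0 < b) (b1 : b <= 1) (th0 : 0 < th) (th1 : th < 1).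
Hypothesis bE : (1 + b) * k.+1%:R = 2 * k%:R + th.
Hypothesis tmaxE : 2 * k%:R * tmax * (k.+1%:R * ((a + 1) / (a + 2))) <= th.
Hypothesis btmax : b * k.+1%:R * tmax < 1.
Hypotheses (q0 : 0 < q) (qE : p * q = b * k.+1%:R).

(** The powers of [K] cancel, and since [p q = b (k + 1)] the integrand dominates
    [A_0(w)^b A_tmax(x)^(-b)] times the Gaussian kernel; the rest is [flow_bound]. *)
Lemma normaliser_flow (E : 'rV[R]_d -> R) w :
  measurable_fun setT (fun t : d.-tuple R => E (tvec t)) ->
  (forall x, 0 < E x) ->
  (forall x, integral_Rd (fun w => (M w * phi (w - x) (v * tmax))%:E) = (E x)%:E) ->
  (1 <= integral_Rd (fun x => (M w `^ q * (E x)^-1 `^ q * phi (w - x) (v * tmax))%:E))%E.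
Proof.
move=> mE E0 EI; have s0 : 0 < v * tmax by rewrite mulr_gt0.
have phi0 x : 0 < phi (x - w) (v * tmax) by exact: phi_gt0.
have ct : coord_meas (fun t : d.-tuple R => tvec t) by exact: coord_meas_tvec.
have g0 : 0 < gmean d a k 0 (rad w) := gmean_gt0 d a0 k (lexx 0) (rad_ge0 v0 w).
have tq : p / k.+1%:R * q = b by rewrite mulrAC qE mulfK// pnatr_eq0.
have Kpq : 0 < (K `^ p) `^ q by rewrite !powR_gt0.
have ME : M w `^ q = (K `^ p) `^ q * gmean d a k 0 (rad w) `^ b.
  by rewrite marginalM (gmean00_powR k) powRM ?powR_ge0// -(powRrM (gmean _ _ _ _ _)) tq.
have Ele x : gmean d a k tmax (rad x) `^ (- b) <= (K `^ p) `^ q * (E x)^-1 `^ q.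
  have [E' E'0 [IE' E'le]] := marginal_normaliser x tmax0.
  have EE : E x = E' by move: (EI x); rewrite IE' => -[].
  have c0 : 0 < gmean d a k tmax (rad x) := gmean_gt0 d a0 k (ltW tmax0) (rad_ge0 v0 x).
  rewrite EE inv_powR ?(ltW E'0)// powRN.
  move: (gmean d a k tmax (rad x)) c0 E'le => c c0 E'le.
  rewrite -[leLHS]div1r ler_pdivrMr ?powR_gt0// mulrAC ler_pdivlMr ?powR_gt0// mul1r.
  have -> : (K `^ p) `^ q * c `^ b = (K `^ p * c `^ (p / k.+1%:R)) `^ q.
    by rewrite powRM ?powR_ge0// -(powRrM c) tq.
  by apply: ge0_ler_powR; rewrite ?nnegrE ?(ltW q0) ?(ltW E'0)// mulr_ge0 ?powR_ge0.
have F := flow_bound a0 ad v0 tmax0 b0 b1 th0 th1 bE tmaxE btmax w.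
have gb : 0 < gmean d a k 0 (rad w) `^ b by rewrite powR_gt0.
have -> : 1%E = ((gmean d a k 0 (rad w) `^ b)%:E * (gmean d a k 0 (rad w) `^ (- b))%:E)%E.
  by rewrite -EFinM powRN divff// gt_eqF.
apply: le_trans (lee_wpmul2l _ F) _; first by rewrite lee_fin ltW.
have mphi : measurable_fun setT (fun t : d.-tuple R => phi (tvec t - w) (v * tmax)).
  by apply: measurable_phi; apply: coord_measD => //; exact: coord_meas_cst.
have m1 : meas_vec (fun x => (phi (x - w) (v * tmax) * gmean d a k tmax (rad x) `^ (- b))%:E).
  by apply: meas_vec_EFin; apply: measurable_funM => //; exact: measurable_gmean_pow.
have n1 x : (0 <= (phi (x - w) (v * tmax) * gmean d a k tmax (rad x) `^ (- b))%:E)%E.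
  by rewrite lee_fin mulr_ge0 ?powR_ge0// ltW.
rewrite -integral_RdZl ?(ltW gb)//; apply: le_integral_Rd.
- exact: measurable_funeM.
- under eq_fun do rewrite phi_sym.
  apply: meas_vec_EFin; apply: measurable_funM => //; apply: measurable_funM => //.
  by apply: (measurableT_comp (measurable_powR q)); exact: measurable_funinv.
- by move=> x; rewrite mule_ge0// lee_fin ltW.
move=> x; rewrite -EFinM lee_fin ME [phi (w - x) _]phi_sym.
have aux (x1 x2 x3 x4 x5 : R) : x1 * x2 * x3 <= x1 * x2 * (x4 * x5) ->
    x1 * (x2 * x3) <= x4 * x1 * x5 * x2.
  have -> : x4 * x1 * x5 * x2 = x1 * x2 * (x4 * x5) by ring.
  by rewrite (mulrA x1).
exact: aux (ler_wpM2l (mulr_ge0 (ltW gb) (ltW (phi0 x))) (Ele x)).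
Qed.

End normalising_constant.

(** * Risk *)

Section risk.
Variable R : realType.
Variable d : nat.
Implicit Types x y w z : 'rV[R]_d.

Lemma Rd_finite_phi x (s c : R) : 0 < s -> 0 <= c ->
  Rd_finite (fun y => (c * phi (y - x) s)%:E).
Proof.
move=> s0 c0; have is0 : 0 < s^-1 by rewrite invr_gt0.
have [_ h] := integral_gaussian (s^-1 *: x) is0.
pose k := c * expR (- (d%:R / 2 * ln (2 * pi * s)) - sqnorm x / (2 * s)).
have k0 : 0 <= k by rewrite mulr_ge0 ?expR_ge0.
rewrite (_ : (fun y => _) =
  (fun y => k%:E * (expR (- (s^-1 / 2) * sqnorm y + dot (s^-1 *: x) y))%:E)%E).
  apply: iint_finiteZ => //.
  - apply: (meas_vec_coord (f := fun y => (expR (- (s^-1 / 2) * sqnorm y + dot (s^-1 *: x) y))%:E)).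
    apply: meas_vec_EFin; apply: measurableT_comp => //.
    have ct : coord_meas (fun t : d.-tuple R => tvec t) by exact: coord_meas_tvec.
    apply: measurable_funD; last exact: measurable_dot.
    by apply: measurable_funM => //; exact: measurable_sqnorm.
apply/funext => y; rewrite -EFinM; congr EFin.
rewrite /k phiE// sqnormB dotZl -(mulrA c) -expRD; congr (c * expR _); field; by rewrite gt_eqF.
Qed.

Lemma measurable_tvec_comp d0 (X : measurableType d0) (f : 'rV[R]_d -> R) (u : X -> 'rV[R]_d) :
  measurable_fun setT (fun t : d.-tuple R => f (tvec t)) -> coord_meas u ->
  measurable_fun setT (fun t => f (u t)).
Proof.
move=> mf mu.
have mt : measurable_fun setT (fun t : X => [tuple u t ord0 i | i < d]).
  apply/measurable_fun_tnthP => i; rewrite (_ : _ \o _ = (fun t => u t ord0 i)); first exact: mu.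
  by apply/funext => t /=; rewrite tnth_mktuple.
rewrite (_ : (fun t => _) = (fun t : d.-tuple R => f (tvec t)) \o
  (fun t : X => [tuple u t ord0 i | i < d])); last first.
  by apply/funext => t /=; congr f; apply/rowP => i; rewrite !mxE tnth_mktuple.
exact: measurableT_comp.
Qed.

Lemma measurable_affine (f : 'rV[R]_d -> R) x (c : R) :
  measurable_fun setT (fun t : d.-tuple R => f (tvec t)) ->
  measurable_fun setT (fun t : d.-tuple R => f (x + c *: tvec t)).
Proof.
move=> mf; apply: measurable_tvec_comp => //.
by apply: coord_measD; [exact: coord_meas_cst|apply: coord_measZ; exact: coord_meas_tvec].
Qed.

Lemma integral_phi_affine (f : 'rV[R]_d -> R) (c s : R) x : 0 < c -> 0 < s ->
  measurable_fun setT (fun t : d.-tuple R => f (tvec t)) -> (forall w, 0 <= f w) ->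
  integral_Rd (fun z => (f (x + c *: z) * phi z s)%:E) =
  integral_Rd (fun w => (f w * phi (w - x) (c ^+ 2 * s))%:E).
Proof.
move=> c0 s0 mf f0; have cs : 0 < c ^+ 2 * s by rewrite mulr_gt0// exprn_gt0.
have ct : coord_meas (fun t : d.-tuple R => tvec t) by exact: coord_meas_tvec.
have m1 : meas_vec (fun w => (f w * phi (w - x) (c ^+ 2 * s))%:E).
  apply: meas_vec_EFin; apply: measurable_funM => //; apply: measurable_phi.
  by apply: coord_measD => //; exact: coord_meas_cst.
rewrite [RHS](integral_Rd_affine x c0 m1); last first.
  by move=> w; rewrite lee_fin mulr_ge0// ltW// phi_gt0.
have cd : 0 < c ^+ d by rewrite exprn_gt0.
rewrite -integral_RdZl ?(ltW cd)//; last 2 first.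
- apply: meas_vec_EFin; apply: measurable_funM; first exact: measurable_affine.
  apply: measurable_phi; apply: coord_measD; last exact: coord_meas_cst.
  by apply: coord_measD; [exact: coord_meas_cst|exact: coord_measZ].
- by move=> w; rewrite lee_fin mulr_ge0// ltW// phi_gt0.
congr integral_Rd; apply/funext => z; rewrite -EFinM; congr EFin.
rewrite [RHS]mulrCA; congr (_ * _); rewrite [x + _]addrC addrK.
rewrite !phiE// sqnormZ -[c ^+ d]lnK ?posrE// -expRD; congr expR.
rewrite lnXn// -[ln c *+ d]mulr_natl.
have -> : ln (2 * pi * (c ^+ 2 * s)) = 2 * ln c + ln (2 * pi * s).
  have ps : 0 < 2 * pi * s by rewrite !mulr_gt0// pi_gt0.
  rewrite (_ : 2 * pi * _ = c ^+ 2 * (2 * pi * s)); last by ring.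
  by rewrite lnM ?posrE ?exprn_gt0// lnXn// -[ln c *+ 2]mulr_natl.
field; by rewrite !gt_eqF.
Qed.

Variables (alpha vx vy : R) (mu : 'rV[R]_d).
Hypotheses (alpha1 : -1 < alpha < 1) (vx0 : 0 < vx) (vy0 : 0 < vy).
Local Notation q := ((1 + alpha) / 2).
Local Notation C := (4 / (1 - alpha ^+ 2)).

Lemma exponent_itv : 0 < q < 1.
Proof. by move: alpha1 => /andP[h1 h2]; apply/andP; split; lra. Qed.

Lemma divergence_cst_gt0 : 0 < C.
Proof. by rewrite divr_gt0//; move: alpha1 => /andP[h1 h2]; nra. Qed.

(** Multiplied by the true density, this dominates the affinity integrand by the sum of the two
    densities. *)
Lemma powR_le1D (t s : R) : 0 <= t -> 0 < s < 1 -> t `^ s <= 1 + t.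
Proof.
move=> t0 /andP[s0 s1]; have [t1|t1] := leP t 1.
  apply: (@le_trans _ _ 1); last by rewrite lerDl.
  have h : 1 `^ s = 1 :> R by rewrite powR1.
  by rewrite -[leRHS]h; apply: ge0_ler_powR; rewrite ?nnegrE ?(ltW s0).
apply: (@le_trans _ _ t); last by rewrite lerDr.
by rewrite -[leRHS]powRr1// ler_powR ?ltW.
Qed.

Section predictive.
Variable p : 'rV[R]_d -> 'rV[R]_d -> R.
Hypothesis p0 : forall x y, 0 <= p y x.
Hypothesis mp : measurable_fun setT (fun t : d.-tuple R * d.-tuple R => p (tvec t.2) (tvec t.1)).
Hypothesis pint : forall x, (integral_Rd (fun y => (p y x)%:E) <= 1)%E.
Hypothesis pfin : forall x, Rd_finite (fun y => (p y x)%:E).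
Let k x y : R := (p y x / phi (y - mu) vy) `^ q * phi (y - mu) vy.

Definition affinity : \bar R :=
  integral_Rd (fun x => integral_Rd (fun y => (k x y * phi (x - mu) vx)%:E)).

(** The [1] in [f_alpha] integrates to the constant and the power to the affinity. Splitting the
    difference of iterated integrals needs every partial integral finite, which the bound [kle] by
    the sum of two densities provides. *)
Lemma risk_affinity : affinity \is a fin_num /\
  risk_alpha alpha vx vy mu p = (C%:E - C%:E * affinity)%E.
Proof.
have /andP[q0 q1] := exponent_itv; have C0 := divergence_cst_gt0.
have py y : 0 < phi (y - mu) vy by exact: phi_gt0.
have px x : 0 < phi (x - mu) vx by exact: phi_gt0.
have k0 x y : 0 <= k x y by rewrite mulr_ge0 ?powR_ge0// ltW.
have kle x y : k x y <= p y x + phi (y - mu) vy.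
  have := powR_le1D (divr_ge0 (p0 x y) (ltW (py y))) exponent_itv.
  move=> /(ler_wpM2r (ltW (py y))) /le_trans; apply.
  by rewrite mulrDl mul1r divfK ?gt_eqF// addrC.
have ct : coord_meas (fun t : d.-tuple R => tvec t) by exact: coord_meas_tvec.
have c2 : coord_meas (fun t : d.-tuple R * d.-tuple R => tvec t.2) by exact: coord_meas_tvec.
have c1 : coord_meas (fun t : d.-tuple R * d.-tuple R => tvec t.1) by exact: coord_meas_tvec.
have mk2 : measurable_fun setT (fun t : d.-tuple R * d.-tuple R => k (tvec t.1) (tvec t.2)).
  have mphi : measurable_fun setT (fun t : d.-tuple R * d.-tuple R => phi (tvec t.2 - mu) vy).
    by apply: measurable_phi; apply: coord_measD => //; exact: coord_meas_cst.
  apply: measurable_funM => //; apply: (measurableT_comp (measurable_powR q)).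
  by apply: measurable_funM => //; exact: measurable_funinv.
have mk x : meas_vec (fun y => (k x y)%:E).
  apply/measurable_EFinP.
  have := measurableT_comp mk2 (measurable_pair1 [tuple x ord0 i | i < d]).
  apply: eq_measurable_fun => t _ /=; congr k.
  by apply/rowP => i; rewrite mxE tnth_mktuple.
have mpx x : meas_vec (fun y => (p y x)%:E).
  apply/measurable_EFinP.
  have := measurableT_comp mp (measurable_pair1 [tuple x ord0 i | i < d]).
  apply: eq_measurable_fun => t _ /=; congr p.
  by apply/rowP => i; rewrite mxE tnth_mktuple.
have mphi s : meas_vec (fun y => (phi (y - mu) s)%:E).
  apply: meas_vec_EFin; apply: measurable_phi.
  by apply: coord_measD => //; exact: coord_meas_cst.
pose n x := integral_Rd (fun y => (k x y)%:E).
have n0 x : (0 <= n x)%E by apply: integral_Rd_ge0 => y; rewrite lee_fin.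
have phify : Rd_finite (fun y => (phi (y - mu) vy)%:E).
  by have := Rd_finite_phi mu vy0 ler01; under eq_fun do rewrite mul1r.
have kfin x : Rd_finite (fun y => (k x y)%:E).
  apply: (@le_Rd_finite _ _ _ (fun y => (p y x)%:E + (phi (y - mu) vy)%:E)%E) => //.
  - exact: (emeasurable_funD (mpx x) (mphi vy)).
  - by move=> y; rewrite lee_fin.
  - by move=> y; rewrite -EFinD lee_fin.
  apply: iint_finiteD => //.
  - exact: (meas_vec_coord (mpx x)).
  - exact: (meas_vec_coord (mphi vy)).
  - by move=> t; rewrite lee_fin.
  - by move=> t; rewrite lee_fin ltW.
  - exact: pfin.
have n2 x : (n x <= 2%:E)%E.
  apply: (@le_trans _ _ (integral_Rd (fun y => (p y x)%:E + (phi (y - mu) vy)%:E)%E)).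
    apply: le_integral_Rd => //.
    - exact: (emeasurable_funD (mpx x) (mphi vy)).
    - by move=> y; rewrite lee_fin.
    - by move=> y; rewrite -EFinD lee_fin.
  rewrite integral_RdD//; last 2 first.
  - by move=> y; rewrite lee_fin.
  - by move=> y; rewrite lee_fin ltW.
  by rewrite (phi_total ltr01 mu vy0) -[2]/(1 + 1) EFinD leeD2r.
have nfin x : n x \is a fin_num by exact: Rd_finite_fin_num.
have mn : meas_vec n.
  by apply: (meas_vec2_integral (f2 := fun x y => (k x y)%:E)) => [|x y]; [exact/measurable_EFinP|rewrite lee_fin].
have DE x : D_alpha alpha vy mu p x = (C%:E - C%:E * n x)%E.
  rewrite /D_alpha (_ : (fun y => _) = (fun y => (C%:E * (phi (y - mu) vy)%:E) - (C%:E * (k x y)%:E))%E); last first.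
    apply/funext => y; rewrite -!EFinM -EFinB; congr EFin; rewrite /f_alpha /k.
    by move: ((p y x / phi (y - mu) vy) `^ q) (phi (y - mu) vy) C => t f c; ring.
  rewrite integral_RdB; last 6 first.
  - by apply: measurable_funeM; exact: mphi.
  - by apply: measurable_funeM; exact: mk.
  - by move=> y; rewrite -EFinM lee_fin mulr_ge0// ltW.
  - by move=> y; rewrite -EFinM lee_fin mulr_ge0// ltW.
  - by under eq_fun do rewrite -EFinM; exact: Rd_finite_phi (ltW C0).
  - apply: iint_finiteZ (ltW C0) _ => //; first exact: (meas_vec_coord (mk x)).
      by move=> t; rewrite lee_fin.
    exact: kfin.
  rewrite !integral_RdZl ?(ltW C0)//; last 2 first.
  - by move=> y; rewrite lee_fin.
  - by move=> y; rewrite lee_fin ltW.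
  by rewrite (phi_total ltr01 mu vy0) mule1.
pose h x := (n x * (phi (x - mu) vx)%:E)%E.
have h0 x : (0 <= h x)%E by rewrite mule_ge0// lee_fin ltW.
have mh : meas_vec h by exact: (emeasurable_funM mn (mphi vx)).
have hfin : Rd_finite h.
  apply: (@le_Rd_finite _ _ _ (fun x => (2 * phi (x - mu) vx)%:E)) => //.
  - apply: meas_vec_EFin; apply: measurable_funM => //; apply: measurable_phi.
    by apply: coord_measD => //; exact: coord_meas_cst.
  - by move=> x; rewrite EFinM lee_wpmul2r// lee_fin ltW.
  - exact: Rd_finite_phi.
have aE : affinity = integral_Rd h.
  congr integral_Rd; apply/funext => x; rewrite /h muleC -integral_RdZl ?(ltW (px _))//.
  - by congr integral_Rd; apply/funext => y; rewrite -EFinM mulrC.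
  - by move=> y; rewrite lee_fin.
split; first by rewrite aE; exact: Rd_finite_fin_num.
rewrite /risk_alpha aE.
rewrite (_ : (fun x => _) = (fun x => (C%:E * (phi (x - mu) vx)%:E) - C%:E * h x)%E); last first.
  apply/funext => x; rewrite DE /h; move: (nfin x).
  case: (n x) => // nx _; rewrite -!EFinM -!EFinB; congr EFin.
  by move: (phi (x - mu) vx) C => f c; ring.
rewrite integral_RdB; last 6 first.
- by apply: measurable_funeM; exact: mphi.
- by apply: measurable_funeM; exact: mh.
- by move=> y; rewrite -EFinM lee_fin mulr_ge0// ltW.
- by move=> y; rewrite mule_ge0// lee_fin ltW.
- by under eq_fun do rewrite -EFinM; exact: Rd_finite_phi (ltW C0).
- exact: (iint_finiteZ (meas_vec_coord mh) (fun t => h0 _) (ltW C0) hfin).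
rewrite !integral_RdZl ?(ltW C0)//; last by move=> y; rewrite lee_fin ltW.
by rewrite (phi_total ltr01 mu vx0) mule1.
Qed.

End predictive.

Lemma risk_le (p1 p2 : 'rV[R]_d -> 'rV[R]_d -> R) :
  affinity p1 \is a fin_num -> affinity p2 \is a fin_num ->
  risk_alpha alpha vx vy mu p1 = (C%:E - C%:E * affinity p1)%E ->
  risk_alpha alpha vx vy mu p2 = (C%:E - C%:E * affinity p2)%E ->
  (affinity p2 <= affinity p1)%E ->
  (risk_alpha alpha vx vy mu p1 <= risk_alpha alpha vx vy mu p2)%E.
Proof.
move=> f1 f2 -> -> h; apply: leeB => //.
by rewrite lee_wpmul2l// lee_fin ltW// divergence_cst_gt0.
Qed.

Local Notation bt := (beta alpha).
Local Notation g := (gamma alpha vx vy).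
Local Notation sg := (vy / gamma alpha vx vy).

Lemma beta_itv : 0 < bt < 1.
Proof. by rewrite /beta; move: alpha1 => /andP[h1 h2]; apply/andP; split; lra. Qed.

Lemma gammaE : g = vy / (vy + bt * vx).
Proof.
have /andP[b0 _] := beta_itv.
by rewrite /gamma; field; rewrite !gt_eqF// addr_gt0// mulr_gt0.
Qed.

Lemma gamma_itv : 0 < g < 1.
Proof.
have /andP[b0 _] := beta_itv; have h : 0 < bt * vx by rewrite mulr_gt0.
by rewrite gammaE divr_gt0 ?addr_gt0//= ltr_pdivrMr ?addr_gt0// mul1r ltrDl.
Qed.

Lemma xi_gt0 : 0 < xi alpha vx vy.
Proof.
have /andP[g0 g1] := gamma_itv.
by rewrite mulr_gt0 ?subr_gt0// sqrtr_gt0 divr_gt0.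
Qed.

Lemma xi_sqr : xi alpha vx vy ^+ 2 = (1 - g) ^+ 2 * sg.
Proof. by have /andP[g0 g1] := gamma_itv; rewrite exprMn sqr_sqrtr// divr_ge0// ltW. Qed.

Lemma xi_sqrE : xi alpha vx vy ^+ 2 = vx * g * (bt ^+ 2 * vx / vy).
Proof.
have /andP[b0 _] := beta_itv; have h : 0 < vy + bt * vx by rewrite addr_gt0// mulr_gt0.
by rewrite xi_sqr gammaE; field; rewrite !gt_eqF.
Qed.

(** [gamma] is the value for which the quadratic form on the left has no cross term between
    [g x + (1 - g) y - mu] and [y - x]. The constant [c0] collects the Gaussian prefactors and is
    the same for every predictive density. *)
Lemma phi_tilt : exists2 c0 : R, 0 < c0 & forall x y,
  (phi (y - x) sg / phi (y - mu) vy) `^ q * phi (y - mu) vy * phi (x - mu) vx =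
  c0 * (phi (g *: x + (1 - g) *: y - mu) (vx * g) * phi (y - x) sg).
Proof.
have /andP[g0 g1] := gamma_itv; have /andP[b0 b1] := beta_itv.
have sg0 : 0 < sg by rewrite divr_gt0.
have v0 : 0 < vx * g by rewrite mulr_gt0.
pose l (s : R) := d%:R / 2 * ln (2 * pi * s).
exists (expR (q * (l vy - l sg) - l vy - l vx + l (vx * g) + l sg)); first exact: expR_gt0.
move=> x y; rewrite !phiE// -!expRN -!expRD -expRM -!expRD; congr expR.
rewrite -/(l sg) -/(l vy) -/(l vx) -/(l (vx * g)).
have -> : g *: x + (1 - g) *: y - mu = (1 - g) *: (y - mu) + g *: (x - mu).
  by apply/rowP => i; rewrite !mxE; ring.
rewrite sqnorm_DZ sqnormZ.
have -> : y - x = (y - mu) - (x - mu) by rewrite opprB addrA subrK.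
rewrite sqnormB (dotC _ ((1 - g) *: _)) dotZl.
rewrite (dotC (x - mu)).
move: (sqnorm (y - mu)) (sqnorm (x - mu)) (dot (y - mu) (x - mu)) => Y X D.
move: (l vy) (l vx) (l sg) (l (vx * g)) => l1 l2 l3 l4.
have qE : q = 1 - bt by rewrite /beta; field.
rewrite qE gammaE; move: bt b0 => b b0.
have h : 0 < vy + b * vx by rewrite addr_gt0// mulr_gt0.
by field; rewrite !gt_eqF.
Qed.

Section factored.
Variables (M rho : 'rV[R]_d -> R).
Hypotheses (M0 : forall w, 0 <= M w) (rho0 : forall x, 0 <= rho x).
Hypothesis mM : measurable_fun setT (fun t : d.-tuple R => M (tvec t)).
Hypothesis mrho : measurable_fun setT (fun t : d.-tuple R => rho (tvec t)).
Local Notation x2 := (xi alpha vx vy ^+ 2).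
(** The common form of both predictive densities: [M] is the power of the marginal and [rho] the
    inverse normaliser for [p_H], while both are 1 for [p_U]. *)
Let pd y x := M (g *: x + (1 - g) *: y) * rho x * phi (y - x) sg.

Lemma affine_phi_integral (f : 'rV[R]_d -> R) x : (forall w, 0 <= f w) ->
  measurable_fun setT (fun t : d.-tuple R => f (tvec t)) ->
  integral_Rd (fun y => (f (g *: x + (1 - g) *: y) * phi (y - x) sg)%:E) =
  integral_Rd (fun w => (f w * phi (w - x) x2)%:E).
Proof.
move=> f0 mf; have /andP[g0 g1] := gamma_itv; have g1' : 0 < 1 - g by rewrite subr_gt0.
have sg0 : 0 < sg by rewrite divr_gt0.
rewrite xi_sqr -(integral_phi_affine x g1' sg0 mf f0).
have ct : coord_meas (fun t : d.-tuple R => tvec t) by exact: coord_meas_tvec.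
rewrite (integral_Rd_affine x ltr01); last 2 first.
- apply: meas_vec_EFin; apply: measurable_funM; first exact: measurable_affine.
  by apply: measurable_phi; apply: coord_measD => //; exact: coord_meas_cst.
- by move=> w; rewrite lee_fin mulr_ge0// ltW// phi_gt0.
rewrite expr1n mul1e; congr integral_Rd; apply/funext => z; congr EFin.
congr (f _ * _); last by rewrite scale1r addrC addKr.
by apply/rowP => i; rewrite !mxE; ring.
Qed.

Variables (c0 : R) (c00 : 0 < c0).
Hypothesis tilt : forall x y,
  (phi (y - x) sg / phi (y - mu) vy) `^ q * phi (y - mu) vy * phi (x - mu) vx =
  c0 * (phi (g *: x + (1 - g) *: y - mu) (vx * g) * phi (y - x) sg).

(** At fixed [x], the point [w = g x + (1 - g) y] is Gaussian around [x] with variance [xi^2]. After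
    exchanging the integrals [mu] appears only in the outer weight, so affinities can be compared
    pointwise in [w]. *)
Lemma affinity_factored : affinity pd = (c0%:E * integral_Rd (fun w => (phi (w - mu) (vx * g))%:E *
    integral_Rd (fun x => (M w `^ q * rho x `^ q * phi (w - x) x2)%:E)))%E.
Proof.
have /andP[g0 g1] := gamma_itv; have sg0 : 0 < sg by rewrite divr_gt0.
have v0 : 0 < vx * g by rewrite mulr_gt0.
have x20 : 0 < x2 by rewrite exprn_gt0// xi_gt0.
have ct : coord_meas (fun t : d.-tuple R => tvec t) by exact: coord_meas_tvec.
pose f x w := M w `^ q * rho x `^ q * phi (w - mu) (vx * g).
have f0 x w : 0 <= f x w by rewrite !mulr_ge0 ?powR_ge0// ltW// phi_gt0.
have mf x : measurable_fun setT (fun t : d.-tuple R => f x (tvec t)).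
  apply: measurable_funM; last by apply: measurable_phi; apply: coord_measD => //; exact: coord_meas_cst.
  by apply: measurable_funM => //; exact: (measurableT_comp (measurable_powR q) mM).
have E x : integral_Rd (fun y => ((pd y x / phi (y - mu) vy) `^ q * phi (y - mu) vy *
    phi (x - mu) vx)%:E) = (c0%:E * integral_Rd (fun w => (f x w * phi (w - x) x2)%:E))%E.
  rewrite -affine_phi_integral// -integral_RdZl ?(ltW c00)//; last 2 first.
  - apply: meas_vec_EFin; apply: measurable_funM; first exact: measurable_affine.
    by apply: measurable_phi; apply: coord_measD => //; exact: coord_meas_cst.
  - by move=> y; rewrite lee_fin mulr_ge0// ltW// phi_gt0.
  congr integral_Rd; apply/funext => y; rewrite -EFinM; congr EFin.
  have py : 0 < phi (y - mu) vy by exact: phi_gt0.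
  have pyx : 0 < phi (y - x) sg by exact: phi_gt0.
  rewrite /pd /f.
  have -> : (M (g *: x + (1 - g) *: y) * rho x * phi (y - x) sg / phi (y - mu) vy) `^ q =
    M (g *: x + (1 - g) *: y) `^ q * rho x `^ q * (phi (y - x) sg / phi (y - mu) vy) `^ q.
    rewrite -(mulrA (M _ * rho x)) powRM; last 2 first.
    - by rewrite mulr_ge0.
    - by rewrite divr_ge0 ?(ltW py) ?(ltW pyx).
    by rewrite powRM.
  have := tilt x y.
  move: (phi (y - x) sg / phi (y - mu) vy) => r.
  move: (phi (y - mu) vy) (phi (x - mu) vx) => f1 f2.
  move: (phi (g *: x + (1 - g) *: y - mu) (vx * g)) (phi (y - x) sg) => h1 h2.
  move: (M (g *: x + (1 - g) *: y) `^ q) (rho x `^ q) (r `^ q) => m1 m2 m3 t.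
  have -> : m1 * m2 * m3 * f1 * f2 = m1 * m2 * (m3 * f1 * f2) by ring.
  by rewrite t; ring.
rewrite /affinity; under eq_fun do rewrite E.
have c2 : coord_meas (fun t : d.-tuple R * d.-tuple R => tvec t.2) by exact: coord_meas_tvec.
have c1 : coord_meas (fun t : d.-tuple R * d.-tuple R => tvec t.1) by exact: coord_meas_tvec.
have m2 : meas_vec2 (fun x w => (f x w * phi (w - x) x2)%:E).
  apply: meas_vec2_EFin; apply: measurable_funM; last first.
    by apply: measurable_phi; apply: coord_measD => //; exact: coord_measN.
  apply: measurable_funM.
    apply: measurable_funM; apply: (measurableT_comp (measurable_powR q)).
      exact: (measurableT_comp mM).
    exact: (measurableT_comp mrho).
  by apply: measurable_phi; apply: coord_measD => //; exact: coord_meas_cst.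
have n2 x w : (0 <= (f x w * phi (w - x) x2)%:E)%E.
  by rewrite lee_fin mulr_ge0// ltW// phi_gt0.
rewrite integral_RdZl ?(ltW c00)//; last 2 first.
- exact: meas_vec2_integral.
- by move=> x; exact: integral_Rd_ge0.
rewrite integral_Rd_swap//; congr (_ * integral_Rd _)%E; apply/funext => w.
rewrite -integral_RdZl//.
- by congr integral_Rd; apply/funext => x; rewrite -EFinM /f; congr EFin; ring.
- apply: meas_vec_EFin; apply: measurable_funM.
    by apply: measurable_funM => //; exact: (measurableT_comp (measurable_powR q) mrho).
  by apply: measurable_phi; apply: coord_measD; [exact: coord_meas_cst|exact: coord_measN].
- by move=> x; rewrite lee_fin !mulr_ge0 ?powR_ge0// ltW// phi_gt0.
- by rewrite ltW// phi_gt0.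
Qed.

Hypothesis rhoM : forall x,
  ((rho x)%:E * integral_Rd (fun w => (M w * phi (w - x) x2)%:E) <= 1)%E.
Variables (B : R) (MB : forall w, M w <= B).

Lemma risk_factored : affinity pd \is a fin_num /\
  risk_alpha alpha vx vy mu pd = (C%:E - C%:E * affinity pd)%E.
Proof.
have /andP[g0 g1] := gamma_itv; have sg0 : 0 < sg by rewrite divr_gt0.
have ct : coord_meas (fun t : d.-tuple R => tvec t) by exact: coord_meas_tvec.
have c2 : coord_meas (fun t : d.-tuple R * d.-tuple R => tvec t.2) by exact: coord_meas_tvec.
have c1 : coord_meas (fun t : d.-tuple R * d.-tuple R => tvec t.1) by exact: coord_meas_tvec.
have phi0 (y x : 'rV[R]_d) : 0 < phi (y - x) sg by exact: phi_gt0.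
have mphi x : measurable_fun setT (fun t : d.-tuple R => phi (tvec t - x) sg).
  by apply: measurable_phi; apply: coord_measD => //; exact: coord_meas_cst.
have mx x : meas_vec (fun y => (M (g *: x + (1 - g) *: y) * phi (y - x) sg)%:E).
  by apply: meas_vec_EFin; apply: measurable_funM => //; exact: measurable_affine.
apply: risk_affinity.
- by move=> x y; rewrite !mulr_ge0// ltW.
- apply: measurable_funM; last first.
    by apply: measurable_phi; apply: coord_measD => //; exact: coord_measN.
  apply: measurable_funM; last exact: measurable_tvec_comp.
  by apply: measurable_tvec_comp => //; apply: coord_measD; exact: coord_measZ.
- move=> x; apply: le_trans (rhoM x); rewrite -affine_phi_integral// -integral_RdZl//.
  + rewrite le_eqVlt; apply/orP; left; apply/eqP; congr integral_Rd; apply/funext => y.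
    by rewrite -EFinM mulrA [rho x * _]mulrC.
  + by move=> y; rewrite lee_fin mulr_ge0// ltW.
- move=> x; apply: (@le_Rd_finite _ _ _ (fun y => (B * rho x * phi (y - x) sg)%:E)).
  + apply: meas_vec_EFin; apply: measurable_funM => //; apply: measurable_funM => //.
    exact: measurable_affine.
  + by apply: meas_vec_EFin; exact: measurable_funM.
  + by move=> y; rewrite lee_fin !mulr_ge0// ltW.
  + by move=> y; rewrite lee_fin ler_wpM2r ?(ltW (phi0 _ _))// ler_wpM2r.
  + by apply: Rd_finite_phi => //; rewrite mulr_ge0// (le_trans (M0 0)).
Qed.

End factored.

End risk.

(** * Domination, with the exponent written as integer part plus fraction *)

Lemma predictive_domination (R : realType) (d k : nat) (alpha vx vy th : R) :
  (3 <= d)%N -> -1 < alpha < 1 -> 0 < vx -> 0 < vy -> (0 < k)%N ->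
  0 < th < 1 -> 2 / (1 - alpha) = k%:R + th ->
  vx / vy <= (2 / (1 - alpha)) ^+ 2 * (d%:R + 2) / d%:R * th / (2 * k.+1%:R * k%:R) ->
  forall mu : 'rV[R]_d,
    (risk_alpha alpha vx vy mu (p_H alpha vx vy)
     <= risk_alpha alpha vx vy mu (p_U alpha vx vy))%E.
Proof.
move=> d3 al vx0 vy0 k0 /andP[th0 th1] pE vle mu.
pose bt := beta alpha; pose g := gamma alpha vx vy; pose v := vx * g.
pose p := 1 / bt; pose q := (1 + alpha) / 2; pose tmax := bt ^+ 2 * vx / vy.
have /andP[bt0 bt1] : 0 < bt < 1 := beta_itv al.
have /andP[g0 g1] : 0 < g < 1 := gamma_itv al vx0 vy0.
have v0 : 0 < v by rewrite mulr_gt0.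
have pE' : p = k%:R + th.
  by rewrite -pE /p /bt /beta; field; rewrite subr_eq0 gt_eqF//; case/andP: al.
have k1 : 1 <= k%:R :> R by rewrite ler1n.
have kS : k.+1%:R = k%:R + 1 :> R by rewrite -natr1.
have p0 : 0 < p by rewrite divr_gt0.
have pk : p < k.+1%:R by rewrite pE' kS ltrD2l.
have tmax0 : 0 < tmax by rewrite divr_gt0// mulr_gt0// exprn_gt0.
have /andP[q0 q1] : 0 < q < 1 := exponent_itv al.
have qE0 : p * q = p - 1 by rewrite /p /q /bt /beta; field; rewrite subr_eq0 gt_eqF//; case/andP: al.
pose b := (p - 1) / k.+1%:R.
have kS0 : 0 < k.+1%:R :> R by [].
have p1 : 0 < p - 1 by rewrite pE'; lra.
have b0 : 0 < b by rewrite divr_gt0.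
have b1 : b <= 1 by rewrite ler_pdivrMr// mul1r; lra.
have bE : (1 + b) * k.+1%:R = 2 * k%:R + th.
  by rewrite mulrDl mul1r divfK ?gt_eqF// pE' kS; ring.
have qE : p * q = b * k.+1%:R by rewrite qE0 divfK// gt_eqF.
pose a : R := d%:R / 2 - 1.
have d3R : 3 <= d%:R :> R by rewrite ler_nat.
have a0 : 0 < a by rewrite subr_gt0 ltr_pdivlMr// mul1r; lra.
have ad : d%:R / 2 = a + 1 by rewrite subrK.
(* The hypothesis on [vx / vy] multiplied by [beta^2], which cancels the square of [2 / (1 - alpha)]
   and turns the left side into [tmax]. *)
have tmaxE : 2 * k%:R * tmax * (k.+1%:R * ((a + 1) / (a + 2))) <= th.
  have -> : (a + 1) / (a + 2) = d%:R / (d%:R + 2).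
    by rewrite /a; field; rewrite !gt_eqF//; lra.
  have kR0 : 0 < k%:R :> R by lra.
  have dR0 : 0 < d%:R :> R by lra.
  have h := ler_wpM2l (sqr_ge0 bt) vle.
  have e : bt ^+ 2 * ((2 / (1 - alpha)) ^+ 2 * (d%:R + 2) / d%:R * th / (2 * k.+1%:R * k%:R)) =
      (d%:R + 2) / d%:R * th / (2 * k.+1%:R * k%:R).
    have -> : 2 / (1 - alpha) = bt^-1 by rewrite pE -pE' /p div1r.
    move: (bt) bt0 (k.+1%:R : R) kS0 (k%:R : R) kR0 (d%:R : R) dR0 => x x0 y y0 z z0 t t0.
    by field; rewrite !gt_eqF.
  rewrite e mulrA -/tmax in h.
  move: (tmax) h => t h.
  have dk : 0 <= 2 * k%:R * k.+1%:R * (d%:R / (d%:R + 2)) :> R.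
    by rewrite !mulr_ge0 ?invr_ge0// addr_ge0.
  have := ler_wpM2r dk h.
  have -> : (d%:R + 2) / d%:R * th / (2 * k.+1%:R * k%:R) *
      (2 * k%:R * k.+1%:R * (d%:R / (d%:R + 2))) = th.
    move: (k.+1%:R : R) kS0 (k%:R : R) kR0 (d%:R : R) dR0 => y y0 z z0 s s0.
    by field; rewrite !gt_eqF// addr_gt0.
  by move=> /(le_trans _); apply; rewrite le_eqVlt; apply/orP; left; apply/eqP; ring.
(* Here [b (k + 1) = p - 1 <= k] and [2 (k + 1) (a + 1) / (a + 2) >= 1], so the product is at most
   the left side of [tmaxE], hence at most [th < 1]. *)
have btmax : b * k.+1%:R * tmax < 1.
  rewrite divfK ?gt_eqF//; apply: le_lt_trans th1; apply: le_trans tmaxE.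
  have a12 : 1 / 2 <= (a + 1) / (a + 2).
    move: (a) a0 => z z0; have z2 : 0 < z + 2 by rewrite addr_gt0.
    rewrite -subr_ge0 (_ : _ - _ = z / (2 * (z + 2))); last by field; rewrite gt_eqF.
    by rewrite divr_ge0 ?mulr_ge0 ?(ltW z2) ?(ltW z0).
  have h1 : p - 1 <= k%:R by rewrite pE'; lra.
  have h2 : 1 <= k.+1%:R * 2 * ((a + 1) / (a + 2)).
    move: a12; move: ((a + 1) / (a + 2)) => x; rewrite kS => hx.
    have := ler_wpM2l (ltW kS0) hx; rewrite kS; lra.
  apply: (@le_trans _ _ (k%:R * tmax)); first by rewrite ler_wpM2r// ltW.
  have kt : 0 <= k%:R * tmax by rewrite mulr_ge0// ltW.
  have := ler_wpM2l kt h2; rewrite mulr1 => /le_trans; apply.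
  by rewrite le_eqVlt; apply/orP; left; apply/eqP; ring.
have [K K0 mHE] := m_H_mixture d3 a0 ad v0.
pose M (w : 'rV[R]_d) := (m_H w v) `^ p.
have ME w : M w = marginal_pow a v K p w by rewrite /M mHE.
pose E (x : 'rV[R]_d) := EZ_mH alpha vx vy x.
have x2E : xi alpha vx vy ^+ 2 = v * tmax := xi_sqrE al vx0 vy0.
have ct : coord_meas (fun t : d.-tuple R => tvec t) by exact: coord_meas_tvec.
have M0 w : 0 <= M w by exact: powR_ge0.
have mM : measurable_fun setT (fun t : d.-tuple R => M (tvec t)).
  by under eq_fun do rewrite ME; exact: measurable_marginal.
have EI x : integral_Rd (fun z => (M (x + xi alpha vx vy *: z) * phi z 1)%:E) =
    integral_Rd (fun w => (M w * phi (w - x) (v * tmax))%:E).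
  by rewrite (integral_phi_affine x (xi_gt0 al vx0 vy0) ltr01 mM M0) mulr1 x2E.
have EP x : 0 < E x /\ integral_Rd (fun w => (M w * phi (w - x) (v * tmax))%:E) = (E x)%:E.
  have [E' E'0 [IE _]] := marginal_normaliser a0 v0 K0 p0 pk x tmax0.
  rewrite /E /EZ_mH -/g -/v -/bt -/p EI.
  under eq_fun do rewrite ME.
  by rewrite IE.
have E0 x : 0 < E x by have [] := EP x.
have IE x : integral_Rd (fun w => (M w * phi (w - x) (v * tmax))%:E) = (E x)%:E by have [] := EP x.
have s0 : 0 < v * tmax by rewrite mulr_gt0.
have mE : measurable_fun setT (fun t : d.-tuple R => E (tvec t)).
  apply/measurable_EFinP.
  have -> : EFin \o (fun t : d.-tuple R => E (tvec t)) =
    (fun t => integral_Rd (fun w => (M w * phi (w - tvec t) (v * tmax))%:E)).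
    by apply/funext => t /=; rewrite IE.
  apply: (meas_vec2_integral (f2 := fun x w => (M w * phi (w - x) (v * tmax))%:E)).
    apply: meas_vec2_EFin; apply: measurable_funM.
      exact: (measurable_tvec_comp mM (coord_meas_tvec measurable_snd)).
    apply: measurable_phi; apply: coord_measD; first exact: coord_meas_tvec.
    by apply: coord_measN; exact: coord_meas_tvec.
  by move=> x y; rewrite lee_fin mulr_ge0// ltW// phi_gt0.
have [c0 c00 tilt] := phi_tilt mu al vx0 vy0.
have pHE : p_H alpha vx vy = (fun y x => M (g *: x + (1 - g) *: y) * (E x)^-1 * phi (y - x) (vy / g)) by [].
pose u1 (w : 'rV[R]_d) : R := 1.
have pUE : p_U alpha vx vy = (fun y x => u1 (g *: x + (1 - g) *: y) * u1 x * phi (y - x) (vy / g)).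
  by apply/funext => y; apply/funext => x; rewrite !mul1r.
have one0 w : 0 <= u1 w by [].
have m1 : measurable_fun setT (fun t : d.-tuple R => u1 (tvec t)) by [].
have Ei0 x : 0 <= (E x)^-1 by rewrite invr_ge0 ltW.
have mEi : measurable_fun setT (fun t : d.-tuple R => (E (tvec t))^-1).
  exact: measurable_funinv.
have [fH rH] : affinity alpha vx vy mu (p_H alpha vx vy) \is a fin_num /\
  risk_alpha alpha vx vy mu (p_H alpha vx vy) =
    ((4 / (1 - alpha ^+ 2))%:E - (4 / (1 - alpha ^+ 2))%:E * affinity alpha vx vy mu (p_H alpha vx vy))%E.
  have rM x : ((E x)^-1%:E * integral_Rd (fun w => (M w * phi (w - x) (xi alpha vx vy ^+ 2))%:E) <= 1)%E.
    by rewrite x2E IE -EFinM mulVf// gt_eqF.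
  have MB w : M w <= K `^ p by rewrite ME; exact: marginal_le.
  by rewrite pHE; exact: (risk_factored mu al vx0 vy0 M0 Ei0 mM mEi rM MB).
have [fU rU] : affinity alpha vx vy mu (p_U alpha vx vy) \is a fin_num /\
  risk_alpha alpha vx vy mu (p_U alpha vx vy) =
    ((4 / (1 - alpha ^+ 2))%:E - (4 / (1 - alpha ^+ 2))%:E * affinity alpha vx vy mu (p_U alpha vx vy))%E.
  have rM x : ((u1 x)%:E * integral_Rd (fun w => (u1 w * phi (w - x) (xi alpha vx vy ^+ 2))%:E) <= 1)%E.
    rewrite x2E mul1e; under eq_fun do rewrite /u1 mul1r.
    by rewrite (phi_total v0 x s0).
  have MB w : u1 w <= 1 by [].
  by rewrite pUE; exact: (risk_factored mu al vx0 vy0 one0 one0 m1 m1 rM MB).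
apply: (risk_le al fH fU rH rU).
rewrite pHE pUE (affinity_factored al vx0 vy0 M0 Ei0 mM mEi c00 tilt).
rewrite (affinity_factored al vx0 vy0 one0 one0 m1 m1 c00 tilt).
rewrite lee_wpmul2l ?lee_fin ?(ltW c00)// x2E -/q -/g -/v.
have mphi : meas_vec (fun w => (phi (w - mu) v)%:E).
  by apply: meas_vec_EFin; apply: measurable_phi; apply: coord_measD => //; exact: coord_meas_cst.
have minner (N r : 'rV[R]_d -> R) : measurable_fun setT (fun t : d.-tuple R => N (tvec t)) ->
  measurable_fun setT (fun t : d.-tuple R => r (tvec t)) ->
  meas_vec (fun w => integral_Rd (fun x => (N w `^ q * r x `^ q * phi (w - x) (v * tmax))%:E)).
  move=> mN mr; apply: (meas_vec2_integral (f2 := fun w x => (N w `^ q * r x `^ q * phi (w - x) (v * tmax))%:E)).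
    apply: meas_vec2_EFin; apply: measurable_funM.
      apply: measurable_funM; apply: (measurableT_comp (measurable_powR q)).
        exact: (measurable_tvec_comp mN (coord_meas_tvec measurable_fst)).
      exact: (measurable_tvec_comp mr (coord_meas_tvec measurable_snd)).
    apply: measurable_phi; apply: coord_measD; first exact: coord_meas_tvec.
    by apply: coord_measN; exact: coord_meas_tvec.
  by move=> w x; rewrite lee_fin !mulr_ge0 ?powR_ge0// ltW// phi_gt0.
apply: le_integral_Rd.
- by apply: emeasurable_funM => //; exact: (minner u1 u1).
- by apply: emeasurable_funM => //; exact: minner.
- move=> w; apply: mule_ge0; first by rewrite lee_fin ltW// phi_gt0.
  by apply: integral_Rd_ge0 => x; rewrite lee_fin !mulr_ge0 ?powR_ge0// ltW// phi_gt0.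
move=> w; apply: lee_wpmul2l; first by rewrite lee_fin ltW// phi_gt0.
(* For [p_U] the inner integral is the total mass of a Gaussian, while for [p_H] it is at least 1 by
   [normaliser_flow]. *)
apply: (@le_trans _ _ 1%E).
  under eq_fun do rewrite /u1 one_powR !mul1r phi_sym.
  by rewrite (phi_total v0 w s0).
rewrite ME; apply: (normaliser_flow a0 ad v0 K0 p0 pk tmax0 b0 b1 th0 th1 bE tmaxE btmax q0 qE _ mE E0).
by move=> x; under eq_fun do rewrite -ME; exact: IE.
Qed.

Theorem theorem6 (R : realType) (d : nat) (alpha vx vy : R) (kappa : int) :
  (3 <= d)%N -> -1 < alpha < 1 -> 0 < vx -> 0 < vy ->
  (forall k : int, 2 / (1 - alpha) != k%:~R) ->
  2 / (1 - alpha) < kappa%:~R ->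
  (forall k : int, 2 / (1 - alpha) < k%:~R -> kappa <= k) ->
  vx / vy <= (2 / (1 - alpha)) ^+ 2 * (d%:R + 2) / d%:R
             * (1 - fracpart (kappa%:~R - 2 / (1 - alpha)))
             / (2 * kappa%:~R * (kappa%:~R - 1)) ->
  forall mu : 'rV[R]_d,
    (risk_alpha alpha vx vy mu (p_H alpha vx vy)
     <= risk_alpha alpha vx vy mu (p_U alpha vx vy))%E.
Proof.
move=> d3 al vx0 vy0 pnint pk pmin vle mu.
have /andP[al1 al2] := al; have al2' : 0 < 1 - alpha by rewrite subr_gt0.
have p1 : 1 < 2 / (1 - alpha) by rewrite ltr_pdivlMr// mul1r; lra.
have [p pE] : exists p, p = 2 / (1 - alpha) by eexists.
rewrite -pE in p1 pnint pk pmin vle.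
(* Minimality of [kappa] gives the weak inequality and non-integrality of [p] makes it strict; this
   is what makes [th = p - (kappa - 1)] positive. *)
have pk1 : kappa%:~R - 1 < p.
  have h : (kappa - 1)%:~R = kappa%:~R - 1 :> R by rewrite intrB.
  rewrite ltNge le_eqVlt -h; apply/negP => /predU1P[e|/pmin].
    by have := pnint (kappa - 1); rewrite e eqxx.
  by rewrite lerBrDr gerDl.
(* The difference already lies in [(0, 1)], so one minus its fractional part is [p - (kappa - 1)],
   the [th] of [predictive_domination]. *)
have fE : fracpart (kappa%:~R - p) = kappa%:~R - p.
  rewrite /fracpart (@floor_def _ _ 0) ?subr0//.
  by apply/andP; split; lra.
have [n kE n2] : exists2 n : nat, kappa = n.+1%:Z & (0 < n)%N.
  have : (1 < kappa)%R by rewrite -(ltr_int R); apply: lt_trans pk.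
  by case: kappa {pk pmin vle pk1 fE} => [[|[|n]]|n]// _; exists n.+1.
rewrite fE kE in vle; rewrite kE in pk pk1.
have nR : (n.+1%:Z)%:~R = n%:R + 1 :> R by rewrite natr1.
rewrite nR in pk pk1 vle.
apply: (@predictive_domination R d n alpha vx vy (p - n%:R)) => //.
- by apply/andP; split; lra.
- by rewrite -pE addrC subrK.
- have e1 : 1 - (n%:R + 1 - p) = p - n%:R by ring.
  have e2 : n%:R + 1 - 1 = n%:R :> R by ring.
  by move: vle; rewrite e1 e2 -pE -[n.+1%:R]natr1.
Qed.
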